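(* Let $n\ge 2$, $F$ the free group on $g_1,\dots,g_n$, $F^{(1)}=[F,F]$, $F^{(2)}=[F^{(1)},F^{(1)}]$, and let $w\in F^{(1)}\setminus F^{(2)}$. Let $G$ be a connected semisimple linear algebraic group over a field $K$ of characteristic $0$. If $u\in G(K)$ is a unipotent element, then there exists a group homomorphism $F\to G(K)$ sending $w$ to $u$; equivalently, there exist $Z_1,\dots,Z_n\in G(K)$ with $w(Z_1,\dots,Z_n)=u$.
   Context: $w(Z_1,\dots,Z_n)$ is the value of the word map of $w$, obtained by substituting $Z_i$ for $g_i$. *)

(* Defs.v *)
From HB Require Import structures.
From mathcomp Require Import all_boot all_order all_algebra.
From mathcomp Require Import mpoly.
Set Implicit Arguments.
Unset Strict Implicit.
Unset Printing Implicit Defensive.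
Import Order.TTheory GRing.Theory.
Local Open Scope ring_scope.

(* A letter (i, false) stands for g_i, (i, true) for g_i^-1.            *)
(* Elements of F are represented by words; two words represent the      *)
(* same element of F iff they have the same free reduction [fred].      *)
Definition letter (n : nat) := ('I_n * bool)%type.
Definition word (n : nat) := seq (letter n).

Definition fpush n (x : letter n) (t : word n) : word n :=
  match t with
  | y :: t' => if (y.1 == x.1) && (y.2 != x.2) then t' else x :: t
  | [::] => [:: x]
  end.

Definition fred n (s : word n) : word n := foldr (@fpush n) [::] s.

Definition winv n (s : word n) : word n := rev (map (fun x => (x.1, ~~ x.2)) s).

Definition wcomm n (a b : word n) : word n := winv a ++ winv b ++ a ++ b.

Definition wcomm_prod n (ps : seq (word n * word n)) : word n :=
  flatten (map (fun p => wcomm p.1 p.2) ps).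

Definition in_F1 n (w : word n) : Prop :=
  exists ps : seq (word n * word n), fred w = fred (wcomm_prod ps).

Definition in_F2 n (w : word n) : Prop :=
  exists ps : seq (word n * word n),
    (forall p, p \in ps -> in_F1 p.1 /\ in_F1 p.2) /\
    fred w = fred (wcomm_prod ps).

Definition word_eval (R : comUnitRingType) m n (Z : 'I_n -> 'M[R]_m)
  (w : word n) : 'M[R]_m :=
  foldr (fun x acc => (if x.2 then invmx (Z x.1) else Z x.1) *m acc) 1%:M w.

(* Linear algebraic groups, as closed subgroups of GL_m.                *)
Definition mxpt (R : nzRingType) m (A : 'M[R]_m) : 'I_(m * m) -> R :=
  fun i => mxvec A 0 i.

Definition Kpoints (K : fieldType) m (S : seq {mpoly K[m * m]})
  (A : 'M[K]_m) : Prop :=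
  A \in unitmx /\ forall p, p \in S -> p.@[mxpt A] = 0.

Definition Lpoints (K L : fieldType) (f : {rmorphism K -> L}) m
  (S : seq {mpoly K[m * m]}) (A : 'M[L]_m) : Prop :=
  A \in unitmx /\ forall p, p \in S -> (map_mpoly f p).@[mxpt A] = 0.

Definition mxset (L : fieldType) m := 'M[L]_m -> Prop.

Definition zclosed_in (L : fieldType) m (X Y : mxset L m) : Prop :=
  exists T : seq {mpoly L[m * m]},
    forall A, Y A <-> (X A /\ forall p, p \in T -> p.@[mxpt A] = 0).

Definition zconnected (L : fieldType) m (X : mxset L m) : Prop :=
  ~ exists Y1 Y2 : mxset L m,
      [/\ zclosed_in X Y1 /\ zclosed_in X Y2,
          (exists A, Y1 A) /\ (exists A, Y2 A),
          (forall A, X A <-> (Y1 A \/ Y2 A)) &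
          (forall A, ~ (Y1 A /\ Y2 A))].

Definition is_subgroup (L : fieldType) m (H : mxset L m) : Prop :=
  [/\ H 1%:M,
      (forall A, H A -> A \in unitmx),
      (forall A B, H A -> H B -> H (A *m B)) &
      (forall A, H A -> H (invmx A))].

Definition is_normal_in (L : fieldType) m (H G : mxset L m) : Prop :=
  forall A B, G A -> H B -> H (invmx A *m B *m A).

Definition mxcomm (L : fieldType) m (A B : 'M[L]_m) : 'M[L]_m :=
  invmx A *m invmx B *m A *m B.

Definition derived (L : fieldType) m (H : mxset L m) : mxset L m :=
  fun A => exists ps : seq ('M[L]_m * 'M[L]_m),
    (forall p, p \in ps -> H p.1 /\ H p.2) /\
    A = foldr (fun p acc => mxcomm p.1 p.2 *m acc) 1%:M ps.

Definition mx_solvable (L : fieldType) m (H : mxset L m) : Prop :=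
  exists k, forall A, iter k (@derived L m) H A -> A = 1%:M.

(* semisimple: the radical (largest connected solvable closed normal
   subgroup) is trivial, i.e. every such subgroup is trivial *)
Definition mx_semisimple (L : fieldType) m (G : mxset L m) : Prop :=
  forall H : mxset L m,
    zclosed_in G H -> is_subgroup H -> is_normal_in H G ->
    zconnected H -> mx_solvable H -> forall A, H A -> A = 1%:M.

Definition algebraic_ext (K L : fieldType) (f : {rmorphism K -> L}) : Prop :=
  forall x : L, exists p : {poly K}, p != 0 /\ root (map_poly f p) x.

Definition mx_unipotent (K : fieldType) m (u : 'M[K]_m) : Prop :=
  exists k, iter k (mulmx (u - 1%:M)) 1%:M = 0.

(* Main.v *)
(** A unipotent [u] is [exp N] with [N] nilpotent in the Lie algebra of [G].  The
    trace form of this Lie algebra is nondegenerate: by Cartan's argument its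
    radical consists of nilpotent matrices, so by Engel's theorem their
    exponentials lie in a unipotent closed connected normal subgroup, which is
    trivial since [G] is semisimple.  As in the Jacobson-Morozov theorem, nondegeneracy gives a
    nilpotent [y] in the Lie algebra with [[[N, y], N] = 2 N]; an affine
    combination of its conjugates is defined over [K].  Then [h = [N, y]] has
    integral eigenvalues, and its semisimple part integrates to elements [g_t] of
    [G(K)] such that [g_t exp(c N) = exp(t^2 c N) g_t].  The elements
    [exp(c N) g_t] multiply like affine maps [x |-> t^2 x + c], and the value of
    [w] at such elements is [exp(c N)], where [c] is linear in the translation
    parts, with coefficients counting the signed passages of the path of [w]
    through the edges of the grid [Z^n].  If all these counts vanished, [w] would
    be a product of loops cancelling in pairs, hence would lie in [F^(2)]. *)

Require Import Defs.
From HB Require Import structures.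
From mathcomp Require Import all_boot all_order all_algebra.
From mathcomp Require Import separable.
From mathcomp Require Import mpoly zify ring.
From Stdlib Require Import Classical.
Set Implicit Arguments.
Unset Strict Implicit.
Unset Printing Implicit Defensive.
Import Order.TTheory GRing.Theory Num.Theory.
Local Open Scope ring_scope.

(** * Words *)

(** Semisimplicity, Cartan's argument and the eigenvalues it uses live over [L], while the answer is
    wanted over [K]. What is sought over [L] is therefore kept affine: the single equation [[N,
    [N, y]] = - 2 N] says that [h = [N, y]] satisfies [[h, N] = 2 N], and it survives affine
    combinations of conjugates of [y], as membership in the Lie algebra does. The price is that [h]
    may have a nilpotent part, so [g_t] is the sum of the [t^a e_a], where the [e_a] are the
    spectral projectors of [h]; they are polynomials in [h], defined over [K] because the
    eigenvalues are integers. Since [N] has weight [2], [g_t] scales it by [t^2], and the counts of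
    [w] have to be detected at squares. One principle gives both the membership of [g_t] in [G] and
    the replicas of Cartan's argument: an operator acting on the generalized weight vectors of a
    derivation by scalars that depend only on the weight preserves every subspace stable under the
    derivation, in particular the ideal of the group. *)

Section FreeGroup.
Variable n : nat.
Implicit Types (x y : letter n) (s t a b c w : word n).

Definition linv x : letter n := (x.1, ~~ x.2).

Definition cancels x y := (y.1 == x.1) && (y.2 != x.2).

Definition reduced t := sorted (fun x y => ~~ cancels x y) t.

Definition feq a b := fred a = fred b.

Lemma linvK : involutive linv.
Proof. by case=> i b; rewrite /linv /= negbK. Qed.

Lemma cancelsE x y : cancels x y = (y == linv x).
Proof.
case: x y => [i b] [j d]; rewrite /cancels /linv /= xpair_eqE.
by case: b; case: d.
Qed.

Lemma fpushE x y t :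
  fpush x (y :: t) = if y == linv x then t else [:: x, y & t].
Proof. by rewrite -cancelsE. Qed.

Lemma fpush_reduced x t : reduced t -> reduced (fpush x t).
Proof.
case: t => // y t red_yt; rewrite fpushE; case: ifP => [_|nyx].
  exact: path_sorted red_yt.
by rewrite /reduced /= cancelsE nyx.
Qed.

(** Reducedness matters when [fpush x] deletes a head [linv x]: the next letter is then not [x], so
    pushing [linv x] puts the head back instead of cancelling again. *)
Lemma fpushK x t : reduced t -> fpush (linv x) (fpush x t) = t.
Proof.
case: t => [|y t] red_t; first by rewrite [fpush x _]/= fpushE linvK eqxx.
rewrite (fpushE x); case: eqP => [y_x|_]; last by rewrite fpushE linvK eqxx.
case: t red_t => [|z t]; first by rewrite y_x.
rewrite fpushE linvK y_x /reduced /= cancelsE linvK.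
by case: eqP.
Qed.

Lemma foldr_fpush_reduced w t : reduced t -> reduced (foldr (@fpush n) t w).
Proof. by move=> red_t; elim: w => //= x w; apply: fpush_reduced. Qed.

(** Van der Waerden's trick: [fpush x] and [fpush (linv x)] are mutually inverse on reduced words,
    so a word acts there as its free reduction does. *)
Lemma foldr_fpush_fred w t :
  reduced t -> foldr (@fpush n) t w = foldr (@fpush n) t (fred w).
Proof.
move=> red_t; elim: w => //= x w ->; case: (fred w) => //= y v.
rewrite -/(cancels x y) cancelsE; case: eqP => // ->.
by rewrite -{1}[x]linvK fpushK // foldr_fpush_reduced.
Qed.

Lemma fred_cat a b : fred (a ++ b) = foldr (@fpush n) (fred b) (fred a).
Proof. by rewrite /fred foldr_cat foldr_fpush_fred // foldr_fpush_reduced. Qed.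

Lemma feq_cat a b c d : feq a b -> feq c d -> feq (a ++ c) (b ++ d).
Proof. by rewrite /feq !fred_cat => -> ->. Qed.

Lemma winv_cons x a : winv (x :: a) = winv a ++ [:: linv x].
Proof. by rewrite /winv /= rev_cons -cats1. Qed.

Lemma winv_cat a b : winv (a ++ b) = winv b ++ winv a.
Proof. by rewrite /winv map_cat rev_cat. Qed.

Lemma winvK : involutive (@winv n).
Proof.
move=> a; rewrite /winv map_rev revK -map_comp -[RHS]map_id.
by apply: eq_map => x; exact: linvK.
Qed.

Lemma feq_winvr a : feq (a ++ winv a) [::].
Proof.
elim: a => // x a IH; rewrite winv_cons /= catA.
have eq_x : feq ([:: x] ++ (a ++ winv a) ++ [:: linv x]) ([:: x] ++ [::] ++ [:: linv x]).
  by do !apply: feq_cat.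
apply: etrans eq_x _; by rewrite /fred /= eqxx; case: (x.2).
Qed.

Lemma feq_cancel_mid a b c : feq (a ++ b ++ winv b ++ c) (a ++ c).
Proof.
rewrite [b ++ _]catA; apply: feq_cat => //.
exact: (feq_cat (feq_winvr b) (erefl (fred c))).
Qed.

Lemma feq_cancel_midV a b c : feq (a ++ winv b ++ b ++ c) (a ++ c).
Proof. by have := feq_cancel_mid a (winv b) c; rewrite winvK. Qed.

End FreeGroup.

Section Commutators.
Variable n : nat.
Implicit Types (a b w : word n).

Lemma wcomm_prod_cat (ps qs : seq (word n * word n)) :
  wcomm_prod (ps ++ qs) = wcomm_prod ps ++ wcomm_prod qs.
Proof. by rewrite /wcomm_prod map_cat flatten_cat. Qed.

Lemma in_F1_feq a b : feq a b -> in_F1 b -> in_F1 a.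
Proof. by rewrite /feq => eq_ab [ps eq_b]; exists ps; rewrite eq_ab. Qed.

Lemma in_F2_feq a b : feq a b -> in_F2 b -> in_F2 a.
Proof. by rewrite /feq => eq_ab [ps [F1ps eq_b]]; exists ps; rewrite eq_ab. Qed.

Lemma in_F1_cat a b : in_F1 a -> in_F1 b -> in_F1 (a ++ b).
Proof.
move=> [ps eq_a] [qs eq_b]; exists (ps ++ qs); rewrite wcomm_prod_cat.
exact: feq_cat.
Qed.

Lemma in_F2_cat a b : in_F2 a -> in_F2 b -> in_F2 (a ++ b).
Proof.
move=> [ps [F1ps eq_a]] [qs [F1qs eq_b]]; exists (ps ++ qs); split.
  by move=> p; rewrite mem_cat => /orP[]; [apply: F1ps | apply: F1qs].
by rewrite wcomm_prod_cat; apply: feq_cat.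
Qed.

Lemma in_F1_comm a b : in_F1 (wcomm a b).
Proof. by exists [:: (a, b)]; rewrite /wcomm_prod /= cats0. Qed.

Lemma in_F2_comm a b : in_F1 a -> in_F1 b -> in_F2 (wcomm a b).
Proof.
move=> F1a F1b; exists [:: (a, b)]; rewrite /wcomm_prod /= cats0; split=> // p.
by rewrite inE => /eqP->.
Qed.

Lemma in_F1_nil : in_F1 ([::] : word n).
Proof. by exists [::]. Qed.

Lemma in_F2_nil : in_F2 ([::] : word n).
Proof. by exists [::]. Qed.

(** Signed words over an arbitrary index type: with letters as indices they give the criterion for
    [F^(1)], with loops of the grid the one for [F^(2)]. *)
Definition sgval (T : Type) (g : T -> word n) (e : T * bool) : word n :=
  if e.2 then winv (g e.1) else g e.1.

Definition spval (T : Type) (g : T -> word n) (l : seq (T * bool)) : word n :=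
  flatten (map (sgval g) l).

Definition netcount (T : eqType) (l : seq (T * bool)) (e : T) : int :=
  \sum_(x <- l) (if x.1 == e then (-1) ^+ x.2 else 0).

Lemma netcount_cons (T : eqType) (x : T * bool) l e :
  netcount (x :: l) e = (if x.1 == e then (-1) ^+ x.2 else 0) + netcount l e.
Proof. exact: big_cons. Qed.

Lemma netcount_cat (T : eqType) (l1 l2 : seq (T * bool)) e :
  netcount (l1 ++ l2) e = netcount l1 e + netcount l2 e.
Proof. exact: big_cat. Qed.

(* A letter [e] and a later inverse occurrence of it cancel at the cost of
   one commutator, which lies in [N]. *)
Lemma netcount0_mem (T : eqType) (g : T -> word n) (H N : word n -> Prop) :
    (forall e, H (g e)) -> (forall e, H (winv (g e))) -> H [::] ->
    (forall a b, H a -> H b -> H (a ++ b)) ->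
    N [::] -> (forall a b, N a -> N b -> N (a ++ b)) ->
    (forall a b, feq a b -> N b -> N a) ->
    (forall a b, H a -> H b -> N (wcomm a b)) ->
  forall l, (forall e, netcount l e = 0) -> N (spval g l).
Proof.
move=> Hg HgV H0 HM N0 NM Neq Ncomm l.
have Hsp k : H (spval g k).
  elim: k => // x k IH; rewrite /spval /=; apply: HM => //.
  by rewrite /sgval; case: ifP.
have HspV k : H (winv (spval g k)).
  elim: k => // x k IH; rewrite /spval /= winv_cat; apply: HM => //.
  by rewrite /sgval; case: ifP; rewrite ?winvK.
elim: {l}(size l) {-2}l (leqnn (size l)) => [|k IH] [|[e b] l] //= lt_l_k net0.
have e_l : (e, ~~ b) \in l.
  (* Without an occurrence of [(e, ~~ b)], all terms of index [e] have the same sign and there is at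
     least one, so the count cannot vanish. *)
  apply/negPn/negP => eNl; have := net0 e; rewrite netcount_cons eqxx.
  rewrite /netcount (_ : \sum_(x <- l) _ = \sum_(x <- l | x == (e, b)) (-1) ^+ b); last first.
    rewrite [RHS]big_mkcond; apply: eq_big_seq => -[e' b'] e_in.
    rewrite xpair_eqE /=; case: eqP => //= ee'; case: eqP => [->//|/eqP nb].
    by case/negP: eNl; rewrite -ee'; move: nb e_in; case: (b); case: (b').
  rewrite big_const_seq iter_addr addr0 -mulrS => /eqP.
  by rewrite -mulr_natr mulf_eq0 signr_eq0 pnatr_eq0.
have [l1 [l2 def_l]] : exists l1 l2, l = l1 ++ (e, ~~ b) :: l2.
  by case/splitPr: e_l => l1 l2; exists l1, l2.
set x := sgval g (e, b); set a := spval g l1.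
have xV : sgval g (e, ~~ b) = winv x by rewrite /x /sgval /=; case: (b); rewrite ?winvK.
have -> : spval g ((e, b) :: l) = x ++ a ++ winv x ++ spval g l2.
  by rewrite def_l /spval /= map_cat flatten_cat /= xV.
(* The commutator is [x a x^-1 a^-1]; what remains, [a] followed by the value of [l2], is shorter by
   two signed letters. *)
apply: (Neq _ (wcomm (winv x) (winv a) ++ (spval g (l1 ++ l2)))).
  rewrite /wcomm !winvK /spval map_cat flatten_cat -/(spval g l2) -/a.
  have := feq_cancel_midV (x ++ a ++ winv x) a (spval g l2).
  by rewrite /feq -!catA => ->.
apply: (NM).
  apply: Ncomm; last exact: HspV.
  by rewrite /x /sgval /=; case: (b); rewrite ?winvK.
apply: IH => [|e'].
  by move: lt_l_k; rewrite def_l !size_cat /= addnS ltnS => /ltnW.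
have := net0 e'; rewrite def_l !(netcount_cat, netcount_cons) => net0e.
rewrite -[RHS]net0e; case: eqP => _; rewrite ?add0r // signrN.
by rewrite addrCA [(-1) ^+ _ + _]addrA subrr add0r.
Qed.

End Commutators.

(** * Paths in the grid and affine evaluation *)

Section GridPaths.
Variable n : nat.
Implicit Types (x : letter n) (v : 'rV[int]_n) (w : word n).

Definition gridstep x : 'rV[int]_n :=
  if x.2 then - delta_mx 0 x.1 else delta_mx 0 x.1.

Definition disp w : 'rV[int]_n := \sum_(x <- w) gridstep x.

(* The signed edges of the grid crossed by the path of [w] issued from [v]; the
   edge from [u] to [u + e_i] is denoted by [(u, i)]. *)
Fixpoint edges v w : seq ('rV[int]_n * 'I_n * bool) :=
  if w is x :: w' then
    (if x.2 then v + gridstep x else v, x.1, x.2) :: edges (v + gridstep x) w'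
  else [::].

(** A fixed path from the origin to [v], direction after direction: a transversal of [F^(1)] in
    [F]. *)
Definition tau v : word n :=
  flatten [seq nseq (absz (v 0 j)) (j, v 0 j < 0) | j <- enum 'I_n].

(** The Schreier generators of [F^(1)] attached to [tau]: reach the edge, cross it, return by the
    fixed path. *)
Definition loop (e : 'rV[int]_n * 'I_n) : word n :=
  tau e.1 ++ [:: (e.2, false)] ++ winv (tau (e.1 + delta_mx 0 e.2)).

Lemma disp_cons x w : disp (x :: w) = gridstep x + disp w.
Proof. exact: big_cons. Qed.

Lemma disp_cat a b : disp (a ++ b) = disp a + disp b.
Proof. exact: big_cat. Qed.

Lemma gridstep_linv x : gridstep (linv x) = - gridstep x.
Proof. by rewrite /gridstep; case: x => i [] /=; rewrite ?opprK. Qed.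

Lemma disp_winv a : disp (winv a) = - disp a.
Proof.
elim: a => [|x a IH]; first by rewrite /disp !big_nil oppr0.
rewrite winv_cons disp_cat IH !disp_cons gridstep_linv /disp big_nil addr0.
by rewrite opprD addrC.
Qed.

Lemma disp_fred w : disp (fred w) = disp w.
Proof.
elim: w => //= x w IH; rewrite [RHS]disp_cons -IH; case: (fred w) => [|y t].
  by rewrite disp_cons.
rewrite fpushE; case: eqP => [->|_]; last by rewrite disp_cons.
by rewrite disp_cons gridstep_linv addrA subrr add0r.
Qed.

Lemma disp_in_F1 w : in_F1 w -> disp w = 0.
Proof.
case=> ps eq_w; rewrite -disp_fred eq_w disp_fred {eq_w}.
elim: ps => [|[a b] ps IH]; first by rewrite /disp big_nil.
rewrite /wcomm_prod /= disp_cat IH /wcomm !disp_cat !disp_winv addr0.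
by rewrite [disp a + _]addrC addKr addNr.
Qed.

Lemma disp_netcount w i : disp w 0 i = netcount w i.
Proof.
elim: w => [|x w IH]; first by rewrite /disp /netcount !big_nil mxE.
rewrite disp_cons netcount_cons mxE IH /gridstep; congr (_ + _).
by case: x => j [] /=; rewrite !mxE eqxx /= [i == j]eq_sym; case: eqP.
Qed.

Lemma in_F1_disp w : disp w = 0 -> in_F1 w.
Proof.
move=> disp0; have -> : w = spval (fun i => [:: (i, false)]) w.
  by elim: w {disp0} => // -[i []] w IH; rewrite {1}IH.
apply: (netcount0_mem (H := fun=> True)) => //.
- exact: in_F1_nil.
- exact: in_F1_cat.
- exact: in_F1_feq.
- by move=> a b _ _; apply: in_F1_comm.
- by move=> i; rewrite -disp_netcount disp0 mxE.
Qed.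

Lemma disp_nseq k x : disp (nseq k x) = gridstep x *+ k.
Proof.
by elim: k => [|k IH] /=; rewrite ?disp_cons ?IH ?mulrS // /disp big_nil.
Qed.

Lemma disp_tau v : disp (tau v) = v.
Proof.
rewrite [RHS]row_sum_delta /tau -[index_enum _]enumT /=.
elim: (enum _) => [|j s IH]; first by rewrite /disp !big_nil.
rewrite big_cons /= disp_cat disp_nseq IH /gridstep /=; congr (_ + _).
case: ltrP => vj; rewrite -scaler_nat.
  by rewrite scalerN -scaleNr natz abszE ltr0_norm // opprK.
by rewrite natz abszE ger0_norm.
Qed.

Lemma in_F1_loop e : in_F1 (loop e).
Proof.
apply: in_F1_disp; rewrite /loop !disp_cat disp_winv !disp_tau.
by rewrite disp_cons /disp big_nil /gridstep /= addr0 addrA subrr.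
Qed.

Lemma in_F1_winv_loop e : in_F1 (winv (loop e)).
Proof. by apply: in_F1_disp; rewrite disp_winv (disp_in_F1 (in_F1_loop e)) oppr0. Qed.

(** Telescoping: a detour to the origin and back, [winv (tau v') ++ tau v'], is inserted at each
    vertex [v'] of the path. *)
Lemma feq_loops v w :
  feq (tau v ++ w ++ winv (tau (v + disp w))) (spval loop (edges v w)).
Proof.
elim: w v => [|x w IH] v.
  by rewrite /disp big_nil addr0 /=; apply: feq_winvr.
set v' := v + gridstep x; rewrite disp_cons addrA -/v'.
have -> : spval loop (edges v (x :: w)) =
    (tau v ++ [:: x]) ++ winv (tau v') ++ spval loop (edges v' w).
  rewrite /spval /= -/v' /sgval /loop /v' /gridstep; case: x @v' => i [] v' /=.
    by rewrite winv_cat winv_cons winvK subrK -!catA.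
  by rewrite -!catA.
have /(feq_cat (erefl (fred (winv (tau v'))))) := IH v'.
move=> /(feq_cat (erefl (fred (tau v ++ [:: x])))); rewrite /feq => <-.
by have := feq_cancel_midV (tau v ++ [:: x]) (tau v') (w ++ winv (tau (v' + disp w)));
  rewrite /feq -!catA => ->.
Qed.

Lemma in_F2_edges w :
  in_F1 w -> (forall e, netcount (edges 0 w) e = 0) -> in_F2 w.
Proof.
move=> F1w net0; apply: (@in_F2_feq _ _ (spval loop (edges 0 w))); last first.
  apply: (netcount0_mem (H := @in_F1 n)) => //.
  - exact: in_F1_loop.
  - exact: in_F1_winv_loop.
  - exact: in_F1_nil.
  - exact: in_F1_cat.
  - exact: in_F2_nil.
  - exact: in_F2_cat.
  - exact: in_F2_feq.
  - exact: in_F2_comm.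
have := feq_loops 0 w; rewrite (disp_in_F1 F1w) addr0.
suff -> : tau 0 = [::] by rewrite cats0.
by rewrite /tau; elim: (enum _) => //= j s ->; rewrite mxE.
Qed.

Lemma netcount_edge_neq0 w :
  in_F1 w -> ~ in_F2 w -> exists e, netcount (edges 0 w) e != 0.
Proof.
move=> F1w nF2w; set l := edges 0 w.
have [/hasP[y _ nz]|/hasPn no_e] := boolP (has (fun y => netcount l y.1 != 0) l).
  by exists y.1.
case: nF2w; apply: in_F2_edges => // e; rewrite -/l.
have [/hasP[y y_l /eqP ye]|/hasPn noe] := boolP (has (fun y => y.1 == e) l).
  by have := no_e y y_l; rewrite negbK ye => /eqP.
by rewrite /netcount big1_seq // => y /andP[_ /noe /negPf ->].
Qed.

End GridPaths.

Lemma ex_nonroot (R : idomainType) (a : nat -> R) (p : {poly R}) :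
  injective a -> p != 0 -> exists k, p.[a k] != 0.
Proof.
move=> inj_a p0; have [/hasP[k _ nz]|/hasPn all0] :=
  boolP (has (fun k => p.[a k] != 0) (iota 0 (size p))); first by exists k.
suff : (size (map a (iota 0 (size p))) < size p)%N.
  by rewrite size_map size_iota ltnn.
apply: max_poly_roots => //; last by rewrite map_inj_uniq ?iota_uniq.
by apply/allP => _ /mapP[k k_p ->]; have := all0 k k_p; rewrite negbK.
Qed.

Lemma intr_char0_eq0 (F : fieldType) (z : int) :
  [pchar F] =i pred0 -> (z%:~R == 0 :> F) = (z == 0).
Proof.
move=> /pcharf0P natF0; case: z => k; first by rewrite -pmulrn natF0.
by rewrite NegzE mulrNz oppr_eq0 -pmulrn natF0 oppr_eq0.
Qed.

(** The value at [B] of the polynomial with coefficients [v]: an additive map that turns vertices of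
    the grid into exponents. *)
Definition gridform n (B : int) (v : 'rV[int]_n) : int := \sum_j v 0 j * B ^+ j.

Lemma gridformD n B (u v : 'rV[int]_n) :
  gridform B (u + v) = gridform B u + gridform B v.
Proof. by rewrite /gridform -big_split; apply: eq_bigr => j _; rewrite mxE mulrDl. Qed.

(** For each [u != v] the difference of the two values is a nonzero polynomial in [B]; any [B]
    outside the roots of the product of these polynomials works. *)
Lemma gridform_separates n (v : 'rV[int]_n) (l : seq 'rV[int]_n) :
  exists B, forall u, u \in l -> u != v -> gridform B u != gridform B v.
Proof.
pose pol u : {poly int} := \sum_(j < n) (u - v) 0 j *: 'X^j.
have polE u B : (pol u).[B] = gridform B u - gridform B v.
  rewrite /pol horner_sum /gridform -sumrB; apply: eq_bigr => j _.
  by rewrite !hornerE !mxE mulrBl.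
have pol0 u : u != v -> pol u != 0.
  move=> nuv; apply/eqP => /polyP pu0; case/eqP: nuv.
  apply/rowP => j; apply/eqP; rewrite -subr_eq0; apply/eqP.
  have := pu0 j; rewrite coef0 /pol coef_sum => <-.
  rewrite (bigD1 j) //= coefZ coefXn eqxx mulr1 big1 ?addr0 ?mxE // => i nij.
  by rewrite coefZ coefXn eq_sym (inj_eq val_inj) (negPf nij) mulr0.
pose P := \prod_(u <- l | u != v) pol u.
have P0 : P != 0 by rewrite prodf_seq_neq0; apply/allP => u _; apply/implyP/pol0.
have [k nz] := @ex_nonroot int (fun k => k%:Z) P (fun _ _ => @congr1 _ _ absz _ _) P0.
exists k%:Z => u u_l nuv; rewrite -subr_eq0 -polE; apply: contraNneq nz => pu0.
by rewrite /P (big_rem u) //= nuv hornerM pu0 mul0r.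
Qed.

(** Up to the factor [q ^ (2 C)], which makes all exponents nonnegative, the sum is the value at
    [q^2] of the polynomial [P]. Its coefficient at [ex v] is the net count of [v], since the choice
    of [B] keeps the other vertices away from this exponent; so [P] is nonzero in characteristic
    [0]. *)
Lemma netcount_nonvanishing n (K : fieldType) (l : seq ('rV[int]_n * bool)) v :
    [pchar K] =i pred0 -> netcount l v != 0 ->
  exists B : int, exists2 q : K, q != 0 &
    \sum_(x <- l) (-1) ^+ x.2 * q ^ (gridform B x.1 *+ 2) != 0.
Proof.
move=> K0 nz_v; have /pcharf0P natK0 := K0.
have [B sepB] := gridform_separates v [seq x.1 | x <- l].
pose C : nat := \sum_(x <- l) absz (gridform B x.1).
have C_ge x : x \in l -> (0 <= gridform B x.1 + C%:Z).
  by move=> x_l; rewrite /C (big_rem x) //=; lia.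
pose ex (x : 'rV[int]_n) := absz (gridform B x + C%:Z).
pose P : {poly K} := \sum_(x <- l) (-1) ^+ x.2 *: 'X^(ex x.1).
have P0 : P != 0.
  apply/eqP => /polyP/(_ (ex v)); rewrite coef0 /P coef_sum.
  rewrite (_ : \sum_(x <- l) _ = (netcount l v)%:~R).
    by move/eqP; rewrite intr_char0_eq0 // (negPf nz_v).
  have v_l : v \in [seq x.1 | x <- l].
    apply: contraNT nz_v => v_nl; rewrite /netcount big1_seq // => x /andP[_ x_l].
    by case: eqP => // xv; case/negP: v_nl; rewrite -xv map_f.
  have v_ge : 0 <= gridform B v + C%:Z by case/mapP: v_l => x /C_ge ? ->.
  rewrite /netcount rmorph_sum /=; apply: eq_big_seq => x x_l.
  rewrite coefZ coefXn; have [->|xv] := eqVneq x.1 v.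
    by rewrite eqxx mulr1 rmorph_sign.
  case: eqP => [ex_eq|]; last by rewrite mulr0.
  case/eqP: (sepB x.1 (map_f _ x_l) xv); apply: (addIr C%:Z).
  by rewrite -(gez0_abs (C_ge x x_l)) -(gez0_abs v_ge); congr Posz.
(* Squares of positive integers are nonzero and pairwise distinct in [K], so one of them is not a
   root of [P]. *)
have [|k nz] := @ex_nonroot K (fun k => (k.+1)%:R ^+ 2) P _ P0.
  move=> i j /eqP; rewrite eqf_sqr => /orP[]/eqP.
    move=> eq_ij; apply/eqP; wlog le_ij: i j eq_ij / (i <= j)%N => [IH|].
      by case/orP: (leq_total i j) => /IH; [|rewrite eq_sym]; apply.
    have : (j - i)%:R == 0 :> K by rewrite -subSS natrB // eq_ij subrr.
    by rewrite natK0 subn_eq0 eqn_leq le_ij.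
  move/eqP; rewrite -subr_eq0 opprK -natrD natK0.
  by rewrite addSn.
have q0 : k.+1%:R != 0 :> K by rewrite natK0.
exists B, k.+1%:R => //; apply: contraNneq nz => sum0.
apply/eqP; rewrite /P horner_sum.
transitivity (k.+1%:R ^ (C%:Z *+ 2) *
    \sum_(x <- l) (-1) ^+ x.2 * k.+1%:R ^ (gridform B x.1 *+ 2) : K);
  last by rewrite sum0 mulr0.
rewrite mulr_sumr; apply: eq_big_seq => x x_l; rewrite hornerZ hornerXn mulrCA.
congr (_ * _); rewrite -expfzDr // -mulrnDl addrC -(gez0_abs (C_ge x x_l)).
by rewrite -[_ *+ 2]mulr_natl natz -PoszM -exprM.
Qed.

Lemma invmx_uniq (R : comUnitRingType) m (A B : 'M[R]_m) :
  A *m B = 1%:M -> invmx A = B.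
Proof.
by move=> AB1; have [uA _] := mulmx1_unit AB1; rewrite -[LHS]mulmx1 -AB1 mulKmx.
Qed.

Section AffineEvaluation.
Variables (n m : nat) (K : fieldType) (q : K) (B : int).
Variables (E g : K -> 'M[K]_m) (s : 'I_n -> K).
Hypothesis q0 : q != 0.
Hypothesis E0 : E 0 = 1%:M.
Hypothesis ED : forall a b, E (a + b) = E a *m E b.
Hypothesis g1 : g 1 = 1%:M.
Hypothesis gM : forall a b, a != 0 -> b != 0 -> g (a * b) = g a *m g b.
Hypothesis gE : forall t c, t != 0 -> g t *m E c = E (t ^+ 2 * c) *m g t.

Let T (v : 'rV_n) := g (q ^ gridform B v).

Let TD u v : T (u + v) = T u *m T v.
Proof. by rewrite /T gridformD expfzDr // gM ?expfz_neq0. Qed.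

Let T0 : T (0 : 'rV_n) = 1%:M.
Proof. by rewrite /T /gridform big1 ?expr0z ?g1 // => j _; rewrite mxE mul0r. Qed.

Let TE (v : 'rV_n) c : T v *m E c = E (q ^ (gridform B v *+ 2) * c) *m T v.
Proof. by rewrite /T gE ?expfz_neq0 // exprnP exprz_exp -[_ *+ 2]mulr_natr natz. Qed.

Let Z i := E (s i) *m T (delta_mx 0 i).

(** The prefix [T v] keeps track of the current vertex: moving it past [E (s i)] multiplies the
    translation by [q ^ (2 * gridform B v)], the weight of the edge leaving [v]. An inverse letter
    first moves to [v - e_i], which is the base point that [edges] records for it. *)
Lemma word_eval_affine v w :
  T v *m word_eval Z w =
  E (\sum_(x <- edges v w) (-1) ^+ x.2 * q ^ (gridform B x.1.1 *+ 2) * s x.1.2)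
    *m T (v + disp w).
Proof.
elim: w v => [|[i b] w IH] v.
  by rewrite /= big_nil E0 mulmx1 mul1mx /disp big_nil addr0.
rewrite disp_cons addrA /= big_cons /= ED /= -mulmxA -IH /gridstep /=.
case: b => /=; last first.
  by rewrite /Z !mulmxA TE expr0 mul1r -[_ *m T v *m T _]mulmxA -TD.
have -> : invmx (Z i) = T (- delta_mx 0 i) *m E (- s i).
  apply: invmx_uniq; rewrite /Z mulmxA -[E _ *m _ *m _]mulmxA -TD subrr T0 mulmx1.
  by rewrite -ED subrr E0.
by rewrite !mulmxA -TD TE expr1 mulN1r mulNr mulrN.
Qed.

End AffineEvaluation.

(* The group generated by the [E c] and the [g t] is a quotient of an affine
   group, and free metabelian groups embed in products of affine groups. *)
Lemma word_eval_surjective n (w : word n) (K : fieldType) m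
    (E g : K -> 'M[K]_m) :
    in_F1 w -> ~ in_F2 w -> [pchar K] =i pred0 ->
    E 0 = 1%:M -> (forall a b, E (a + b) = E a *m E b) ->
    g 1 = 1%:M ->
    (forall a b, a != 0 -> b != 0 -> g (a * b) = g a *m g b) ->
    (forall t c, t != 0 -> g t *m E c = E (t ^+ 2 * c) *m g t) ->
  exists2 Z : 'I_n -> 'M[K]_m,
    forall i, exists s, exists2 t, t != 0 & Z i = E s *m g t
    & word_eval Z w = E 1.
Proof.
move=> F1w F2w K0 E0 ED g1 gM gE.
have [[v0 i0] nz] := netcount_edge_neq0 F1w F2w.
pose l := [seq (x.1.1, x.2) | x <- edges 0 w & x.1.2 == i0].
have nz_l : netcount l v0 != 0.
  apply: contraNneq nz => l0; apply/eqP; rewrite -[RHS]l0.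
  rewrite /netcount big_map big_filter [RHS]big_mkcond.
  apply: eq_bigr => -[[v i] b] _ /=.
  by rewrite xpair_eqE andbC; case: eqP.
have [B [q q0 P0]] := netcount_nonvanishing K0 nz_l.
set P := \sum_(x <- l) _ in P0.
(* Translating in direction [i0] only keeps the edges counted by [l], and [P^-1] normalizes the
   total translation to [1]. *)
pose s i := if i == i0 then P^-1 else 0.
exists (fun i => E (s i) *m g (q ^ gridform B (delta_mx 0 i))).
  by move=> i; exists (s i), (q ^ gridform B (delta_mx 0 i)); rewrite ?expfz_neq0.
have := word_eval_affine B s q0 E0 ED g1 gM gE 0 w.
rewrite (disp_in_F1 F1w) addr0.
have -> : gridform B (0 : 'rV_n) = 0.
  by rewrite /gridform big1 // => j _; rewrite mxE mul0r.
rewrite expr0z g1 mul1mx mulmx1 => ->; congr E.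
rewrite -[RHS](mulfV P0).
rewrite -[X in X / _]/(\sum_(x <- l) (-1) ^+ x.2 * q ^ (gridform B x.1 *+ 2)).
rewrite big_map big_filter mulr_suml [RHS]big_mkcond.
apply: eq_bigr => -[[v i] b] _ /=; rewrite /s.
by case: (i == i0); rewrite ?mulr0.
Qed.

(** * The exponential of nilpotent matrices *)

Lemma expr_vanish (R : pzRingType) (x : R) d k :
  x ^+ d = 0 -> (d <= k)%N -> x ^+ k = 0.
Proof. by move=> x0 le_dk; rewrite -(subnK le_dk) exprD x0 mulr0. Qed.

(** The minimal polynomial divides ['X^k], so it is some ['X^j]; it also divides the characteristic
    polynomial, whence [j <= m.+1]. *)
Lemma mx_nilpotent_exp (F : fieldType) m k (A : 'M[F]_m.+1) :
  A ^+ k = 0 -> A ^+ m.+1 = 0.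
Proof.
move=> Ak0; have : mxminpoly A %| ('X - 0%:P) ^+ k.
  by apply: mxminpoly_min; rewrite subr0 rmorphXn /= horner_mx_X.
case/dvdp_exp_XsubCP => j _ eq_min; have := mxminpoly_dvd_char A.
rewrite (eqp_dvdl _ eq_min) => dvd_char.
have le_j : (j <= m.+1)%N.
  have := dvdp_leq (monic_neq0 (char_poly_monic A)) dvd_char.
  by rewrite size_exp_XsubC size_char_poly ltnS.
have Aj0 : A ^+ j = 0.
  have /eqpP[[c1 c2] /= /andP[c10 c20]] := eq_min.
  move=> /(congr1 (horner_mx A)); rewrite !linearZ /= mx_root_minpoly scaler0.
  move=> /esym/eqP; rewrite scaler_eq0 (negPf c20) /= => /eqP.
  by rewrite subr0 rmorphXn /= horner_mx_X.
exact: expr_vanish Aj0 le_j.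
Qed.

(** The exponential series cut after [A ^+ m], which is exact on nilpotent matrices because these
    satisfy [A ^+ m.+1 = 0]. *)
Definition nexp (F : fieldType) m (A : 'M[F]_m.+1) : 'M[F]_m.+1 :=
  \sum_(i < m.+1) i`!%:R^-1 *: A ^+ i.

Lemma sum_triangle (V : nmodType) (f : nat -> nat -> V) n :
  \sum_(k < n) \sum_(i < k.+1) f (k - i)%N i =
  \sum_(i < n) \sum_(j < n - i) f j i.
Proof.
elim: n => [|n IH]; first by rewrite !big_ord0.
rewrite big_ord_recr /= IH [RHS]big_ord_recr /= big_ord_recr /= subnn.
rewrite subSnn big_ord1 addrA; congr (_ + _); rewrite -big_split /=.
apply: eq_bigr => i _; rewrite subSn ?big_ord_recr //=.
exact: ltnW.
Qed.

Section NilpotentExponential.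
Variables (F : fieldType) (m : nat).
Hypothesis F0 : [pchar F] =i pred0.
Implicit Types (A B : 'M[F]_m.+1).

Let natF0 k : (k%:R == 0 :> F) = (k == 0)%N.
Proof. by move/pcharf0P: F0. Qed.

Lemma nexp_widen A k :
  (m < k)%N -> A ^+ m.+1 = 0 -> nexp A = \sum_(i < k) i`!%:R^-1 *: A ^+ i.
Proof.
move=> lt_mk A0; rewrite /nexp (big_ord_widen k (fun i => i`!%:R^-1 *: A ^+ i)) //.
rewrite big_mkcond; apply: eq_bigr => i _; case: ltnP => // le_mi.
by rewrite (expr_vanish A0 le_mi) scaler0.
Qed.

Lemma nilpotentD A B : A * B = B * A -> A ^+ m.+1 = 0 -> B ^+ m.+1 = 0 ->
  (A + B) ^+ m.+1 = 0.
Proof.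
move=> AB A0 B0; apply: (@mx_nilpotent_exp _ _ (m.+1 + m.+1)).
rewrite exprDn_comm //; apply: big1 => i _.
have [le_i|lt_i] := leqP i m.+1.
  by rewrite (expr_vanish A0) ?mul0r ?mul0rn // -addnBA // leq_addr.
by rewrite (expr_vanish B0 (ltnW lt_i)) mulr0 mul0rn.
Qed.

Lemma nexp0 : nexp (0 : 'M[F]_m.+1) = 1.
Proof.
rewrite /nexp big_ord_recl expr0 fact0 invr1 scale1r big1 ?addr0 // => i _.
by rewrite expr0n /= scaler0.
Qed.

Lemma nexpD A B : A * B = B * A -> A ^+ m.+1 = 0 -> B ^+ m.+1 = 0 ->
  nexp (A + B) = nexp A * nexp B.
Proof.
move=> AB A0 B0; have AB0 := nilpotentD AB A0 B0.
(* With [2 (m + 1)] terms, the triangle of the Cauchy product contains the whole square [i, j <= m],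
   and its remaining terms vanish. *)
rewrite (nexp_widen (k := m.+1 + m.+1)) ?leq_addr //.
pose f j i := (j`!%:R^-1 * i`!%:R^-1) *: (A ^+ j * B ^+ i) : 'M[F]_m.+1.
transitivity (\sum_(k < m.+1 + m.+1) \sum_(i < k.+1) f (k - i)%N i).
  apply: eq_bigr => k _; rewrite exprDn_comm // scaler_sumr.
  apply: eq_bigr => i _; rewrite /f -scaler_nat scalerA; congr (_ *: _).
  have le_ik : (i <= k)%N by rewrite -ltnS.
  rewrite -(bin_fact le_ik) !natrM !invfM mulrAC mulVf ?mul1r 1?mulrC //.
  by rewrite natF0 -lt0n bin_gt0.
rewrite sum_triangle big_split_ord /= [X in _ + X]big1 ?addr0 => [|i _]; last first.
  by rewrite big1 // => j _; rewrite /f exprD B0 mul0r mulr0 scaler0.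
rewrite /nexp mulr_suml.
transitivity (\sum_(i < m.+1) \sum_(j < m.+1) f j i).
  apply: eq_bigr => i _; have le_m : (m.+1 <= m.+1 + m.+1 - i)%N.
    by rewrite -addnBA ?leq_addr // ltnW.
  rewrite (big_ord_widen _ (fun j => f j i) le_m) [RHS]big_mkcond.
  apply: eq_bigr => j _; case: ltnP => // le_mj.
  by rewrite /f (expr_vanish A0 le_mj) mul0r scaler0.
rewrite exchange_big /=; apply: eq_bigr => j _; rewrite mulr_sumr.
by apply: eq_bigr => i _; rewrite /f -scalerAl -scalerAr scalerA.
Qed.

Lemma nexpN A : A ^+ m.+1 = 0 -> nexp A * nexp (- A) = 1.
Proof.
move=> A0; rewrite -nexpD ?subrr ?nexp0 ?mulrN ?mulNr //.
by rewrite exprNn A0 mulr0.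
Qed.

Lemma nilpotentZ c A : A ^+ m.+1 = 0 -> (c *: A) ^+ m.+1 = 0.
Proof. by move=> A0; rewrite exprZn A0 scaler0. Qed.

Lemma nexpZD A a b : A ^+ m.+1 = 0 ->
  nexp ((a + b) *: A) = nexp (a *: A) * nexp (b *: A).
Proof.
move=> A0; rewrite scalerDl nexpD ?nilpotentZ //.
by rewrite -!scalerAl -!scalerAr !scalerA mulrC.
Qed.

Lemma nexp_natmul A k : A ^+ m.+1 = 0 -> nexp (k%:R *: A) = nexp A ^+ k.
Proof.
move=> A0; elim: k => [|k IH]; first by rewrite scale0r nexp0.
by rewrite exprS -IH -natr1 addrC nexpZD // scale1r.
Qed.

Lemma nexp_conj A B C : C * A = B * C -> C * nexp A = nexp B * C.
Proof.
move=> CA; have CAk k : C * A ^+ k = B ^+ k * C.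
  by elim: k => [|k IH]; rewrite ?mulr1 ?mul1r // exprS mulrA CA -mulrA IH mulrA exprS.
rewrite /nexp mulr_sumr mulr_suml; apply: eq_bigr => i _.
by rewrite -scalerAl -scalerAr CAk.
Qed.

Let ev_nil (nu : 'M[F]_m.+1) p :
  nu ^+ m.+1 = 0 -> horner_mx nu ('X * p) ^+ m.+1 = 0.
Proof. by move=> nu0; rewrite -rmorphXn exprMn rmorphM rmorphXn /= horner_mx_X nu0 mul0r. Qed.

(** One term more than in [nexp], so that the linear term is present even when [m = 0]. *)
Let nexp_ev (nu : 'M[F]_m.+1) p : nu ^+ m.+1 = 0 ->
  nexp (- horner_mx nu ('X * p)) =
  horner_mx nu (\sum_(i < m.+2) i`!%:R^-1 *: (- ('X * p)) ^+ i).
Proof.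
move=> nu0; rewrite -rmorphN (nexp_widen (k := m.+2)) //; last first.
  by rewrite -mulrN ev_nil.
by rewrite rmorph_sum /=; apply: eq_bigr => i _; rewrite linearZ /= rmorphXn.
Qed.

Let exp_trunc (c : {poly F}) : exists s,
  \sum_(i < m.+2) i`!%:R^-1 *: (- c) ^+ i = 1 - c + c ^+ 2 * s.
Proof.
rewrite big_ord_recl expr0 fact0 invr1 scale1r.
rewrite big_ord_recl /= expr1 invr1 scale1r.
exists (\sum_(i < m) (-1) ^+ i.+2 *: ((i.+2)`!%:R^-1 *: c ^+ i)).
rewrite -addrA; congr (_ + (_ + _)); rewrite mulr_sumr; apply: eq_bigr => i _.
rewrite /bump !add1n -!scalerAr -exprD add2n [RHS]scalerA mulrC -scalerA.
by congr (_ *: _); rewrite (exprNn c) -mul_polyC polyC_exp polyCN polyC1.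
Qed.

(* Newton iteration: multiplying [1 + nu] by [exp (- c)] squares the error [c]. *)
Lemma nexp_onto (P : 'M[F]_m.+1 -> Prop) nu :
    P 0 -> (forall A B, P A -> P B -> P (A + B)) -> (forall c A, P A -> P (c *: A)) ->
    (forall A B, P A -> P B -> P (A * B)) ->
    P nu -> nu ^+ m.+1 = 0 ->
  exists N, [/\ P N, N ^+ m.+1 = 0 & nexp N = 1 + nu].
Proof.
move=> P0 PD PZ PM Pnu nu0.
have Pev p : P (horner_mx nu ('X * p)).
  elim/poly_ind: p => [|p c IH]; first by rewrite mulr0 rmorph0.
  rewrite mulrDr rmorphD mulrA rmorphM /= horner_mx_X; apply: PD; first exact: PM.
  by rewrite rmorphM /= horner_mx_X horner_mx_C -mulmxE mul_mx_scalar; apply: PZ.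
have approx k : exists p r : {poly F},
    (1 + nu) * nexp (- horner_mx nu ('X * p)) = 1 + horner_mx nu ('X^(k.+1) * r).
  elim: k => [|k [p [r IH]]].
    by exists 0, 1; rewrite mulr0 rmorph0 oppr0 nexp0 !mulr1 expr1 horner_mx_X.
  pose c := 'X^(k.+1) * r; have [s def_s] := exp_trunc c.
  have c_X : c = 'X * ('X^k * r) by rewrite mulrA -exprS.
  exists (p + 'X^k * r).
  have eq_c : exists r', (1 + horner_mx nu c) * nexp (- horner_mx nu c) =
      1 + horner_mx nu ('X^(k.+2) * r').
    rewrite {2}c_X nexp_ev // -c_X def_s -{1}(rmorph1 (horner_mx nu)).
    rewrite -rmorphD -rmorphM /=.
    (* From [(1 + c) (1 - c + c^2 s) = 1 + c^2 ((1 + c) s - 1)], where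
       [c^2 = 'X^(k.+2) * ('X^k * r^2)]. *)
    exists ('X^k * r ^+ 2 * ((1 + c) * s - 1)).
    rewrite -[1 in RHS](rmorph1 (horner_mx nu)) -rmorphD /=; congr horner_mx.
    rewrite /c !exprS; move: 'X^k => Xk; ring.
  have [r' def_r'] := eq_c; exists r'.
  rewrite mulrDr -c_X rmorphD opprD nexpD; first last.
  - by rewrite exprNn c_X ev_nil // mulr0.
  - by rewrite exprNn ev_nil // mulr0.
  - by rewrite !mulrN !mulNr -!rmorphM mulrC.
  by rewrite mulrA IH -/c.
have [p [r eq_p]] := approx m.
exists (horner_mx nu ('X * p)); split; rewrite ?ev_nil //.
have /(congr1 ( *%R^~ (nexp (horner_mx nu ('X * p))))) := eq_p.
rewrite [horner_mx nu (_ * r)]rmorphM rmorphXn /= horner_mx_X nu0 mul0r addr0 mul1r.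
rewrite -mulrA => <-; rewrite -[X in _ * (_ * nexp X)]opprK nexpN ?mulr1 //.
by rewrite exprNn ev_nil // mulr0.
Qed.

(** Once [A ^+ j.+1 = 0] is known, the relation [A + A^2/2 + ... = 0] multiplied by [A ^+ (j - 1)]
    reduces to [A ^+ j = 0]; descending on [j] reaches [A = 0]. *)
Lemma nexp_eq1 A : A ^+ m.+1 = 0 -> nexp A = 1 -> A = 0.
Proof.
move=> A0 eq1.
have tail k : (k <= m)%N -> \sum_(1 <= i < m.+1) i`!%:R^-1 *: A ^+ (i + k) = 0.
  move=> _; transitivity ((nexp A - 1) * A ^+ k); last by rewrite eq1 subrr mul0r.
  rewrite /nexp big_ord_recl expr0 fact0 invr1 scale1r addrC addKr mulr_suml.
  rewrite big_add1 /= big_mkord; apply: eq_bigr => i _.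
  by rewrite /bump /= add1n -scalerAl -exprD.
have Ak k : (k <= m)%N -> A ^+ (m.+1 - k) = 0.
  elim: k => [|k IH] lt_km; first by rewrite subn0.
  have /IH Ak0 := ltnW lt_km.
  have := tail (m.+1 - k.+2)%N (leq_trans (leq_subr _ _) (leqnn _)).
  have m_gt0 : (0 < m)%N by apply: leq_ltn_trans lt_km.
  rewrite big_ltn // factS fact0 muln1 invr1 scale1r big_nat big1 ?addr0 => [|i /andP[i2 _]].
    by rewrite add1n -subSn // ltnS.
  by rewrite (expr_vanish Ak0) ?scaler0 //; lia.
by have := Ak m (leqnn _); rewrite subSnn.
Qed.

End NilpotentExponential.

(** * Generalized weights and spectral projectors *)

(** A predicate rather than the row space of a matrix, because it is also applied to ideals of
    polynomials, which may have infinite dimension. *)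
Definition is_subspace (F : fieldType) (V : lmodType F) (I : V -> Prop) : Prop :=
  [/\ I 0, forall u v, I u -> I v -> I (u + v) & forall a v, I v -> I (a *: v)].

Section Subspaces.
Variables (F : fieldType) (V : lmodType F) (I : V -> Prop).
Hypothesis subI : is_subspace I.

Lemma subspaceD u v : I u -> I v -> I (u + v).
Proof. by case: subI => _ + _; apply. Qed.

Lemma subspaceZ a v : I v -> I (a *: v).
Proof. by case: subI => _ _; apply. Qed.

Lemma subspace0 : I 0.
Proof. by case: subI. Qed.

Lemma subspaceN v : I v -> I (- v).
Proof. by rewrite -scaleN1r; apply: subspaceZ. Qed.

Lemma subspaceB u v : I u -> I v -> I (u - v).
Proof. by move=> Iu /subspaceN; apply: subspaceD. Qed.

Lemma subspace_sum (T : Type) (r : seq T) (P : pred T) (f : T -> V) :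
  (forall i, P i -> I (f i)) -> I (\sum_(i <- r | P i) f i).
Proof.
move=> If; elim/big_rec: _ => [|i v Pi Iv]; first exact: subspace0.
by apply: subspaceD; auto.
Qed.

Lemma subspace_sum_seq (T : eqType) (r : seq T) (f : T -> V) :
  (forall i, i \in r -> I (f i)) -> I (\sum_(i <- r) f i).
Proof. by move=> If; rewrite big_seq; apply: subspace_sum. Qed.

End Subspaces.

Section Weights.
Variables (F : fieldType) (V : lmodType F) (D : {linear V -> V}).
Implicit Types (a b : F) (u v : V) (k : nat).

Definition shift a v := D v - a *: v.

Fact shift_linear a : linear (shift a).
Proof.
move=> c u v; rewrite /shift linearP scalerDr scalerBr !scalerA mulrC opprD.
by rewrite addrACA.
Qed.
HB.instance Definition _ a := GRing.isLinear.Build F V V _ (shift a) (shift_linear a).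

Definition gen_weight a k v := iter k (shift a) v = 0.

Lemma shiftC a b v : shift a (shift b v) = shift b (shift a v).
Proof.
have DE c w : D (D v - c *: w) = D (D v) - c *: D w by rewrite linearB linearZ.
rewrite /shift !DE !scalerBr !scalerA [b * a]mulrC !opprB.
by rewrite addrACA [RHS]addrACA; congr (_ + _); rewrite addrC.
Qed.

Lemma iter_shift_linear a k : linear (iter k (shift a)).
Proof. by elim: k => // k IH c u v; rewrite !iterS IH linearP. Qed.
HB.instance Definition _ a k :=
  GRing.isLinear.Build F V V _ (iter k (shift a)) (iter_shift_linear a k).

Lemma iter_shiftC a b k l v :
  iter k (shift a) (iter l (shift b) v) = iter l (shift b) (iter k (shift a) v).
Proof.
have C1 w : iter k (shift a) (shift b w) = shift b (iter k (shift a) w).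
  by elim: k => //= k ->; rewrite shiftC.
by elim: l => //= l <-.
Qed.

Lemma gen_weight_leq a k l v : (k <= l)%N -> gen_weight a k v -> gen_weight a l v.
Proof. by rewrite /gen_weight => le_kl v0; rewrite -(subnK le_kl) iterD v0 linear0. Qed.

Lemma gen_weight_iter a b k l v :
  gen_weight a k v -> gen_weight a k (iter l (shift b) v).
Proof. by rewrite /gen_weight iter_shiftC => ->; rewrite linear0. Qed.

Variable I : V -> Prop.
Hypothesis subI : is_subspace I.
Hypothesis stabI : forall v, I v -> I (D v).

Lemma shift_stable a v : I v -> I (shift a v).
Proof. by move=> Iv; apply: subspaceB; auto; apply: subspaceZ. Qed.

(** Modulo [I], [shift b] is injective on vectors of generalized weight [a != b], because
    [(a - b) w = shift b w - shift a w] and [shift a w] has smaller order. *)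
Lemma gen_weight_shift_mem a b k l v : a != b ->
  gen_weight a k v -> I (iter l (shift b) v) -> I v.
Proof.
move=> nab; have step w : gen_weight a k w -> I (shift b w) -> I w.
  elim: k w => [|k IH] w; first by rewrite /gen_weight /= => -> _; exact: subspace0.
  rewrite /gen_weight iterSr => wt_w Ibw.
  have Iaw : I (shift a w) by apply: IH => //; rewrite shiftC; apply: shift_stable.
  rewrite -[w]scale1r -(mulVf (_ : a - b != 0)) ?subr_eq0 // -scalerA.
  apply: subspaceZ => //; rewrite (_ : (a - b) *: w = shift b w - shift a w).
    exact: subspaceB.
  by rewrite /shift scalerBl opprB [RHS]addrC addrA subrK.
elim: l => //= l IH wt_v Ibv; apply: IH => //.
by apply: step => //; apply: gen_weight_iter.
Qed.

(** Applying [shift b] [k] times kills the component of weight [b], so induction handles the images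
    of the others, and [gen_weight_shift_mem] brings them back. *)
Lemma gen_weight_split k (s : seq F) (c : F -> V) : uniq s ->
    (forall a, a \in s -> gen_weight a k (c a)) ->
    I (\sum_(a <- s) c a) ->
  forall a, a \in s -> I (c a).
Proof.
elim: s c => // b s IH c /andP[bNs uniq_s] wt_c; rewrite big_cons => Ic.
have Is a : a \in s -> I (c a).
  move=> a_s; have nab : a != b by apply: contraNneq bNs => <-.
  apply: (@gen_weight_shift_mem a b k k) => //.
    by apply: wt_c; rewrite inE a_s orbT.
  apply: (IH (fun a => iter k (shift b) (c a))) => // [a' a'_s|].
    by apply: gen_weight_iter; apply: wt_c; rewrite inE a'_s orbT.
  have -> : \sum_(a0 <- s) iter k (shift b) (c a0)
      = iter k (shift b) (c b + \sum_(a0 <- s) c a0).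
    by rewrite linearD linear_sum /= wt_c ?mem_head // add0r.
  by elim: (k) => //= j IHj; apply: shift_stable.
move=> a; rewrite inE => /orP[/eqP-> | /Is //].
rewrite -[c b](addrK (\sum_(a <- s) c a)); apply: subspaceB => //.
exact: subspace_sum_seq.
Qed.

(** As the scalar [x.1.2] depends only on the weight [x.1.1], grouping by weights turns the new sum
    into a combination of weight components of the old one, each lying in [I]. Taking [I] reduced to
    [0] yields identities between weight components. *)
Lemma gen_weight_rescale (l : seq (F * F * V)) :
    (forall x, x \in l -> exists k, gen_weight x.1.1 k x.2) ->
    (forall x y, x \in l -> y \in l -> x.1.1 = y.1.1 -> x.1.2 = y.1.2) ->
    I (\sum_(x <- l) x.2) -> I (\sum_(x <- l) x.1.2 *: x.2).
Proof.
move=> wt_l fun_l I_l.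
have [k wt_k] : exists k, forall x, x \in l -> gen_weight x.1.1 k x.2.
  elim: (l) wt_l => [|x l' IH] wt_l; first by exists 0%N.
  have [k1 wt1] := wt_l x (mem_head _ _).
  have [|k2 wt2] := IH; first by move=> y y_l; apply: wt_l; rewrite inE y_l orbT.
  exists (maxn k1 k2) => y; rewrite inE => /orP[/eqP-> | /wt2].
    by apply: gen_weight_leq wt1; rewrite leq_maxl.
  by apply: gen_weight_leq; rewrite leq_maxr.
pose s := undup [seq x.1.1 | x <- l].
pose c a := \sum_(x <- l | x.1.1 == a) x.2.
have part (f : F * F * V -> V) :
    \sum_(x <- l) f x = \sum_(a <- s) \sum_(x <- l | x.1.1 == a) f x.
  rewrite (exchange_big_dep xpredT) //=; apply: eq_big_seq => x x_l.
  rewrite [RHS]big_mkcond (bigD1_seq x.1.1) ?undup_uniq //=; last first.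
    by rewrite mem_undup; apply/mapP; exists x.
  rewrite eqxx.
  by rewrite big1 ?addr0 // => a; rewrite eq_sym => /negPf->.
rewrite part in I_l; rewrite part big_seq; apply: subspace_sum => // a a_s.
have Ic : I (c a).
  apply: (gen_weight_split (k := k) (s := s)) => //; first exact: undup_uniq.
  move=> b b_s; rewrite /gen_weight /c linear_sum big_seq_cond /=.
  by rewrite big1 // => x /andP[x_l /eqP <-]; apply: wt_k.
have /mapP[y y_l def_a] : a \in [seq x.1.1 | x <- l] by rewrite mem_undup in a_s.
rewrite (_ : \sum_(x <- l | _) _ = y.1.2 *: c a); first exact: subspaceZ.
rewrite scaler_sumr big_seq_cond [RHS]big_seq_cond.
apply: eq_bigr => x /andP[x_l /eqP xa]; congr (_ *: _).
by apply: fun_l => //; rewrite xa.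
Qed.

End Weights.

Lemma gen_weight_mul (F : fieldType) (A : algType F) (D : {linear A -> A}) a b k l u v :
    (forall x y, D (x * y) = D x * y + x * D y) ->
    gen_weight D a k u -> gen_weight D b l v -> gen_weight D (a + b) (k + l) (u * v).
Proof.
move=> leib; suff mul n : forall i j u v, (i + j <= n)%N -> gen_weight D a i u ->
    gen_weight D b j v -> gen_weight D (a + b) n (u * v) by exact: mul.
elim: n => [|n IH] [|i] [|j] {}u {}v // le_n;
  move=> wt_u wt_v; do ?by [rewrite (wt_u : u = 0) mul0r /gen_weight linear0
                           |rewrite (wt_v : v = 0) mulr0 /gen_weight linear0].
rewrite /gen_weight iterSr.
have -> : shift D (a + b) (u * v) = shift D a u * v + u * shift D b v.
  rewrite /shift leib scalerDl mulrBl mulrBr -scalerAl -scalerAr opprD.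
  by rewrite addrACA.
rewrite linearD /= [X in X + _](IH i j.+1) ?add0r; first apply: (IH i.+1 j) => //.
- by move: le_n; rewrite addnS ltnS.
- by move: wt_v; rewrite /gen_weight iterSr.
- by [].
- by move: wt_u; rewrite /gen_weight iterSr.
- by [].
Qed.

(** [e a] projects onto the generalized eigenspace of [a], so the sum of the [a *: e a] is the
    semisimple part of [x]. Polynomials in [x] commute with [x], and [e a != 0] makes the ranks,
    which serve as multiplicities, positive. *)
Definition spectral_family (F : fieldType) m (x : 'M[F]_m.+1) (s : seq F)
    (e : F -> 'M[F]_m.+1) : Prop :=
  [/\ uniq s, \sum_(a <- s) e a = 1,
      exists k, forall a, a \in s -> (x - a%:M) ^+ k * e a = 0,
      forall a b, a \in s -> b \in s -> e a * e b = if a == b then e a else 0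
    & forall a, a \in s -> e a != 0 /\ exists p, e a = horner_mx x p].

Lemma coprime_XsubC_prod (F : fieldType) (s : seq F) a k :
  a \notin s -> coprimep (('X - a%:P) ^+ k) (\prod_(b <- s) ('X - b%:P) ^+ k).
Proof.
move=> aNs; rewrite big_seq; elim/big_rec: _ => [|b p b_s cop]; first exact: coprimep1.
rewrite coprimepMr cop andbT coprimep_expl // coprimep_expr //.
rewrite coprimep_XsubC root_XsubC.
by apply: contraNneq aNs => <-.
Qed.

Lemma horner_mx_XsubC (F : fieldType) m (x : 'M[F]_m.+1) a k :
  horner_mx x (('X - a%:P) ^+ k) = (x - a%:M) ^+ k.
Proof. by rewrite rmorphXn rmorphB /= horner_mx_X horner_mx_C. Qed.

(** Bezout relations between the coprime powers [('X - a) ^ k] split [1] into components, one root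
    at a time; [k = size l] bounds all multiplicities in [l]. Roots whose component is [0] are
    discarded. *)
Lemma ex_spectral_family (F : fieldType) m (x : 'M[F]_m.+1) (l : seq F) :
  \prod_(a <- l) (x - a%:M) = 0 ->
  exists s e, spectral_family x s e /\ {subset s <= l}.
Proof.
move=> prod0; pose k := size l; pose Q (s : seq F) := \prod_(b <- s) ('X - b%:P) ^+ k.
have split s p : uniq s -> horner_mx x (Q s * p) = 0 ->
    exists c : F -> {poly F}, horner_mx x p = \sum_(a <- s) horner_mx x (c a) /\
      forall a, a \in s -> horner_mx x (('X - a%:P) ^+ k * c a) = 0.
  elim: s p => [|a s IH] p /=.
    by move=> _; rewrite /Q big_nil mul1r => ->; exists (fun=> 0); rewrite big_nil.
  case/andP=> aNs uniq_s; rewrite /Q big_cons -/(Q s) => Qp0.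
  have /Bezout_eq1_coprimepP[[u v] /= uv1] := coprime_XsubC_prod k aNs.
  have [||c [sum_c wt_c]] := IH (u * ('X - a%:P) ^+ k * p) => //.
    have -> A B : A * (u * B * p) = u * (B * A * p) by ring.
    by rewrite rmorphM /= Qp0 mulr0.
  pose c' b := if b == a then v * Q s * p else c b.
  have c'_s b : b \in s -> c' b = c b.
    by rewrite /c'; case: eqP => // ->; rewrite (negPf aNs).
  exists c'; split.
    rewrite big_cons {1}/c' eqxx -[p in LHS]mul1r -uv1 mulrDl rmorphD -/(Q s) addrC.
    by rewrite /= sum_c; congr (_ + _); apply: eq_big_seq => b /c'_s->.
  move=> b; rewrite inE => /orP[/eqP->|b_s]; last by rewrite c'_s ?wt_c.
  rewrite /c' eqxx; have -> A B : A * (v * B * p) = v * (A * B * p) by ring.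
  by rewrite rmorphM /= Qp0 mulr0.
have [|c [sum_c wt_c]] := split (undup l) 1 (undup_uniq l).
  rewrite mulr1; have [r ->] : exists r, Q (undup l) = r * \prod_(a <- l) ('X - a%:P).
    have /dvdpP[r ->] : \prod_(a <- l) ('X - a%:P) %| Q (undup l); last by exists r.
    rewrite -big_undup_iterop_count /Q; elim: (undup l) => [|a s IH].
      by rewrite !big_nil.
    rewrite !big_cons; apply: dvdp_mul => //.
    by rewrite -[iterop _ _ _ _]/(_ ^+ _) dvdp_exp2l // count_size.
  rewrite rmorphM rmorph_prod /= (_ : \prod_(a <- l) _ = 0) ?mulr0 // -[RHS]prod0.
  by apply: eq_bigr => a _; rewrite rmorphB /= horner_mx_X horner_mx_C.
pose e a := horner_mx x (c a); pose s := [seq a <- undup l | e a != 0].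
have sum_e : \sum_(a <- s) e a = 1.
  move: sum_c; rewrite rmorph1 => ->; rewrite big_filter big_mkcond.
  by apply: eq_bigr => a _; rewrite -/(e a); case: eqP => // ->.
have s_l a : a \in s -> a \in undup l by rewrite mem_filter => /andP[].
have wt_e a : a \in s -> (x - a%:M) ^+ k * e a = 0.
  by move/s_l/wt_c; rewrite rmorphM /= horner_mx_XsubC.
have e_orth a b : a \in s -> b \in s -> a != b -> e a * e b = 0.
  move=> a_s b_s nab; rewrite -[e a * e b]mul1r.
  have /Bezout_eq1_coprimepP[[u v] /= uv1] : coprimep (('X - a%:P) ^+ k) (('X - b%:P) ^+ k).
    have := @coprime_XsubC_prod F [:: b] a k; rewrite big_seq1 inE; exact.
  have := congr1 (horner_mx x) uv1; rewrite rmorph1 => <-.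
  rewrite rmorphD !rmorphM /= !horner_mx_XsubC mulrDl -!mulrA.
  rewrite [_ * (e a * e b)]mulrA wt_e // mul0r mulr0 add0r /e -rmorphM mulrC rmorphM.
  by rewrite [_ * (e b * e a)]mulrA wt_e // mul0r mulr0.
exists s, e; split; last by move=> a /s_l; rewrite mem_undup.
split=> //; first by rewrite filter_uniq ?undup_uniq.
- by exists k.
- move=> a b a_s b_s; case: eqP => [<-|/eqP]; last exact: e_orth.
  rewrite -[RHS]mulr1 -sum_e mulr_sumr (bigD1_seq a) ?filter_uniq ?undup_uniq //=.
  rewrite [X in _ = _ + X]big_seq_cond big1 ?addr0 // => d /andP[d_s nda].
  by rewrite e_orth // eq_sym.
- by move=> a; rewrite mem_filter => /andP[nz _]; split=> //; exists (c a).
Qed.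

(** * Engel's theorem *)

Lemma subspace_rV_basis (F : fieldType) n (P : 'rV[F]_n -> Prop) :
  is_subspace P -> exists B : 'M[F]_n, forall v, P v <-> (v <= B)%MS.
Proof.
move=> subP; pose inP (B : 'M[F]_n) := forall v, (v <= B)%MS -> P v.
suff grow d (B : 'M[F]_n) : (n - \rank B <= d)%N -> inP B ->
    exists B : 'M[F]_n, forall v, P v <-> (v <= B)%MS.
  apply: (grow n 0); first by rewrite leq_subr.
  by move=> v; rewrite submx0 => /eqP->; apply: subspace0.
elim: d B => [|d IH] B rk_B P_B.
  exists B => v; split=> [_|]; last exact: P_B.
  by apply: submx_full; rewrite -col_leq_rank -subn_eq0 -leqn0.
have [all_B|not_B] := classic (forall v, P v -> (v <= B)%MS).
  by exists B => v; split; [apply: all_B | apply: P_B].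
case: (not_all_ex_not _ _ not_B) => v not_Bv.
case: (imply_to_and _ _ not_Bv) => Pv /negP vNB.
apply: (IH (B + v)%MS) => [|w].
  have : (\rank B < \rank (B + v)%MS)%N.
    by rewrite (ltn_leqif (mxrank_leqif_sup (addsmxSl _ _))) addsmx_sub submx_refl.
  by lia.
move/sub_addsmxP=> [[u1 u2] /= ->]; apply: subspaceD => //.
  by apply: P_B; apply: submxMl.
by rewrite [u2]mx11_scalar mul_scalar_mx; apply: subspaceZ.
Qed.

Lemma subspace_mx_basis (F : fieldType) m n (P : 'M[F]_(m, n) -> Prop) :
  is_subspace P -> exists B : 'M[F]_(m * n), forall x, P x <-> (mxvec x <= B)%MS.
Proof.
move=> subP; have [|B defB] := @subspace_rV_basis F (m * n) (fun v => P (vec_mx v)).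
  split=> [|u v Pu Pv|a v Pv]; first by rewrite linear0; apply: subspace0.
    by rewrite linearD; apply: subspaceD.
  by rewrite linearZ; apply: subspaceZ.
by exists B => x; rewrite -defB mxvecK.
Qed.

Lemma mxvec_subspace (F : fieldType) m n (B : 'M[F]_(m * n)) :
  is_subspace (fun x : 'M_(m, n) => (mxvec x <= B)%MS).
Proof.
split=> [|u v Bu Bv|a v Bv]; first by rewrite linear0 sub0mx.
  by rewrite linearD addmx_sub.
by rewrite linearZ scalemx_sub.
Qed.

Definition bracket (R : pzRingType) (x y : R) : R := x * y - y * x.

Section Engel.
Variables (F : fieldType) (m : nat).
Local Notation A := 'M[F]_m.+1.
Implicit Types (h r : A -> Prop) (v x y z : A).

(** The ascending flag of a module over [h]: level [i] is annihilated by every product of [i]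
    elements of [h]. The module is the matrix algebra under left multiplication, and level [M] is
    everything as soon as it contains [1]. *)
Fixpoint kills h i v : Prop :=
  if i is i'.+1 then forall k, h k -> kills h i' (k * v) else v = 0.

Lemma kills_subspace h i : is_subspace (kills h i).
Proof.
elim: i => [|i [IH0 IHD IHZ]] /=.
  split=> [//|u v -> ->|a v ->]; [exact: addr0 | exact: scaler0].
split=> [k _|u v ku kv k hk|a v kv k hk].
- by rewrite mulr0.
- by rewrite mulrDr; apply: IHD; auto.
- by rewrite -scalerAr; apply: IHZ; auto.
Qed.

Lemma killsS h i v : kills h i v -> kills h i.+1 v.
Proof.
elim: i v => [|i IH] v; first by move=> /= -> k _; rewrite mulr0.
by move=> kv k hk; apply/IH/kv.
Qed.

Lemma kills_leq h i j v : (i <= j)%N -> kills h i v -> kills h j v.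
Proof.
move=> le_ij kv; rewrite -(subnK le_ij); elim: (j - i)%N => // d IH.
by rewrite addSn; apply: killsS.
Qed.

Lemma kills_mono h h' i v : (forall x, h' x -> h x) -> kills h i v -> kills h' i v.
Proof. by move=> sub; elim: i v => //= i IH v kv k /sub hk; apply/IH/kv. Qed.

Lemma kills_mulr h i v z : kills h i v -> kills h i (v * z).
Proof.
elim: i v => [|i IH] v /=; first by move=> ->; rewrite mul0r.
by move=> kv k hk; rewrite mulrA; apply/IH/kv.
Qed.

Definition nilpotently_acting h := exists M, kills h M 1.

Lemma nilpotently_actingP h : nilpotently_acting h -> exists M, forall v, kills h M v.
Proof. by case=> M k1; exists M => v; rewrite -[v]mul1r; apply: kills_mulr. Qed.

Fixpoint ad_kills h i z : Prop :=
  if i is i'.+1 then forall k, h k -> ad_kills h i' (bracket k z) else z = 0.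

Lemma nilpotently_acting_ad h :
  nilpotently_acting h -> exists M, forall z, ad_kills h M z.
Proof.
case/nilpotently_actingP=> M killM.
(* [deg s t z] says that [z] maps level [t + j] of the flag into level [s + j]. A bracket with an
   element of [h] improves this by one level: [s] drops from [M] to [0], then [t] grows from [0] to
   [M], where [z] must be [0]; hence the bound [M + M]. *)
pose deg s t z := forall j v, kills h (t + j) v -> kills h (s + j) (z * v).
have down s z k : h k -> deg s.+1 0%N z -> deg s 0%N (bracket k z).
  move=> hk deg_z [|j] v.
    by rewrite /= => ->; rewrite mulr0; exact: subspace0 (kills_subspace _ _).
  move=> kv; rewrite /bracket mulrBl -!mulrA.
  apply: (subspaceB (kills_subspace _ _)); first by apply: (deg_z j.+1 v kv k hk).
  by rewrite addnS -addSn; apply: deg_z; apply: kv.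
have up t z k : h k -> deg 0%N t z -> deg 0%N t.+1 (bracket k z).
  move=> hk deg_z j v kv; rewrite /bracket mulrBl -!mulrA.
  apply: (subspaceB (kills_subspace _ _)); last by apply: deg_z; apply: kv.
  by apply: (deg_z j.+1) => //; rewrite addnS.
have fin t z : (t <= M)%N -> deg 0%N t z -> ad_kills h (M - t) z.
  move: {-1}(M - t)%N (erefl (M - t)%N) => d; elim: d t z => [|d IH] t z.
    move/eqP; rewrite subn_eq0 => leMt letM deg_z.
    by have := deg_z 0%N 1; rewrite mulr1 addn0; apply; apply: kills_leq leMt _.
  move=> def_d le_t deg_z k hk; apply: (IH t.+1); [lia|lia|exact: up].
have start s z : deg s 0%N z -> ad_kills h (s + M) z.
  elim: s z => [|s IH] z deg_z; first by rewrite add0n -[M]subn0; apply: fin.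
  by move=> k hk; apply/IH/down.
exists (M + M)%N => z; apply: start => j v _.
by apply: kills_leq (killM _); apply: leq_addr.
Qed.

(** Repeated brackets of [x] with elements of [h] end in [0], which lies in [h]; the last bracket
    outside [h] normalizes [h]. *)
Lemma ex_normalizing h r : nilpotently_acting h ->
    (forall x, h x -> r x) -> (forall x y, r x -> r y -> r (bracket x y)) -> h 0 ->
    (exists2 x, r x & ~ h x) ->
  exists y, [/\ r y, ~ h y & forall k, h k -> h (bracket k y)].
Proof.
move=> /nilpotently_acting_ad[M adM] hr rbr h0 [x rx hNx]; apply: NNPP => no_y.
have {adM} := adM x; elim: M x rx hNx => [|M IH] x rx hNx.
  by move=> x0; rewrite x0 in hNx.
move=> ad_x; apply: no_y; exists x; split=> // k hk; apply: NNPP => hNkx.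
by apply: (IH (bracket k x)) => //; [apply: rbr => //; apply: hr | apply: ad_x].
Qed.

(** Because [y] normalizes [h], it stabilizes the flag of [h]. Among [M] successive factors
    [a + c *: y], either some [a] descends one level or only [y ^+ M = 0] is left; so [M] steps of
    [h'] descend a level of [h]. *)
Lemma nilpotently_acting_extend h y M : is_subspace h -> nilpotently_acting h ->
    y ^+ M = 0 -> (forall k, h k -> h (bracket k y)) ->
  nilpotently_acting (fun x => exists2 a, h a & exists c, x = a + c *: y).
Proof.
move=> subh nil_h yM0 norm_y; set h' := (fun x => _).
have y_stab i v : kills h i v -> kills h i (y * v).
  elim: i v => [|i IH] v /=; first by move=> ->; rewrite mulr0.
  move=> kv k hk; rewrite (_ : k * (y * v) = y * (k * v) + bracket k y * v).
    by apply: (subspaceD (kills_subspace _ _)); [apply/IH/kv | apply/kv/norm_y].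
  by rewrite /bracket mulrBl !mulrA addrC subrK.
have step i : (forall v, kills h i v -> kills h' (i * M) v) ->
    forall b v, kills h i.+1 v -> kills h i (y ^+ b * v) -> kills h' (i * M + b) v.
  move=> IH; elim=> [|b IHb] v kv; first by rewrite expr0 mul1r addn0; apply: IH.
  rewrite addnS => kyv _ [a ha [c ->]]; rewrite mulrDl -scalerAl.
  apply: (subspaceD (kills_subspace _ _)).
    by apply: kills_leq (leq_addr _ _) _; apply/IH/kv.
  apply: (subspaceZ (kills_subspace _ _)); apply: IHb; first exact: y_stab.
  by rewrite mulrA -exprSr.
have sub i v : kills h i v -> kills h' (i * M) v.
  elim: i v => // i IH v kv; rewrite mulSn addnC; apply: step => //.
  by rewrite yM0 mul0r; apply: subspace0 (kills_subspace _ _).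
by have [N kN] := nil_h; exists (N * M)%N; apply: sub.
Qed.

(** Starting from [0], a subalgebra of [r] acting nilpotently is enlarged by a normalizing element;
    its rank increases until it exhausts [r]. *)
Theorem Engel r d : is_subspace r -> (forall x y, r x -> r y -> r (bracket x y)) ->
  (forall x, r x -> x ^+ d = 0) -> exists M, forall v, kills r M v.
Proof.
move=> subr rbr nil_r; apply: nilpotently_actingP; pose n := (m.+1 * m.+1)%N.
pose inr (B : 'M[F]_n) := [/\ forall x, (mxvec x <= B)%MS -> r x,
  forall x y, (mxvec x <= B)%MS -> (mxvec y <= B)%MS -> (mxvec (bracket x y) <= B)%MS &
  nilpotently_acting (fun x => (mxvec x <= B)%MS)].
suff grow k (B : 'M[F]_n) : (n - \rank B <= k)%N -> inr B -> nilpotently_acting r.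
  apply: (grow n 0); first by rewrite leq_subr.
  split=> [x|x y|]; rewrite ?submx0 ?mxvec_eq0.
  - by move/eqP->; apply: subspace0.
  - by rewrite ?submx0 ?mxvec_eq0 => /eqP-> /eqP->; rewrite /bracket mulr0 subr0.
  - by exists 1%N => /= x; rewrite submx0 mxvec_eq0 => /eqP->; rewrite mul0r.
elim: k B => [|k IH] B rk_B [B_r B_br B_nil].
  have [M kM] := B_nil; exists M; apply: kills_mono kM => x _.
  by apply: submx_full; rewrite -col_leq_rank -subn_eq0 -leqn0.
have [all_B|not_B] := classic (forall x, r x -> (mxvec x <= B)%MS).
  by case: B_nil => M kM; exists M; apply: kills_mono kM.
case: (not_all_ex_not _ _ not_B) => x not_Bx.
case: (imply_to_and _ _ not_Bx) => rx xNB.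
have [||y [ry yNB norm_y]] := ex_normalizing B_nil B_r rbr.
- by rewrite linear0 sub0mx.
- by exists x.
have B'P z : (mxvec z <= B + mxvec y)%MS <->
    exists2 a, (mxvec a <= B)%MS & exists c, z = a + c *: y.
  split=> [/sub_addsmxP[[u1 u2] /= def_z]|[a Ba [c ->]]].
    exists (vec_mx (u1 *m B)); first by rewrite vec_mxK submxMl.
    exists (u2 0 0); apply: (can_inj mxvecK).
    by rewrite def_z linearD linearZ /= vec_mxK {1}[u2]mx11_scalar mul_scalar_mx.
  rewrite linearD linearZ addmx_sub ?scalemx_sub ?addsmxSr //.
  by apply: submx_trans Ba (addsmxSl _ _).
have subB := mxvec_subspace B.
apply: (IH (B + mxvec y)%MS).
  have : (\rank B < \rank (B + mxvec y)%MS)%N.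
    rewrite (ltn_leqif (mxrank_leqif_sup (addsmxSl _ _))) addsmx_sub submx_refl.
    exact/negP.
  by move: rk_B; lia.
split.
- move=> z /B'P[a Ba [c ->]]; apply: subspaceD => //; first exact: B_r.
  exact: subspaceZ.
- move=> z1 z2 /B'P[a1 Ba1 [c1 ->]] /B'P[a2 Ba2 [c2 ->]].
  apply: submx_trans (addsmxSl _ _).
  have -> : bracket (a1 + c1 *: y) (a2 + c2 *: y) =
      bracket a1 a2 + (c2 *: bracket a1 y - c1 *: bracket a2 y).
    rewrite /bracket !mulrDl !mulrDr -!scalerAl -!scalerAr.
    move: (a1 * a2) (a1 * y) (y * a2) (y * y) (a2 * a1) (a2 * y) (y * a1).
    by move=> ? ? ? ? ? ? ?; apply/matrixP => i j; rewrite !mxE; ring.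
  apply: (subspaceD subB); first exact: B_br.
  by apply: (subspaceB subB); apply: (subspaceZ subB); apply: norm_y.
- have [M kM] := nilpotently_acting_extend subB B_nil (nil_r y ry) norm_y.
  by exists M; apply: kills_mono kM => z /B'P.
Qed.

End Engel.

(** * Traces *)

Lemma nilpotent_trace0 (L : closedFieldType) m (A : 'M[L]_m.+1) d :
  A ^+ d = 0 -> \tr A = 0.
Proof.
move=> Ad0; have [r def_r] := closed_field_poly_normal (char_poly A).
rewrite (monicP (char_poly_monic A)) scale1r in def_r.
have r0 z : z \in r -> z = 0.
  move=> z_r; have : root (char_poly A) z by rewrite def_r root_prod_XsubC.
  rewrite -eigenvalue_root_char => /eigenvalueP[v vA nz_v].
  have vAk k : v *m A ^+ k = z ^+ k *: v.
    elim: k => [|k IH]; first by rewrite mulmx1 scale1r.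
    by rewrite exprSr mulmxA IH -scalemxAl vA scalerA -exprSr.
  have := vAk d; rewrite Ad0 mulmx0 => /esym/eqP.
  by rewrite scaler_eq0 (negPf nz_v) orbF expf_eq0 => /andP[_ /eqP].
have := @char_poly_trace _ _ A isT; rewrite def_r.
rewrite (eq_big_seq (fun=> 'X)) => [|z /r0->]; last by rewrite subr0.
rewrite big_const_seq count_predT iter_mulr_1 coefXn.
have : size (char_poly A) = m.+2 by rewrite size_char_poly.
rewrite def_r size_prod_XsubC => -[->].
by rewrite eqn_leq ltnn andbF => /esym/eqP; rewrite oppr_eq0 => /eqP.
Qed.

Lemma idempotent_trace (F : fieldType) m (e : 'M[F]_m) :
  e *m e = e -> \tr e = (\rank e)%:R.
Proof.
move=> ee; rewrite -[in LHS](mulmx_base e) mxtrace_mulC.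
suff -> : row_base e *m col_base e = 1%:M by rewrite mxtrace1.
apply: (row_full_inj (col_base_full e)); apply: (row_free_inj (row_base_free e)).
by rewrite /= mulmx1 mulmxA mulmx_base -mulmxA mulmx_base.
Qed.

Lemma mxtrace_mul_form (F : fieldType) m : exists T : 'M[F]_(m * m),
  forall x y : 'M[F]_m, mxvec x *m T *m (mxvec y)^T = (\tr (x *m y))%:M.
Proof.
pose f (v : 'rV[F]_(m * m)) := mxvec (vec_mx v)^T.
have fL : linear f by move=> a u v; rewrite /f !linearP.
pose fl := HB.pack f (GRing.isLinear.Build F _ _ _ f fL) : {linear 'rV_(m * m) -> 'rV_(m * m)}.
exists (lin1_mx fl) => x y; rewrite mul_rV_lin1 /= /f mxvecK.
apply/matrixP => i j; rewrite !ord1 [RHS]mxE eqxx mulr1n mxE.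
rewrite (reindex _ (curry_mxvec_bij m m)) /=.
transitivity (\sum_p x p.2 p.1 * y p.1 p.2).
  by apply: eq_bigr => -[k l] _; rewrite [(mxvec y)^T _ _]mxE !mxvecE mxE.
rewrite -(pair_bigA _ (fun k l => x l k * y k l)) exchange_big /=.
by apply: eq_bigr => k _; rewrite mxE.
Qed.

(** [B *m W] is the Gram matrix of the form on generators of [g]. Nondegeneracy gives it the rank of
    [B], hence the row space of [W], so the functional of [Q] restricted to [g] is one of its row
    combinations. *)
Lemma trace_form_represents (F : fieldType) m (g : 'M[F]_m -> Prop) :
    is_subspace g ->
    (forall z, g z -> (forall x, g x -> \tr (z *m x) = 0) -> z = 0) ->
  forall Q, exists2 z, g z & forall x, g x -> \tr (z *m x) = \tr (Q *m x).
Proof.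
move=> subg nondeg Q; have [T formT] := mxtrace_mul_form F m.
have [B defB] := subspace_mx_basis subg.
pose W := T *m B^T.
have trW z (u : 'rV_(m * m)) : mxvec z *m W *m u^T = (\tr (z *m vec_mx (u *m B)))%:M.
  by rewrite -formT vec_mxK trmx_mul !mulmxA.
have BW_W : (B *m W == W)%MS.
  rewrite -(geq_leqif (mxrank_leqif_eq (submxMl _ _))).
  have -> : \rank (B *m W) = \rank B.
    have ker : (kermx (B *m W) <= kermx B)%MS.
      apply/rV_subP => u; rewrite !sub_kermx mulmxA => /eqP uBW.
      have gz : g (vec_mx (u *m B)) by apply/defB; rewrite vec_mxK submxMl.
      suff : vec_mx (u *m B) = 0.
        by move/(congr1 mxvec); rewrite vec_mxK linear0 => ->.
      apply: nondeg => // x /defB/submxP[v def_x].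
      have := trW (vec_mx (u *m B)) v; rewrite vec_mxK uBW mul0mx -def_x mxvecK.
      by move/matrixP/(_ 0 0); rewrite !mxE eqxx mulr1n.
    have := mxrankS ker; rewrite !mxrank_ker => le_ker.
    apply/eqP; rewrite eqn_leq mxrankM_maxl /=.
    by have := rank_leq_row B; have := rank_leq_row (B *m W); lia.
  by rewrite -[\rank B]mxrank_tr mxrankM_maxr.
have : (mxvec Q *m W <= B *m W)%MS.
  by rewrite (eqmxP BW_W) submxMl.
case/submxP => c def_c; exists (vec_mx (c *m B)).
  by apply/defB; rewrite vec_mxK submxMl.
move=> x /defB/submxP[u def_x]; rewrite -[x]mxvecK def_x.
have := trW (vec_mx (c *m B)) u; rewrite vec_mxK -[c *m B *m W]mulmxA -def_c trW.
by move/matrixP/(_ 0 0); rewrite !mxE eqxx !mulr1n.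
Qed.

Section RationalFunctionals.
Variables (F : fieldType).
Hypothesis F0 : [pchar F] =i pred0.

Lemma ratr_frac (x : rat) (a b : int) :
  b != 0 -> x * b%:~R = a%:~R -> ratr x = a%:~R / b%:~R :> F.
Proof.
move=> nz_b xb; apply/eqP; rewrite /ratr eqr_div ?intr_char0_eq0 ?denq_neq0 //.
rewrite -!rmorphM /=; apply/eqP; congr (_%:~R); apply: (@intr_inj rat).
rewrite !rmorphM /= -xb numqE; ring.
Qed.

Lemma ratr_char0D : {morph @ratr F : x y / x + y}.
Proof.
move=> x y; rewrite (@ratr_frac _ (numq x * denq y + numq y * denq x) (denq x * denq y)).
- rewrite /ratr addf_div ?intr_char0_eq0 ?denq_neq0 //.
  by rewrite !rmorphD !rmorphM.
- by rewrite mulf_neq0 ?denq_neq0.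
- by rewrite !rmorphD !rmorphM /= !numqE; ring.
Qed.

Lemma ratr_char0M : {morph @ratr F : x y / x * y}.
Proof.
move=> x y; rewrite (@ratr_frac _ (numq x * numq y) (denq x * denq y)).
- by rewrite /ratr mulf_div !rmorphM.
- by rewrite mulf_neq0 ?denq_neq0.
- by rewrite !rmorphM /= !numqE; ring.
Qed.

(* Positivity of the rational form [\sum_i mu i * phi i ^ 2] plays the role of
   complex conjugation in Cartan's criterion. *)
Lemma rational_functionals_vanish d (lam : 'I_d -> F) (mu : 'I_d -> nat) :
    (forall i, 0 < mu i)%N ->
    (forall phi : 'I_d -> rat,
       (forall c : 'I_d -> rat, \sum_i ratr (c i) * lam i = 0 ->
                                \sum_i c i * phi i = 0) ->
       \sum_i ratr (phi i) * (mu i)%:R * lam i = 0) ->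
  forall i, lam i = 0.
Proof.
move=> mu0 vanish; pose R (c : 'rV[rat]_d) := \sum_i ratr (c 0 i) * lam i = 0.
have [|B defB] := @subspace_rV_basis _ _ R.
  rewrite /R; split=> [|u v Ru Rv|a v Rv].
  - by rewrite big1 // => i _; rewrite mxE -[0]/(0%:R) ratr_nat mul0r.
  - rewrite -[RHS]addr0 -[X in _ = X + _]Ru -[X in _ = _ + X]Rv -big_split /=.
    apply: eq_bigr => i _; by rewrite mxE ratr_char0D mulrDl.
  - rewrite -[RHS](mulr0 (ratr a)) -[X in _ = _ * X]Rv mulr_sumr; apply: eq_bigr => i _.
    by rewrite mxE ratr_char0M mulrA.
(* [B] spans the rational relations of [lam]. If only [0] is orthogonal to all of them, every vector
   is a relation, in particular each [delta_mx 0 i]. *)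
have full : row_full B.
  rewrite /row_full -mxrank_tr -[_ == _]/(row_free _) -kermx_eq0.
  apply/eqP/row_matrixP => k; rewrite row0.
  set phi := row k _; have phiB : phi *m B^T = 0.
    by apply/eqP; rewrite -sub_kermx row_sub.
  have relp (c : 'rV_d) : R c -> \sum_i c 0 i * phi 0 i = 0.
    move/defB/submxP=> [u def_c]; have : phi *m c^T = 0.
      by rewrite def_c trmx_mul mulmxA phiB mul0mx.
    move/matrixP/(_ 0 0); rewrite [RHS]mxE mxE => phi0; rewrite -[RHS]phi0.
    by apply: eq_bigr => i _; rewrite [c^T _ _]mxE mulrC.
  have sum0 : \sum_i ratr (phi 0 i) * (mu i)%:R * lam i = 0.
    apply: vanish => c Rc; rewrite -[RHS](relp (\row_i c i)).
      by apply: eq_bigr => i _; rewrite [(\row_i c i) _ _]mxE.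
    by rewrite /R -[RHS]Rc; apply: eq_bigr => i _; rewrite mxE.
  (* By [sum0], the vector [phi * mu] is itself a relation, so [phi] is orthogonal to it: the sum of
     the [mu i * phi i ^ 2] is [0]. *)
  have /relp : R (\row_i (phi 0 i * (mu i)%:R)).
    rewrite /R -[RHS]sum0; apply: eq_bigr => i _.
    by rewrite mxE ratr_char0M ratr_nat.
  move/eqP; rewrite psumr_eq0 => [/allP all0|i _]; last first.
    by rewrite [(\row_i _) _ _]mxE mulrAC mulr_ge0 ?ler0n // -expr2 sqr_ge0.
  apply/rowP => i; have := all0 i (mem_index_enum _); rewrite [(\row_i _) _ _]mxE mulrAC.
  rewrite mulf_eq0 pnatr_eq0 [_ == 0%N]eqn0Ngt mu0 orbF -expr2 expf_eq0 /= => /eqP->.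
  by rewrite mxE.
move=> i; have : R (delta_mx 0 i) by apply/defB/submx_full.
rewrite /R (bigD1 i) //= mxE !eqxx ratr_nat mul1r big1 ?addr0 // => j nji.
by rewrite mxE (negPf nji) andbF -[0%:R]/(0%:R) ratr_nat mul0r.
Qed.

Lemma rational_functionals_vanish_seq (s : seq F) (mu : F -> nat) :
    uniq s -> (forall a, a \in s -> 0 < mu a)%N ->
    (forall phi : F -> rat,
       (forall c : F -> rat, \sum_(a <- s) ratr (c a) * a = 0 ->
                             \sum_(a <- s) c a * phi a = 0) ->
       \sum_(a <- s) ratr (phi a) * (mu a)%:R * a = 0) ->
  forall a, a \in s -> a = 0.
Proof.
move=> uniq_s mu_s vanish a a_s; pose lam (i : 'I_(size s)) := nth 0 s i.
have := @rational_functionals_vanish _ lam (fun i => mu (lam i)) _ _.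
have sumE (V : nmodType) (f : F -> V) : \sum_(a <- s) f a = \sum_i f (lam i).
  by rewrite (big_nth 0) big_mkord.
have extend (phi : 'I_(size s) -> rat) : exists phi', forall i, phi' (lam i) = phi i.
  exists (fun a => oapp phi 0 (insub (index a s))) => i.
  by rewrite index_uniq // valK.
move=> vanish_ord; have a_lt : (index a s < size s)%N by rewrite index_mem.
have -> : a = lam (Ordinal a_lt) by rewrite /lam nth_index.
apply: vanish_ord => [i|phi rel]; first by apply/mu_s/mem_nth.
have [phi' def_phi] := extend phi; rewrite -[RHS](vanish phi') => [|c].
  by rewrite sumE; apply: eq_bigr => i _; rewrite def_phi.
rewrite !sumE => /rel {2}<-; apply: eq_bigr => i _.
by rewrite def_phi.
Qed.

End RationalFunctionals.

(** * Polynomial functions on matrices *)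

Lemma mpoly_alg_ind n (R : nzRingType) (P : {mpoly R[n]} -> Prop) :
    (forall c, P c%:MP) -> (forall i, P 'X_i) ->
    (forall p q, P p -> P q -> P (p + q)) ->
    (forall p q, P p -> P q -> P (p * q)) ->
  forall p, P p.
Proof.
move=> PC PX PD PM; elim/mpolyind => [|c m p _ _ Pp]; first by rewrite -mpolyC0.
apply: (PD) => //; rewrite -mul_mpolyC; apply: (PM) => //.
rewrite mpolyXE_id; elim/big_rec: _ => [|i q _ Pq]; first by rewrite -mpolyC1.
apply: (PM) => //; elim: (m i) => [|k IH]; first by rewrite expr0 -mpolyC1.
by rewrite exprS; apply: (PM).
Qed.

Section MatrixPolynomials.
Variables (L : fieldType) (m : nat).
Local Notation N := (m.+1 * m.+1)%N.
Local Notation A := 'M[L]_m.+1.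
Local Notation P := {mpoly L[N]}.
Implicit Types (B C X Y x y g h : A) (p q : P).

Lemma mxpt_index B a b : mxpt B (mxvec_index a b) = B a b.
Proof. by rewrite /mxpt mxvecE. Qed.

(* The coordinates of [T * B], where [T] is the matrix of indeterminates. *)
Definition mulX B (i : 'I_N) : P :=
  \sum_(j < m.+1) \sum_(k < m.+1)
    mxpt (delta_mx j k *m B) i *: 'X_(mxvec_index j k).

Lemma mulX_index B a b :
  mulX B (mxvec_index a b) = \sum_c B c b *: 'X_(mxvec_index a c).
Proof.
rewrite /mulX (bigD1 a) //= [X in _ + X]big1 ?addr0 => [|j nja].
  apply: eq_bigr => c _; rewrite mxpt_index; congr (_ *: _).
  rewrite mxE (bigD1 c) //= mxE !eqxx mul1r big1 ?addr0 // => d ndc.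
  by rewrite mxE (negPf ndc) andbF mul0r.
apply: big1 => c _; rewrite mxpt_index (_ : (_ *m _) a b = 0) ?scale0r //.
rewrite mxE; apply: big1 => d _; rewrite mxE [a == j]eq_sym (negPf nja).
by rewrite mul0r.
Qed.

Lemma mulX1 i : mulX 1 i = 'X_i.
Proof.
case/mxvec_indexP: i => a b; rewrite mulX_index (bigD1 b) //= mxE eqxx scale1r.
by rewrite big1 ?addr0 // => c ncb; rewrite mxE (negPf ncb) scale0r.
Qed.

Lemma mulX_linear a B C i : mulX (a *: B + C) i = a *: mulX B i + mulX C i.
Proof.
case/mxvec_indexP: i => j k; rewrite !mulX_index scaler_sumr -big_split /=.
by apply: eq_bigr => c _; rewrite !mxE scalerDl scalerA.
Qed.

Lemma mulX0 i : mulX 0 i = 0.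
Proof.
by case/mxvec_indexP: i => a b; rewrite mulX_index big1 // => c _; rewrite mxE scale0r.
Qed.

Lemma mulXZ a B i : mulX (a *: B) i = a *: mulX B i.
Proof. by rewrite -[a *: B]addr0 mulX_linear mulX0 addr0. Qed.

Lemma mulX_sum (I : Type) (r : seq I) (f : I -> A) i :
  mulX (\sum_(j <- r) f j) i = \sum_(j <- r) mulX (f j) i.
Proof.
elim: r => [|j r IH]; last by rewrite !big_cons -[f j]scale1r mulX_linear IH !scale1r.
by rewrite !big_nil mulX0.
Qed.

Lemma meval_mulX B C i : (mulX B i).@[mxpt C] = mxpt (C * B) i.
Proof.
case/mxvec_indexP: i => a b; rewrite mulX_index mxpt_index rmorph_sum /= mxE.
by apply: eq_bigr => c _; rewrite mevalZ mevalXU mxpt_index mulrC.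
Qed.

(* The left-invariant derivation whose value at the identity is [X]. *)
Definition lderiv X p : P := \sum_i mulX X i * p^`M(i).

Fact lderiv_linear X : linear (lderiv X).
Proof.
move=> a p q; rewrite /lderiv scaler_sumr -big_split /=; apply: eq_bigr => i _.
by rewrite mderivD mderivZ mulrDr scalerAr.
Qed.
HB.instance Definition _ X := GRing.isLinear.Build L P P _ (lderiv X) (lderiv_linear X).

Lemma lderivM X p q : lderiv X (p * q) = lderiv X p * q + p * lderiv X q.
Proof.
rewrite /lderiv mulr_suml mulr_sumr -big_split /=; apply: eq_bigr => i _.
by rewrite mderivM; ring.
Qed.

Lemma lderivC X c : lderiv X c%:MP = 0.
Proof. by rewrite /lderiv big1 // => i _; rewrite mderivC mulr0. Qed.

Lemma lderivX X i : lderiv X 'X_i = mulX X i.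
Proof.
rewrite /lderiv (bigD1 i) //= big1 => [|j nji].
  rewrite mderivX mnm1E eqxx scale1r addr0 (_ : (_ - _)%MM = 0%MM) ?mpolyX0 ?mulr1 //.
  by apply/mnmP => j; rewrite mnmBE mnm0E subnn.
by rewrite mderivX mnm1E eq_sym (negPf nji) scale0r mulr0.
Qed.

Lemma lderiv_mulX X B i : lderiv X (mulX B i) = mulX (X * B) i.
Proof.
case/mxvec_indexP: i => a b; rewrite !mulX_index raddf_sum /=.
under eq_bigr do rewrite linearZ /= lderivX mulX_index scaler_sumr.
rewrite exchange_big /=; apply: eq_bigr => c _; rewrite mxE scaler_suml.
by apply: eq_bigr => d _; rewrite scalerA mulrC.
Qed.

Lemma lderiv_linearl a X Y p : lderiv (a *: X + Y) p = a *: lderiv X p + lderiv Y p.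
Proof.
rewrite /lderiv scaler_sumr -big_split /=; apply: eq_bigr => i _.
by rewrite mulX_linear mulrDl scalerAl.
Qed.

Lemma lderiv_bracket X Y p :
  lderiv (bracket X Y) p = lderiv X (lderiv Y p) - lderiv Y (lderiv X p).
Proof.
elim/mpoly_alg_ind: p => [c|i|p q IHp IHq|p q IHp IHq].
- by rewrite !lderivC !linear0 addr0.
- rewrite !lderivX !lderiv_mulX /bracket -[- _]scaleN1r addrC mulX_linear.
  by rewrite scaleN1r addrC.
- by rewrite !linearD /= IHp IHq addrACA.
- by rewrite !lderivM !linearD /= !lderivM IHp IHq; ring.
Qed.

Definition rtrans g p : P := mmap (@mpolyC N L) (mulX g) p.

Lemma rtransD g p q : rtrans g (p + q) = rtrans g p + rtrans g q.
Proof. exact: mmapD. Qed.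

Lemma rtransM g p q : rtrans g (p * q) = rtrans g p * rtrans g q.
Proof. exact: rmorphM. Qed.

Lemma rtransC g c : rtrans g c%:MP = c%:MP.
Proof. exact: mmapC. Qed.

Lemma rtransZ g c p : rtrans g (c *: p) = c *: rtrans g p.
Proof. by rewrite /rtrans mmapZ mul_mpolyC. Qed.

Lemma rtransX g i : rtrans g 'X_i = mulX g i.
Proof. by rewrite /rtrans mmapX mmap1U. Qed.

Lemma rtrans_mulX g B i : rtrans g (mulX B i) = mulX (g * B) i.
Proof.
case/mxvec_indexP: i => a b; rewrite !mulX_index /rtrans raddf_sum /=.
under eq_bigr do rewrite -/(rtrans g _) rtransZ rtransX mulX_index scaler_sumr.
rewrite exchange_big /=; apply: eq_bigr => c _; rewrite mxE scaler_suml.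
by apply: eq_bigr => d _; rewrite scalerA mulrC.
Qed.

Lemma meval_rtrans g p B : (rtrans g p).@[mxpt B] = p.@[mxpt (B * g)].
Proof.
elim/mpoly_alg_ind: p => [c|i|p q IHp IHq|p q IHp IHq].
- by rewrite rtransC !mevalC.
- by rewrite rtransX meval_mulX mevalXU.
- by rewrite rtransD !mevalD IHp IHq.
- by rewrite rtransM !mevalM IHp IHq.
Qed.

Lemma lderiv_rtrans X Y h p :
  h * Y = X * h -> lderiv X (rtrans h p) = rtrans h (lderiv Y p).
Proof.
move=> hY; elim/mpoly_alg_ind: p => [c|i|p q IHp IHq|p q IHp IHq].
- by rewrite rtransC !lderivC /rtrans mmap0.
- by rewrite rtransX !lderivX lderiv_mulX rtrans_mulX hY.
- by rewrite rtransD !linearD /= rtransD IHp IHq.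
- by rewrite rtransM !lderivM rtransD !rtransM IHp IHq.
Qed.

(** Coordinates of the curve [s |-> B * exp (s X)], with the exponential cut as in [nexp]. *)
Definition expcurve B X (i : 'I_N) : {poly L} :=
  \poly_(k < m.+1) (mxpt (B * X ^+ k) i / k`!%:R).

Definition curve B X p : {poly L} := mmap (@polyC L) (expcurve B X) p.

Lemma curveC B X c : curve B X c%:MP = c%:P.
Proof. exact: mmapC. Qed.

Lemma curveX B X i : curve B X 'X_i = expcurve B X i.
Proof. by rewrite /curve mmapX mmap1U. Qed.

Lemma curveD B X p q : curve B X (p + q) = curve B X p + curve B X q.
Proof. exact: mmapD. Qed.

Lemma curveM B X p q : curve B X (p * q) = curve B X p * curve B X q.
Proof. exact: rmorphM. Qed.

Lemma curveZ B X c p : curve B X (c *: p) = c *: curve B X p.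
Proof. by rewrite /curve mmapZ mul_polyC. Qed.

Lemma horner_curve B X p s :
  (curve B X p).[s] = p.@[mxpt (B * nexp (s *: X))].
Proof.
elim/mpoly_alg_ind: p => [c|i|p q IHp IHq|p q IHp IHq].
- by rewrite curveC hornerC mevalC.
- rewrite curveX mevalXU /expcurve horner_poly; case/mxvec_indexP: i => a b.
  rewrite mxpt_index /nexp mulr_sumr summxE; apply: eq_bigr => k _.
  by rewrite mxpt_index exprZn -!scalerAr !mxE; ring.
- by rewrite curveD hornerD mevalD IHp IHq.
- by rewrite curveM hornerM mevalM IHp IHq.
Qed.

Hypothesis L0 : [pchar L] =i pred0.

Let natL0 k : (k%:R == 0 :> L) = (k == 0)%N.
Proof. by move/pcharf0P: L0. Qed.

Lemma deriv_curve B X p :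
  X ^+ m.+1 = 0 -> (curve B X p)^`() = curve B X (lderiv X p).
Proof.
move=> X0; elim/mpoly_alg_ind: p => [c|i|p q IHp IHq|p q IHp IHq].
- by rewrite curveC derivC lderivC -mpolyC0 curveC.
- rewrite curveX lderivX; case/mxvec_indexP: i => a b; rewrite mulX_index.
  rewrite /curve raddf_sum /=.
  under eq_bigr do rewrite -/(curve B X _) curveZ curveX.
  apply/polyP => k; rewrite coef_deriv coef_sum coef_poly mxpt_index.
  under eq_bigr do rewrite coefZ coef_poly mxpt_index.
  have [lt_km|le_mk] := ltnP k m.+1; last first.
    rewrite ltnNge (leqW le_mk) /= mul0rn big1 // => c _.
    by rewrite mulr0.
  transitivity ((B * X ^+ k.+1) a b / k`!%:R).
    (* The coefficient that truncation loses is that of [X ^+ m.+1], which is [0]. *)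
    case: ltnP => [_|le_mk]; last by rewrite (expr_vanish X0) // mulr0 mxE mul0r mul0rn.
    by rewrite -[LHS]mulr_natr factS natrM invfM mulrA mulrAC mulfVK // natL0.
  rewrite exprSr mulrA mxE mulr_suml; apply: eq_bigr => c _.
  by rewrite mulrAC mulrC.
- by rewrite curveD derivD linearD /= curveD IHp IHq.
- by rewrite curveM derivM lderivM curveD !curveM IHp IHq.
Qed.

End MatrixPolynomials.

(** * The Lie algebra of a matrix group *)

Lemma nexp_unit (F : fieldType) m (X : 'M[F]_m.+1) :
  [pchar F] =i pred0 -> X ^+ m.+1 = 0 -> nexp X \in unitmx.
Proof. by move=> F0 X0; have [] := mulmx1_unit (nexpN F0 X0). Qed.

Lemma char0_natr_inj (F : fieldType) :
  [pchar F] =i pred0 -> injective (fun k => k%:R : F).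
Proof.
move=> /pcharf0P natF0 i j; wlog le_ij: i j / (i <= j)%N => [IH|] eq_ij.
  by case/orP: (leq_total i j) => /IH; [apply | move=> ->].
apply/eqP; rewrite eqn_leq le_ij /= -subn_eq0 -natF0 natrB //.
by rewrite eq_ij subrr.
Qed.

Lemma poly_nat_roots (F : fieldType) (p : {poly F}) :
  [pchar F] =i pred0 -> (forall k : nat, p.[k%:R] = 0) -> p = 0.
Proof.
move=> F0 p0; apply/eqP; apply: contraT => nz_p.
have [k] := ex_nonroot (char0_natr_inj F0) nz_p.
by rewrite p0 eqxx.
Qed.

Section AlgebraicGroup.
Variables (L : fieldType) (m : nat).
Hypothesis L0 : [pchar L] =i pred0.
Local Notation N := (m.+1 * m.+1)%N.
Local Notation A := 'M[L]_m.+1.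
Local Notation P := {mpoly L[N]}.
Variables (G : A -> Prop) (S : seq P).
Hypothesis subG : is_subgroup G.
Hypothesis defG : forall B, G B <-> B \in unitmx /\ forall p, p \in S -> p.@[mxpt B] = 0.
Implicit Types (B C X Y x y g h : A) (p q : P).

Definition vanishing p := forall B, G B -> p.@[mxpt B] = 0.

(** Left-invariant derivations preserving the ideal of the group. This ideal consists of all
    polynomials vanishing at the points of [G], not only of those generated by [S]. *)
Definition Lie X := forall p, vanishing p -> vanishing (lderiv X p).

Lemma grp1 : G 1.
Proof. by case: subG. Qed.

Lemma grpM B C : G B -> G C -> G (B * C).
Proof. by case: subG => _ _ + _; apply. Qed.

Lemma grpV B : G B -> G (invmx B).
Proof. by case: subG => _ _ _; apply. Qed.

Lemma grp_unit B : G B -> B \in unitmx.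
Proof. by case: subG => _ + _ _; apply. Qed.

Lemma grp_mulV B : G B -> B * invmx B = 1.
Proof. by move=> /grp_unit uB; exact: (mulmxV uB). Qed.

Lemma grp_mulVl B : G B -> invmx B * B = 1.
Proof. by move=> /grp_unit uB; exact: (mulVmx uB). Qed.

Lemma grpX B k : G B -> G (B ^+ k).
Proof. by move=> GB; elim: k => [|k IH]; [apply: grp1 | rewrite exprS; apply: grpM]. Qed.

Lemma vanishing_subspace : is_subspace vanishing.
Proof.
split=> [B _|p q Ip Iq B GB|a p Ip B GB]; first by rewrite meval0.
  by rewrite mevalD Ip // Iq // addr0.
by rewrite mevalZ Ip // mulr0.
Qed.

Lemma vanishing_mem B : B \in unitmx -> (forall p, vanishing p -> p.@[mxpt B] = 0) -> G B.
Proof.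
move=> uB I0; apply/defG; split=> // p Sp; apply: I0 => C /defG[_]; exact.
Qed.

Lemma vanishing_rtrans h p : G h -> vanishing p -> vanishing (rtrans h p).
Proof. by move=> Gh Ip B GB; rewrite meval_rtrans; apply/Ip/grpM. Qed.

Lemma Lie_subspace : is_subspace Lie.
Proof.
have [I0 ID IZ] := vanishing_subspace.
have lin a X Y p : vanishing (lderiv X p) -> vanishing (lderiv Y p) ->
    vanishing (lderiv (a *: X + Y) p).
  by move=> IX IY; rewrite lderiv_linearl; apply: ID => //; apply: IZ.
have L0' : Lie 0.
  move=> p Ip; rewrite (_ : lderiv 0 p = 0) //.
  by have := lderiv_linearl (-1) 0 0 p; rewrite scaler0 addr0 scaleN1r addNr.
split=> // [X Y LX LY|a X LX] p Ip.
  by rewrite -[X]scale1r; apply: lin; [apply: LX | apply: LY].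
by rewrite -[a *: X]addr0; apply: lin; [apply: LX | apply: L0'].
Qed.

Lemma Lie_bracket X Y : Lie X -> Lie Y -> Lie (bracket X Y).
Proof.
move=> LX LY p Ip; rewrite lderiv_bracket.
by apply: (subspaceB vanishing_subspace); auto.
Qed.

Lemma Lie_conj h X : G h -> Lie X -> Lie (invmx h * X * h).
Proof.
move=> Gh LX p Ip B GB.
have hY : h * (invmx h * X * h) = X * h by rewrite !mulrA grp_mulV // mul1r.
have := LX _ (vanishing_rtrans Gh Ip) _ (grpM GB (grpV Gh)).
by rewrite (lderiv_rtrans p hY) meval_rtrans -mulrA grp_mulVl // mulr1.
Qed.

(** The derivatives at [0] of [p] along [exp (s X)] are values at [1] of iterated derivations of
    [p], all of which vanish on [G]; in characteristic [0] this forces the polynomial in [s] to be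
    [0]. *)
Lemma Lie_exp X s : X ^+ m.+1 = 0 -> Lie X -> G (nexp (s *: X)).
Proof.
move=> X0 LX; apply: vanishing_mem => [|p Ip].
  by apply: nexp_unit => //; apply: nilpotentZ.
rewrite -[nexp _]mul1r -horner_curve (_ : curve 1 X p = 0) ?horner0 //.
have derivn k q : vanishing q -> (curve 1 X q)^`(k).[0] = 0.
  elim: k q => [|k IH] q Iq.
    by rewrite horner_curve scale0r nexp0 mulr1; apply/Iq/grp1.
  by rewrite derivSn deriv_curve //; apply/IH/LX.
apply/polyP => k; rewrite coef0; have := derivn k p Ip.
rewrite horner_coef0 coef_derivn addn0 ffactnn -mulr_natr => /eqP.
rewrite mulf_eq0; have /pcharf0P-> := L0.
by rewrite eqn0Ngt fact_gt0 orbF => /eqP.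
Qed.

(** Along [B * exp (s X)], [p] vanishes at every natural [s], since [exp (k X) = (exp X)^k]; so it
    vanishes identically, and with it its derivative at [s = 0]. *)
Lemma exp_Lie X : X ^+ m.+1 = 0 -> G (nexp X) -> Lie X.
Proof.
move=> X0 GX1 p Ip B GB.
have curve0 : curve B X p = 0.
  apply: poly_nat_roots => // k; rewrite horner_curve nexp_natmul //.
  by apply/Ip/grpM/grpX.
have := deriv_curve L0 B p X0; rewrite curve0 deriv0 => /(congr1 (horner^~ 0)).
by rewrite horner_curve scale0r nexp0 mulr1 horner0.
Qed.

(* Products of the linear forms [mulX (e a) i] span all polynomials and are both
   generalized eigenvectors of [lderiv x] and eigenvectors of [E], the second
   eigenvalue being a function of the first.  So [E] preserves every subspace
   that is stable under [lderiv x]. *)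
Section WeightDecomposition.
Variables (x : A) (s : seq L) (e : L -> A).
Hypothesis LX : Lie x.
Hypothesis spec : spectral_family x s e.
Variables (E : P -> P) (Rel : L -> L -> Prop) (op : L -> L -> L) (b0 : L) (phi : L -> L).
Hypothesis ED : forall p q, E (p + q) = E p + E q.
Hypothesis EC : forall c, E c%:MP = b0 *: c%:MP.
Hypothesis EM : forall p q a b,
  E p = a *: p -> E q = b *: q -> E (p * q) = op a b *: (p * q).
Hypothesis Egen : forall a i, a \in s -> E (mulX (e a) i) = phi a *: mulX (e a) i.
Hypothesis Rel0 : Rel 0 b0.
Hypothesis Rel_op : forall a b a' b', Rel a b -> Rel a' b' -> Rel (a + a') (op b b').
Hypothesis Rel_gen : forall a, a \in s -> Rel a (phi a).
Hypothesis Rel_fun : forall a b b', Rel a b -> Rel a b' -> b = b'.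

Let weight (z : L * L * P) :=
  [/\ Rel z.1.1 z.1.2, exists k, gen_weight (lderiv x) z.1.1 k z.2 & E z.2 = z.1.2 *: z.2].

Let weight_sum p := exists l, p = \sum_(z <- l) z.2 /\ forall z, z \in l -> weight z.

Let E0 : E 0 = 0.
Proof. by apply: (addIr (E 0)); rewrite -ED !add0r. Qed.

Let weight_sumD p q : weight_sum p -> weight_sum q -> weight_sum (p + q).
Proof.
move=> [l1 [-> wt1]] [l2 [-> wt2]]; exists (l1 ++ l2); rewrite big_cat.
by split=> // z; rewrite mem_cat => /orP[/wt1|/wt2].
Qed.

Let weight_sum1 z : weight z -> weight_sum z.2.
Proof. by move=> wz; exists [:: z]; rewrite big_seq1; split=> // y /[!inE] /eqP->. Qed.

Let weight_sum_big (I : eqType) (r : seq I) (f : I -> P) :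
  (forall i, i \in r -> weight_sum (f i)) -> weight_sum (\sum_(i <- r) f i).
Proof.
elim: r => [|i r IH] wt_f; first by exists [::]; rewrite !big_nil.
rewrite big_cons; apply: weight_sumD; first by apply: wt_f; rewrite mem_head.
by apply: IH => j j_r; apply: wt_f; rewrite inE j_r orbT.
Qed.

Let weight_sumM p q : weight_sum p -> weight_sum q -> weight_sum (p * q).
Proof.
move=> [l1 [-> wt1]] [l2 [-> wt2]]; rewrite mulr_suml.
apply: weight_sum_big => z1 /wt1[R1 [k1 gw1] E1]; rewrite mulr_sumr.
apply: weight_sum_big => z2 /wt2[R2 [k2 gw2] E2].
apply: (weight_sum1 (z := (z1.1.1 + z2.1.1, op z1.1.2 z2.1.2, z1.2 * z2.2))).
split=> /=; [exact: Rel_op | exists (k1 + k2)%N | exact: EM].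
by apply: gen_weight_mul => //; apply: lderivM.
Qed.

Let gen_weight_mulX a k B i :
  (x - a%:M) ^+ k * B = 0 -> gen_weight (lderiv x) a k (mulX B i).
Proof.
rewrite /gen_weight; elim: k B => [|k IH] B.
  by rewrite mul1r => ->; rewrite mulX0.
rewrite exprSr -mulrA => /IH; rewrite iterSr.
suff -> : shift (lderiv x) a (mulX B i) = mulX ((x - a%:M) * B) i by [].
rewrite /shift /= lderiv_mulX mulrBl -[a%:M * B]/(a%:M *m B) mul_scalar_mx.
by rewrite addrC -!scaleNr -mulX_linear addrC.
Qed.

Let weight_sum_all p : weight_sum p.
Proof.
have [uniq_s sum_e [k wt_e] _ _] := spec.
elim/mpoly_alg_ind: p => [c|i|p q|p q].
- apply: (weight_sum1 (z := (0, b0, c%:MP))); split=> //=; exists 1%N.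
  by rewrite /gen_weight /= /shift /= lderivC scale0r subr0.
- rewrite -mulX1 -sum_e mulX_sum; apply: weight_sum_big => a a_s.
  apply: (weight_sum1 (z := (a, phi a, mulX (e a) i))).
  split=> /=; [exact: Rel_gen | exists k | exact: Egen].
  exact/gen_weight_mulX/wt_e.
- exact: weight_sumD.
- exact: weight_sumM.
Qed.

Lemma weights_stable p : vanishing p -> vanishing (E p).
Proof.
move=> Ip; have [l [def_p wt_l]] := weight_sum_all p.
have -> : E p = \sum_(z <- l) z.1.2 *: z.2.
  rewrite def_p; elim: {def_p}l wt_l => [|z l IH] wt_l; first by rewrite !big_nil E0.
  rewrite !big_cons ED IH => [|y y_l]; last by apply: wt_l; rewrite inE y_l orbT.
  by have [_ _ ->] := wt_l z (mem_head _ _).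
apply: (gen_weight_rescale (D := lderiv x) vanishing_subspace).
- exact: LX.
- by move=> z /wt_l[].
- move=> z y /wt_l[Rz _ _] /wt_l[Ry _ _] zy.
  by apply: Rel_fun Rz _; rewrite zy.
- by rewrite -def_p.
Qed.

End WeightDecomposition.

Lemma spectral_eigen (x : A) s e (phi : L -> L) a : spectral_family x s e -> a \in s ->
  (\sum_(b <- s) phi b *: e b) * e a = phi a *: e a.
Proof.
case=> uniq_s _ _ orth _ a_s; rewrite mulr_suml (bigD1_seq a) //= -scalerAl.
rewrite orth // eqxx big_seq_cond big1 ?addr0 // => b /andP[b_s nba].
by rewrite -scalerAl orth // (negPf nba) scaler0.
Qed.

(** On polynomials of weight [\sum_d c d * d] the replica acts by the scalar [\sum_d c d * phi d];
    the condition on [phi] says that two expressions of one weight give the same scalar. *)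
Lemma Lie_rescale x s e (phi : L -> rat) : Lie x -> spectral_family x s e ->
    (forall c : L -> rat, \sum_(a <- s) ratr (c a) * a = 0 ->
                          \sum_(a <- s) c a * phi a = 0) ->
  Lie (\sum_(a <- s) ratr (phi a) *: e a).
Proof.
move=> Lx spec rel p Ip; set x' := \sum_(a <- s) _.
pose Rel a b := exists2 c : L -> rat, a = \sum_(d <- s) ratr (c d) * d &
  b = ratr (\sum_(d <- s) c d * phi d) :> L.
have ratr0 : ratr 0 = 0 :> L by rewrite -[0]/(0%:R) ratr_nat.
have uniq_s : uniq s by case: spec.
apply: (weights_stable Lx spec (Rel := Rel) (op := +%R) (b0 := 0)
  (phi := fun a => ratr (phi a))) => //.
- by move=> q1 q2; rewrite linearD.
- by move=> c; rewrite lderivC scale0r.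
- by move=> q1 q2 a b q1a q2b; rewrite lderivM q1a q2b scalerDl -scalerAl -scalerAr.
- move=> a i a_s; rewrite lderiv_mulX /x' (spectral_eigen (fun a => ratr (phi a)) spec) //.
  exact: mulXZ.
- exists (fun=> 0); rewrite big1 ?ratr0 // => a _; rewrite ?mul0r ?ratr0 ?mul0r //.
- move=> a b a' b' [c -> ->] [c' -> ->]; exists (fun d => c d + c' d).
    by rewrite -big_split; apply: eq_bigr => d _; rewrite ratr_char0D // mulrDl.
  by rewrite -ratr_char0D // -big_split; congr ratr; apply: eq_bigr => d _; rewrite mulrDl.
- move=> a a_s; exists (fun d => (d == a)%:R); rewrite (bigD1_seq a) //= eqxx.
    by rewrite ratr_nat mul1r big1 ?addr0 // => d /negPf->; rewrite ratr_nat mul0r.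
  by rewrite mul1r big1 ?addr0 // => d /negPf->; rewrite mul0r.
- move=> a b b' [c -> ->] [c' eq_c ->]; congr ratr; apply/eqP; rewrite -subr_eq0.
  rewrite -sumrB; apply/eqP; rewrite -[RHS](rel (fun d => c d - c' d)).
    by apply: eq_bigr => d _; rewrite mulrBl.
  rewrite -[RHS](subrr (\sum_(d <- s) ratr (c d) * d)) {2}eq_c -sumrB.
  apply: eq_bigr => d _; rewrite -mulrBl; congr (_ * _); apply: (addIr (ratr (c' d))).
  by rewrite -ratr_char0D // !subrK.
Qed.

(** Right translation by the matrix acts on polynomials of integral weight [z] by [t ^ z], and [z]
    is determined by its image in [L]. So the ideal of [G] is stable under this translation, and
    evaluating at [1] gives the claim. *)
Lemma torus_mem h s e (t : L) (wt : L -> int) : Lie h -> spectral_family h s e ->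
    (forall a, a \in s -> a = (wt a)%:~R) -> t != 0 ->
  G (\sum_(a <- s) t ^ wt a *: e a).
Proof.
move=> Lh spec int_s t0; set g := \sum_(a <- s) _.
have [uniq_s sum_e _ orth _] := spec.
pose Rel a b := exists2 z : int, a = z%:~R :> L & b = t ^ z.
have eig r b : b \in s -> (\sum_(a <- s) t ^ (r a : int) *: e a) * e b = t ^ (r b) *: e b.
  exact: (spectral_eigen (fun a => t ^ r a) spec).
apply: vanishing_mem => [|p Ip].
  suff /mulmx1_unit[] : g *m (\sum_(a <- s) t ^ (- wt a) *: e a) = 1%:M by [].
  rewrite mulmxE mulr_sumr -[RHS]sum_e; apply: eq_big_seq => a a_s.
  by rewrite -scalerAr eig // scalerA -expfzDr // addNr scale1r.
rewrite -[g]mul1r -meval_rtrans; apply: (_ : vanishing (rtrans g p)); last exact: grp1.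
apply: (weights_stable Lh spec (Rel := Rel) (op := *%R) (b0 := 1)
  (phi := fun a => t ^ wt a)) => //.
- exact: rtransD.
- by move=> c; rewrite rtransC scale1r.
- by move=> q1 q2 a b q1a q2b; rewrite rtransM q1a q2b -scalerAl -scalerAr scalerA.
- move=> a i a_s; rewrite rtrans_mulX eig //.
  exact: mulXZ.
- by exists 0; rewrite ?expr0z.
- by move=> a b a' b' [z -> ->] [z' -> ->]; exists (z + z'); rewrite ?rmorphD ?expfzDr.
- by move=> a a_s; exists (wt a); rewrite -?int_s.
- move=> a b b' [z -> ->] [z' eq_z ->]; congr (t ^ _); apply/eqP; rewrite -subr_eq0.
  by rewrite -(intr_char0_eq0 _ L0) rmorphB /= eq_z subrr.
Qed.

End AlgebraicGroup.

(** * Nondegeneracy of the trace form *)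

Section TraceForm.
Variables (L : closedFieldType) (m : nat).
Hypothesis L0 : [pchar L] =i pred0.
Local Notation N := (m.+1 * m.+1)%N.
Local Notation A := 'M[L]_m.+1.
Local Notation P := {mpoly L[N]}.
Variables (G : mxset L m.+1) (S : seq P).
Hypothesis subG : is_subgroup G.
Hypothesis defG : forall B, G B <-> B \in unitmx /\ forall p, p \in S -> p.@[mxpt B] = 0.
Implicit Types (B C X Y x y g h v : A) (p q : P).

Local Notation Lie := (Lie G).

Definition trace_radical x := Lie x /\ forall y, Lie y -> \tr (x * y) = 0.

Local Notation rad := trace_radical.

Lemma trace_radical_subspace : is_subspace rad.
Proof.
have subL := @Lie_subspace _ _ G.
split=> [|x y [Lx x0] [Ly y0]|a x [Lx x0]].
- split=> [|y _]; first exact: subspace0 subL.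
  by rewrite mul0r mxtrace0.
- split=> [|z Lz]; first exact: (subspaceD subL).
  by rewrite mulrDl mxtraceD x0 // y0 // addr0.
- split=> [|z Lz]; first exact: (subspaceZ subL).
  by rewrite -scalerAl mxtraceZ x0 // mulr0.
Qed.

Lemma mxtraceC x y : \tr (x * y) = \tr (y * x).
Proof. exact: mxtrace_mulC. Qed.

Lemma mxtrace_bracket x y z : \tr (bracket x y * z) = \tr (x * bracket y z).
Proof.
rewrite /bracket mulrBl mulrBr !raddfB /= !mulrA; congr (_ - _).
by rewrite -[y * x * z]mulrA [LHS]mxtraceC.
Qed.

Lemma trace_radical_bracket x y : rad x -> rad y -> rad (bracket x y).
Proof.
move=> [Lx x0] [Ly _]; split=> [|z Lz]; first exact: Lie_bracket.
by rewrite mxtrace_bracket x0 //; apply: Lie_bracket.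
Qed.

Lemma trace_radical_conj g x : G g -> rad x -> rad (invmx g * x * g).
Proof.
move=> Gg [Lx x0]; split=> [|y Ly]; first exact: Lie_conj.
rewrite -!mulrA mxtraceC -!mulrA (mulrA g).
suff -> : g * y * invmx g = invmx (invmx g) * y * invmx g.
  by apply: x0; apply: Lie_conj => //; apply: grpV.
by rewrite invmxK.
Qed.

(* The replicas [\sum_a phi a *: e a] of [x] lie in [Lie G], so [x] is orthogonal
   to all of them. *)
Lemma trace_radical_nilpotent x : rad x -> x ^+ m.+1 = 0.
Proof.
move=> [Lx x0]; have [r def_r] := closed_field_poly_normal (char_poly x).
have [|s [e [spec _]]] := @ex_spectral_family _ _ x r.
  have := Cayley_Hamilton x; rewrite {1}def_r.
  rewrite (monicP (char_poly_monic x)) scale1r rmorph_prod /= => <-.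
  by apply: eq_bigr => a _; rewrite rmorphB /= horner_mx_X horner_mx_C.
have [uniq_s sum_e [k wt_e] orth poly_e] := spec.
(* On the range of [e a], [x] is the scalar [a] plus a nilpotent. *)
have tr_e a : a \in s -> \tr (x * e a) = a * (\rank (e a))%:R.
  move=> a_s; have -> : x * e a = (x - a%:M) * e a + a *: e a.
    by rewrite mulrBl (mul_scalar_mx a (e a) : a%:M * e a = _) subrK.
  rewrite mxtraceD mxtraceZ (@idempotent_trace _ _ (e a)); last first.
    by apply: etrans (orth a a a_s a_s) _; rewrite eqxx.
  rewrite (@nilpotent_trace0 _ _ _ k.+1) ?add0r //.
  have [_ [p def_e]] := poly_e a a_s.
  rewrite exprMn_comm; last first.
    rewrite def_e -[x in x - _]horner_mx_X -(horner_mx_C x) -rmorphB.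
    by rewrite /GRing.comm -!rmorphM mulrC.
  by rewrite exprS [e a ^+ _]exprS -mulrA [_ ^+ k * _]mulrA wt_e // mul0r mulr0.
have s0 : forall a, a \in s -> a = 0.
  apply: (rational_functionals_vanish_seq L0 (mu := fun a => \rank (e a))) => //.
    by move=> a /poly_e[nz _]; rewrite lt0n mxrank_eq0.
  move=> phi rel; have := x0 _ (Lie_rescale L0 Lx spec rel).
  rewrite mulr_sumr raddf_sum /= => sum0; rewrite -[RHS]sum0; apply: eq_big_seq => a a_s.
  by rewrite -scalerAr mxtraceZ tr_e // -mulrA [_%:R * a]mulrC.
apply: (@mx_nilpotent_exp _ _ k); rewrite -[_ ^+ _]mulr1 -sum_e mulr_sumr.
rewrite big_seq big1 // => a a_s; have := wt_e a a_s.
by rewrite (s0 a a_s) raddf0 subr0.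
Qed.

(** * The normal unipotent subgroup attached to the trace radical *)

Section Unipotent.
Variable M : nat.
Hypothesis killM : forall v, kills rad M v.

Lemma kills_G g i v : G g -> kills rad i v -> kills rad i (g * v).
Proof.
move=> Gg; elim: i v => [|i IH] v /=; first by move=> ->; rewrite mulr0.
move=> kv k rk; have -> : k * (g * v) = g * ((invmx g * k * g) * v).
  by rewrite !mulrA (grp_mulV subG Gg) mul1r.
by apply/IH/kv/trace_radical_conj.
Qed.

(** Filters matrices by the number of levels they descend in the flag of [rad]. The flag is
    [G]-stable and [lowers M] is [0], so the elements of [G] in [1 + lowers 1] form a normal
    unipotent subgroup, containing the exponentials of [rad]. *)
Definition lowers j a := forall i v, kills rad (i + j) v -> kills rad i (a * v).

Lemma lowers_subspace j : is_subspace (lowers j).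
Proof.
split=> [i v _|a b la lb i v kv|c a la i v kv]; rewrite ?mul0r ?mulrDl -?scalerAl.
- exact: subspace0 (kills_subspace _ _).
- by apply: (subspaceD (kills_subspace _ _)); auto.
- by apply: (subspaceZ (kills_subspace _ _)); auto.
Qed.

Lemma lowersM j l a b : lowers j a -> lowers l b -> lowers (j + l) (a * b).
Proof. by move=> la lb i v; rewrite addnA -mulrA => /lb/la. Qed.

Lemma lowers_leq j l a : (l <= j)%N -> lowers j a -> lowers l a.
Proof. by move=> le_lj la i v kv; apply: la; apply: kills_leq kv; rewrite leq_add2l. Qed.

Lemma lowers_top a : lowers M a -> a = 0.
Proof. by move=> la; have := la 0%N 1 (killM 1); rewrite mulr1. Qed.

Lemma lowersGl g j a : G g -> lowers j a -> lowers j (g * a).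
Proof. by move=> Gg la i v kv; rewrite -mulrA; apply/kills_G/la. Qed.

Lemma lowersGr g j a : G g -> lowers j a -> lowers j (a * g).
Proof. by move=> Gg la i v kv; rewrite -mulrA; apply/la/kills_G. Qed.

Lemma lowers_rad x : rad x -> lowers 1 x.
Proof. by move=> rx i v; rewrite addn1; apply. Qed.

Lemma lowersX j a k : lowers 1 a -> (j <= k)%N -> lowers j (a ^+ k).
Proof.
move=> la /lowers_leq; apply; elim: k => [|k IH]; last by rewrite exprS -add1n; apply: lowersM.
by move=> i v; rewrite addn0 mul1r.
Qed.

Definition unipotent_radical : mxset L m.+1 := fun g => G g /\ lowers 1 (g - 1).

Local Notation H := unipotent_radical.

Lemma unipotent_radical_nilpotent g : H g -> (g - 1) ^+ m.+1 = 0.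
Proof.
by case=> _ lg; apply: (@mx_nilpotent_exp _ _ M); apply/lowers_top/lowersX.
Qed.

Lemma nexp_lowers X s : lowers 1 X -> lowers 1 (nexp (s *: X) - 1).
Proof.
move=> lX; rewrite /nexp big_ord_recl expr0 fact0 invr1 scale1r addrC addKr.
apply: (subspace_sum (lowers_subspace 1)) => i _; rewrite exprZn.
by do 2 apply: (subspaceZ (lowers_subspace 1)); apply: lowersX.
Qed.

(** Puts each element on a one-parameter subgroup inside [H]: the logarithm stays in [lowers 1],
    which is closed under products. *)
Lemma unipotent_radical_log g : H g ->
  exists2 X, X ^+ m.+1 = 0 /\ nexp X = g & forall s, H (nexp (s *: X)).
Proof.
move=> Hg; have nil_g := unipotent_radical_nilpotent Hg; have [Gg lg] := Hg.
have [l_0 lD lZ] := lowers_subspace 1.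
have lM a b : lowers 1 a -> lowers 1 b -> lowers 1 (a * b).
  by move=> la lb; apply: lowers_leq (lowersM la lb).
have [X [lX X0 expX]] := nexp_onto L0 l_0 lD lZ lM lg nil_g.
rewrite addrC subrK in expX; exists X => // s.
split; last exact: nexp_lowers.
by apply: (Lie_exp L0 subG defG) => //; apply: (exp_Lie L0 subG); rewrite ?expX.
Qed.

Lemma unipotent_radical_subgroup : is_subgroup H.
Proof.
split.
- by split; [apply: (grp1 subG) | rewrite subrr; apply: subspace0 (lowers_subspace 1)].
- by move=> g [/(grp_unit subG)].
- move=> g h [Gg lg] [Gh lh]; split; first exact: (grpM subG).
  rewrite (_ : _ - 1 = g * (h - 1) + (g - 1)); last by rewrite mulrBr mulr1 addrA subrK.
  by apply: (subspaceD (lowers_subspace 1)) => //; apply: lowersGl.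
- move=> g [Gg lg]; have GgV := grpV subG Gg; split=> //.
  rewrite (_ : _ - 1 = - (invmx g * (g - 1))).
    by apply: (subspaceN (lowers_subspace 1)); apply: lowersGl.
  by rewrite mulrBr mulr1 (grp_mulVl subG Gg) opprB.
Qed.

Lemma unipotent_radical_normal : is_normal_in H G.
Proof.
move=> g h Gg [Gh lh]; have GgV := grpV subG Gg; split.
  by do 2 apply: (grpM subG) => //.
rewrite (_ : _ - 1 = invmx g * (h - 1) * g); last first.
  by rewrite mulrBr mulr1 mulrBl (grp_mulVl subG Gg).
by apply: lowersGr => //; apply: lowersGl.
Qed.

Lemma unipotent_radical_closed : zclosed_in G H.
Proof.
have [B defB] := subspace_mx_basis (lowers_subspace 1).
pose form j : P := \sum_i cokermx B i j *: ('X_i - (mxpt (1 : A) i)%:MP).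
have formE g j : (form j).@[mxpt g] = (mxvec (g - 1) *m cokermx B) 0 j.
  rewrite /form rmorph_sum /= mxE; apply: eq_bigr => i _.
  by rewrite mevalZ mevalB mevalXU mevalC /mxpt linearB !mxE mulrC.
exists [seq form j | j <- enum 'I_N] => g; split=> [[Gg /defB lg]|[Gg form0]]; split=> //.
  move=> _ /mapP[j _ ->]; rewrite formE; move: lg; rewrite submxE => /eqP->.
  by rewrite mxE.
apply/defB; rewrite submxE; apply/eqP/rowP => j; rewrite -formE [RHS]mxE.
by apply: form0; apply: map_f; rewrite mem_enum.
Qed.

(** The curve [g1 * exp (s X)] joins [g1] to [g2] inside [H]. Neither [p1] nor [p2] vanishes
    identically along it, so at some natural [s] both are nonzero, and that point lies in neither
    closed piece. *)
Lemma unipotent_radical_connected : zconnected H.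
Proof.
move=> [Y1 [Y2 [[[T1 defY1] [T2 defY2]] [[g1 Yg1] [g2 Yg2]] Hcover disj]]].
have [H1 _ HM HV] := unipotent_radical_subgroup.
have Hg1 : H g1 by apply/Hcover; left.
have Hg2 : H g2 by apply/Hcover; right.
have [X [X0 expX] HX] := unipotent_radical_log (HM _ _ (HV _ Hg1) Hg2).
have nonzero (T : seq P) (Z : mxset L m.+1) g :
    (forall B, Z B <-> H B /\ forall p, p \in T -> p.@[mxpt B] = 0) ->
    H g -> ~ Z g -> exists2 p, p \in T & p.@[mxpt g] != 0.
  move=> defZ Hg nZg; apply: NNPP => no_p; apply: nZg; apply/defZ; split=> // p Tp.
  by apply/eqP; apply: contraT => nz; case: no_p; exists p.
have [p2 Tp2 nz2] : exists2 p, p \in T2 & p.@[mxpt g1] != 0.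
  by apply: (nonzero T2 Y2) => // Yg; apply: (disj g1).
have [p1 Tp1 nz1] : exists2 p, p \in T1 & p.@[mxpt g2] != 0.
  by apply: (nonzero T1 Y1) => // Yg; apply: (disj g2).
have c1 : curve g1 X p1 != 0.
  apply: contraNneq nz1 => c0; have := horner_curve g1 X p1 1; rewrite c0 horner0.
  by rewrite scale1r expX mulmxE mulrA (grp_mulV subG (proj1 Hg1)) mul1r => <-.
have c2 : curve g1 X p2 != 0.
  apply: contraNneq nz2 => c0; have := horner_curve g1 X p2 0; rewrite c0 horner0.
  by rewrite scale0r nexp0 mulr1 => <-.
have [k] := ex_nonroot (char0_natr_inj L0) (mulf_neq0 c1 c2).
rewrite hornerM !horner_curve mulf_eq0 negb_or => /andP[k1 k2].
case: (proj1 (Hcover _) (HM _ _ Hg1 (HX k%:R))) => [/defY1[_ Y0]|/defY2[_ Y0]].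
  by rewrite -mulmxE Y0 ?eqxx in k1.
by rewrite -mulmxE Y0 ?eqxx in k2.
Qed.

(** [[a, b] - 1] is [a^-1 b^-1] times the additive commutator of [a - 1] and [b - 1], which descends
    [2 (j + 1) >= j + 2] levels. *)
Lemma mxcomm_lowers j a b : G a -> G b ->
  lowers j.+1 (a - 1) -> lowers j.+1 (b - 1) -> lowers j.+2 (mxcomm a b - 1).
Proof.
move=> Ga Gb la lb; have GaV := grpV subG Ga; have GbV := grpV subG Gb.
have -> : mxcomm a b - 1 =
    (invmx a * invmx b) * ((a - 1) * (b - 1) - (b - 1) * (a - 1)).
  have -> : (a - 1) * (b - 1) - (b - 1) * (a - 1) = a * b - b * a.
    rewrite !mulrBl !mulrBr !mul1r !mulr1 !opprB !addrA.
    rewrite -[RHS]addr0 -!addrA; congr (_ + _).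
    by apply/matrixP => i k; rewrite !mxE; ring.
  rewrite mulrBr -[X in _ = _ - X]mulrA (mulrA (invmx b)) (grp_mulVl subG Gb) mul1r.
  by rewrite (grp_mulVl subG Ga) /mxcomm !mulmxE !mulrA.
apply: lowersGl; first exact: (grpM subG).
have le_j : (j.+2 <= j.+1 + j.+1)%N by rewrite addSn addnS !ltnS leq_addr.
by apply: (subspaceB (lowers_subspace _)); apply: lowers_leq le_j _; apply: lowersM.
Qed.

Lemma unipotent_radical_solvable : mx_solvable H.
Proof.
exists M => g der_g.
suff [_ lg] : G g /\ lowers M.+1 (g - 1).
  by apply/eqP; rewrite -subr_eq0; apply/eqP/lowers_top/(lowers_leq (leqnSn _)).
elim: M g der_g => [|k IH] g /=; first by [].
case=> ps [Hps ->]; elim: ps Hps => [|[a b] ps IHps] Hps /=.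
  by split; [apply: (grp1 subG) | rewrite subrr; apply: subspace0 (lowers_subspace _)].
have [|Gc lc] := IHps; first by move=> p ps_p; apply: Hps; rewrite inE ps_p orbT.
have [/IH[Ga la] /IH[Gb lb]] := Hps _ (mem_head _ _).
set c := foldr _ _ _ in Gc lc *; have GaV := grpV subG Ga; have GbV := grpV subG Gb.
have Gab : G (mxcomm a b) by rewrite /mxcomm !mulmxE; do !apply: (grpM subG).
rewrite mulmxE; split; first exact: (grpM subG).
rewrite (_ : _ - 1 = mxcomm a b * (c - 1) + (mxcomm a b - 1)); last first.
  by rewrite mulrBr mulr1 addrA subrK.
apply: (subspaceD (lowers_subspace _)); last exact: mxcomm_lowers.
exact: lowersGl.
Qed.

End Unipotent.

Theorem trace_radical_eq0 : mx_semisimple G -> forall x, rad x -> x = 0.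
Proof.
move=> ssG x rx; have x0 := trace_radical_nilpotent rx.
have [M killM] := Engel trace_radical_subspace trace_radical_bracket trace_radical_nilpotent.
have Hexp : unipotent_radical (nexp x).
  split; last by rewrite -[x]scale1r; apply/nexp_lowers/lowers_rad.
  by rewrite -[x]scale1r; apply: (Lie_exp L0 subG defG) => //; case: rx.
apply: (nexp_eq1 x0).
apply: (ssG _ unipotent_radical_closed unipotent_radical_subgroup
  unipotent_radical_normal (unipotent_radical_connected killM)
  (unipotent_radical_solvable killM)) => //.
Qed.

End TraceForm.

(** * The Jacobson-Morozov argument *)

Section BracketIdentities.
Variables (F : fieldType) (R : algType F).
Hypothesis F0 : [pchar F] =i pred0.
Implicit Types (x y z n c : R).

Let natF0 k : (k%:R == 0 :> F) = (k == 0)%N.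
Proof. by move/pcharf0P: F0. Qed.

Fact bracket_linear x : linear (bracket x).
Proof.
move=> a y z; rewrite /bracket mulrDr mulrDl scalerBr scalerAr scalerAl opprD.
by rewrite addrACA.
Qed.
HB.instance Definition _ x := GRing.isLinear.Build F R R _ (bracket x) (bracket_linear x).

Lemma bracketD x y z : bracket x (y + z) = bracket x y + bracket x z.
Proof. exact: (linearD (bracket x)). Qed.

Lemma bracketZ x a y : bracket x (a *: y) = a *: bracket x y.
Proof. exact: (linearZZ (bracket x)). Qed.

Lemma bracket0 x : bracket x 0 = 0.
Proof. exact: (linear0 (bracket x)). Qed.

Lemma bracket_sum x (I : Type) (r : seq I) (f : I -> R) :
  bracket x (\sum_(i <- r) f i) = \sum_(i <- r) bracket x (f i).
Proof. exact: (linear_sum (bracket x)). Qed.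

Lemma bracketM x y z : bracket x (y * z) = bracket x y * z + y * bracket x z.
Proof. by rewrite /bracket mulrBl mulrBr !mulrA subrKA. Qed.

Lemma bracket_comm_exp n z k : GRing.comm n (bracket n z) ->
  n ^+ k.+1 * z = z * n ^+ k.+1 + k.+1%:R *: (bracket n z * n ^+ k).
Proof.
move=> cn; have nz : n * z = z * n + bracket n z by rewrite /bracket addrC subrK.
elim: k => [|k IH]; first by rewrite expr1 expr0 mulr1 scale1r.
rewrite exprS -mulrA IH mulrDr mulrA nz mulrDl -mulrA -exprS -scalerAr.
rewrite [n * (_ * _)]mulrA cn -mulrA -exprS -addrA.
by rewrite -[k.+2]add1n natrD scalerDl scale1r.
Qed.

(** Jacobson's lemma. With [c = [n, z]] and [c^a n^(k+1) = 0], multiplying [[n^(k+1), z] = (k+1) c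
    n^k] by [c^a] on both sides gives [c^(2a+1) n^k = 0]; the exponent of [n] thus falls to [0]. *)
Lemma bracket_nilpotent n z d : n ^+ d = 0 -> GRing.comm n (bracket n z) ->
  exists a, bracket n z ^+ a = 0.
Proof.
move=> nd0 cn; set c := bracket n z in cn *.
suff lower k a : c ^+ a * n ^+ k = 0 -> exists a, c ^+ a = 0.
  by apply: (lower d 0%N); rewrite nd0 mulr0.
elim: k a => [|k IH] a; first by rewrite mulr1 => ?; exists a.
move=> can0; apply: (IH (a + a.+1)%N).
have cnX i j : GRing.comm (n ^+ i) (c ^+ j) by apply/commrX/commr_sym/commrX/commr_sym.
have : c ^+ a * (n ^+ k.+1 * z - z * n ^+ k.+1) * c ^+ a = 0.
  rewrite mulrBr mulrBl [c ^+ a * (_ ^+ _ * z)]mulrA can0 !mul0r sub0r.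
  by rewrite -!mulrA (cnX k.+1 a) can0 !mulr0 oppr0.
rewrite bracket_comm_exp // [z * _ + _]addrC addrK -/c -scalerAr -scalerAl => /eqP.
rewrite scaler_eq0 natF0 /= => /eqP => can.
by rewrite exprD exprS -!mulrA -cnX !mulrA -[X in X * _]mulrA in can *.
Qed.

(** Modulo [n^(j+1) R], multiplying [n^j v] by [n z] amounts to replacing [v] by [- j c v], with [c
    = [n, z]] nilpotent. So [(n z)^M] maps [n^j R] into [n^(j+1) R], and [M * d] factors give
    [0]. *)
Lemma bracket2_mul_nilpotent n z d : n ^+ d = 0 -> bracket n (bracket n z) = 0 ->
  exists k, (n * z) ^+ k = 0.
Proof.
move=> nd0 /eqP; rewrite subr_eq0 => /eqP cn; rewrite -/(GRing.comm _ _) in cn.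
have [M cM] := bracket_nilpotent nd0 cn; set c := bracket n z in cn cM *.
have cnX i j : GRing.comm (n ^+ i) (c ^+ j) by apply/commrX/commr_sym/commrX/commr_sym.
have nzn j : n * z * n ^+ j = n ^+ j * (n * z - j%:R *: c).
  case: j => [|j]; first by rewrite mulr1 mul1r scale0r subr0.
  have := bracket_comm_exp j cn; rewrite -/c => /(canLR (addrK _)) => eq_z.
  rewrite -mulrA -eq_z mulrBr mulrBr mulrA -exprS exprSr mulrA; congr (_ - _).
  by rewrite -!scalerAr mulrA cn -mulrA -exprS (cnX j.+1 1%N).
have step j k : exists x, (n * z) ^+ k * n ^+ j = n ^+ j * (- (j%:R *: c)) ^+ k + n ^+ j.+1 * x.
  elim: k => [|k [x IH]]; first by exists 0; rewrite mul1r mulr1 mulr0 addr0.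
  exists (z * (- (j%:R *: c)) ^+ k + (n * z - j.+1%:R *: c) * x).
  rewrite exprS -mulrA IH mulrDr [n * z * (n ^+ j * _)]mulrA nzn.
  rewrite [n * z * (n ^+ j.+1 * _)]mulrA nzn [_ * (z * _ + _)]mulrDr addrA -!mulrA; congr (_ + _).
  rewrite [n ^+ j.+1]exprSr -mulrA -mulrDr; congr (_ * _).
  by rewrite exprS mulrBl mulNr addrC mulrA.
have drop j : exists x, (n * z) ^+ (M * j) = n ^+ j * x.
  elim: j => [|j [x IH]]; first by exists 1; rewrite muln0 mulr1.
  have [y def_y] := step j M; exists (y * x).
  by rewrite mulnS exprD IH mulrA def_y exprNn exprZn cM scaler0 !mulr0 add0r mulrA.
by have [x def_x] := drop d; exists (M * d)%N; rewrite def_x nd0 mul0r.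
Qed.

End BracketIdentities.

(** * Integrality of the eigenvalues of [h] *)

Section SemisimplePartOfTriple.
Variables (F : fieldType) (m : nat).
Hypothesis F0 : [pchar F] =i pred0.
Local Notation A := 'M[F]_m.+1.
Variables (n y : A) (d : nat).
Let h := bracket n y.
Hypothesis nd0 : n ^+ d = 0.
Hypothesis hn : bracket h n = 2%:R *: n.
Implicit Types (v w : A) (l : seq int).

Let natF0 k : (k%:R == 0 :> F) = (k == 0)%N.
Proof. by move/pcharf0P: F0. Qed.

Definition intpoly l : {poly F} := \prod_(a <- l) ('X - (a%:~R)%:P).

Let hp l := horner_mx h (intpoly l).

Let hp_cons a l : hp (a :: l) = (h - (a%:~R)%:M) * hp l.
Proof. by rewrite /hp /intpoly big_cons rmorphM rmorphB /= horner_mx_X horner_mx_C. Qed.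

Let hp_cat l1 l2 : hp (l1 ++ l2) = hp l1 * hp l2.
Proof. by rewrite /hp /intpoly big_cat rmorphM. Qed.

Let scalar_mul (a : F) v : a%:M * v = a *: v.
Proof. exact: mul_scalar_mx. Qed.

Let mul_scalar (a : F) v : v * a%:M = a *: v.
Proof. exact: mul_mx_scalar. Qed.

Let h_n : h * n = n * h + 2%:R *: n.
Proof. by rewrite -hn /bracket addrC subrK. Qed.

Let hX k (a : int) : (h - (a%:~R)%:M) * n ^+ k = n ^+ k * (h - ((a - k.*2%:Z)%:~R)%:M).
Proof.
elim: k => [|k IH]; first by rewrite mulr1 mul1r subr0.
rewrite exprSr mulrA IH -mulrA -mulrA; congr (_ * _).
rewrite mulrBl mulrBr h_n scalar_mul mul_scalar -addrA; congr (_ + _).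
rewrite -scalerBl -scaleNr; congr (_ *: _).
have -> : a - k.+1.*2%:Z = a - k.*2%:Z - 2 by lia.
by rewrite [in RHS]rmorphB /= opprB.
Qed.

Let hpX k l : hp l * n ^+ k = n ^+ k * hp (map (fun a => a - k.*2%:Z) l).
Proof.
elim: l => [|a l IH]; first by rewrite /hp /intpoly big_nil rmorph1 mulr1 mul1r.
by rewrite map_cons !hp_cons -mulrA IH mulrA hX -mulrA.
Qed.

Let n_y k : n ^+ k.+1 * y - y * n ^+ k.+1 = k.+1%:R *: ((h - k%:R%:M) * n ^+ k).
Proof.
elim: k => [|k IH]; first by rewrite !expr1 scale1r raddf0 subr0 mulr1.
have -> : n ^+ k.+2 * y - y * n ^+ k.+2 =
    n * (n ^+ k.+1 * y - y * n ^+ k.+1) + h * n ^+ k.+1.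
  rewrite (exprS n k.+1); move: (n ^+ k.+1) => nk.
  by rewrite mulrBr /h /bracket mulrBl !mulrA addrA subrK.
rewrite IH -scalerAr mulrA mulrBr mul_scalar.
have -> : n * h = h * n - 2%:R *: n by rewrite h_n addrK.
rewrite !mulrBl -!scalerAl -!mulrA -!exprS scalar_mul !scalerBr !scalerA.
move: (n ^+ k.+1) (y * n ^+ k.+2) (n * (y * _)) => u v t; apply/matrixP => i j; rewrite !mxE.
by rewrite -[k.+2]addn2 -[k.+1]addn1 !natrD; ring.
Qed.

Let lowest j w : n * w = 0 ->
  (exists v, hp (map Posz (iota 0 j)) * w = n ^+ j * v) /\
  n * (hp (map Posz (iota 0 j)) * w) = 0.
Proof.
move=> nw0; elim: j => [|j [[v IH] nIH]].
  by rewrite /hp /intpoly big_nil rmorph1 !mul1r; split=> //; exists w; rewrite mul1r.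
have hpS : hp (map Posz (iota 0 j.+1)) = (h - j%:R%:M) * hp (map Posz (iota 0 j)).
  rewrite -addn1 iotaD map_cat add0n hp_cat /hp -rmorphM mulrC rmorphM.
  by congr (_ * _); rewrite /intpoly big_seq1 rmorphB /= horner_mx_X horner_mx_C -pmulrn.
rewrite hpS -mulrA IH; split.
  (* By [n_y], [(j + 1) (h - j) n^j v = n^(j+1) y v - y n^(j+1) v], and the last term vanishes
     because [n^j v] lies in the kernel of [n]. *)
  exists (j.+1%:R^-1 *: (y * v)); rewrite -scalerAr.
  have := n_y j; move/(congr1 (fun u => j.+1%:R^-1 *: (u * v))).
  rewrite -scalerAl scalerA mulVf ?natF0 // scale1r -mulrA => <-.
  by rewrite mulrBl -!mulrA exprS -[n * _ * v]mulrA -IH nIH mulr0 subr0 -exprS.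
have /(congr1 ( *%R^~ (n ^+ j * v))) : n * (h - j%:R%:M) = (h - j.+2%:R%:M) * n.
  have := hX 1 j.+2%:Z; rewrite expr1 -pmulrn => ->; congr (_ * (_ - _%:M)).
  by rewrite pmulrn; congr (_%:~R); lia.
by rewrite -!mulrA => ->; rewrite -IH nIH mulr0.
Qed.

Let annihilate j : exists l, forall v, n ^+ j * v = 0 -> hp l * v = 0.
Proof.
elim: j => [|j [l IH]]; first by exists [::] => v; rewrite mul1r => ->; rewrite mulr0.
(* The integers [0, ..., d - 1] suffice on [ker n], where [n^j v] lies; moving the product across
   [n ^+ j] shifts them by [- 2 j]. *)
exists (l ++ map (fun a => a - j.*2%:Z) (map Posz (iota 0 d))) => v nv0.
rewrite hp_cat -mulrA; apply: IH; rewrite mulrA -hpX -mulrA.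
have [|[u ->] _] := @lowest d (n ^+ j * v); first by rewrite mulrA -exprS.
by rewrite nd0 mul0r.
Qed.

(* The eigenvalues of [h] on [ker n] are natural numbers, because [h - k] maps
   [ker n \cap im n^k] into [im n^(k+1)]; then one climbs the kernels of [n^j]. *)
Lemma integral_eigenvalues : exists l : seq int, \prod_(a <- l) (h - (a%:~R)%:M) = 0.
Proof.
have [l hl0] := annihilate d; exists l.
have := hl0 1; rewrite mulr1 nd0 => /(_ erefl); rewrite mulr1 => hl.
rewrite -[RHS]hl /hp /intpoly rmorph_prod; apply: eq_bigr => a _.
by rewrite rmorphB /= horner_mx_X horner_mx_C.
Qed.

End SemisimplePartOfTriple.

(** Each column of [cokermx B] is a functional vanishing on [W], rewritten as a trace against a
    matrix [Q j]. *)
Lemma trace_separates (F : fieldType) m (W : 'M[F]_m -> Prop) (n : 'M[F]_m) :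
    is_subspace W -> ~ W n ->
  exists Q : 'M[F]_m, (forall x, W x -> \tr (Q *m x) = 0) /\ \tr (Q *m n) != 0.
Proof.
move=> subW nWn; have [B defB] := subspace_mx_basis subW.
pose Q j : 'M[F]_m := \matrix_(a, b) cokermx B (mxvec_index b a) j.
have trQ j x : \tr (Q j *m x) = (mxvec x *m cokermx B) 0 j.
  rewrite mxE (reindex _ (curry_mxvec_bij m m)) /=.
  transitivity (\sum_p x p.1 p.2 * cokermx B (mxvec_index p.1 p.2) j); last first.
    by apply: eq_bigr => -[b a] _; rewrite mxvecE.
  rewrite -(pair_bigA _ (fun b a => x b a * cokermx B (mxvec_index b a) j)) exchange_big /=.
  by apply: eq_bigr => a _; rewrite mxE; apply: eq_bigr => b _; rewrite mxE mulrC.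
have [j nz_j] : exists j, (mxvec n *m cokermx B) 0 j != 0.
  apply: NNPP => no_j; apply: nWn; apply/defB; rewrite submxE; apply/eqP/rowP => j.
  by rewrite [RHS]mxE; apply/eqP; apply: contraT => nz; case: no_j; exists j.
exists (Q j); split=> [x /defB|]; last by rewrite trQ.
by rewrite submxE trQ => /eqP->; rewrite mxE.
Qed.

Lemma gen_weightZ (F : fieldType) (V : lmodType F) (D : {linear V -> V}) a k b v :
  gen_weight D a k v -> gen_weight D a k (b *: v).
Proof. by rewrite /gen_weight linearZ /= => ->; rewrite scaler0. Qed.

Section WeightComponents.
Variables (F : fieldType) (m : nat).
Local Notation A := 'M[F]_m.+1.
Variables (h : A) (s : seq F) (e : F -> A).
Hypothesis spec : spectral_family h s e.
Implicit Types z : A.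

(** On [u = e a * z * e b], [shift (a - b)] is left multiplication by [h - a] minus right
    multiplication by [h - b]; these commute and both act nilpotently. *)
Lemma sandwich_weight a b z : a \in s -> b \in s ->
  exists k, gen_weight (bracket h) (a - b) k (e a * z * e b).
Proof.
move=> a_s b_s; have [_ _ [k wt_e] _ poly_e] := spec.
have comm_e c : c \in s -> GRing.comm (h - c%:M) (e c).
  move=> c_s; have [_ [p ->]] := poly_e c c_s.
  rewrite -{1}(horner_mx_X h) -(horner_mx_C h) -rmorphB.
  by rewrite /GRing.comm -!rmorphM mulrC.
have main N i j u : (i + j <= N)%N -> (h - a%:M) ^+ i * u = 0 ->
    u * (h - b%:M) ^+ j = 0 -> gen_weight (bracket h) (a - b) N u.
  elim: N i j u => [|N IH] [|i] [|j] u // le_N u1 u2;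
    do ?by [rewrite mul1r in u1; rewrite u1 /gen_weight linear0
           |rewrite mulr1 in u2; rewrite u2 /gen_weight linear0].
  rewrite /gen_weight iterSr.
  have -> : shift (bracket h) (a - b) u = (h - a%:M) * u - u * (h - b%:M).
    rewrite /shift /= /bracket mulrBl mulrBr scalerBl.
    rewrite (mul_scalar_mx a u : a%:M * u = _) (mul_mx_scalar b u : u * b%:M = _).
    by rewrite !opprB addrACA [RHS]addrACA; congr (_ + _); rewrite addrC.
  rewrite linearB /= [X in X - _](IH i j.+1) ?[X in _ - X](IH i.+1 j) ?subr0 //.
  - by move: le_N; rewrite addnS ltnS.
  - by rewrite mulrA u1 mul0r.
  - by rewrite -mulrA -exprS.
  - by rewrite mulrA -exprSr.
  - by rewrite -mulrA u2 mulr0.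
exists (k + k)%N; apply: (main _ k k) => //; first by rewrite !mulrA wt_e ?mul0r.
rewrite -mulrA (_ : e b * _ = 0) ?mulr0 //.
by have := wt_e b b_s; rewrite (commrX k (commr_sym (comm_e b b_s))).
Qed.

Lemma sandwich_sum z : z = \sum_(p <- [seq (a, b) | a <- s, b <- s]) e p.1 * z * e p.2.
Proof.
have [_ sum_e _ _ _] := spec; rewrite -{1}[z]mul1r -{1}[1 * z]mulr1 -sum_e big_allpairs.
rewrite -mulrA mulr_suml; apply: eq_bigr => a _ /=.
by rewrite mulrA mulr_sumr.
Qed.

End WeightComponents.

Section JacobsonMorozov.
Variables (L : closedFieldType) (m : nat).
Hypothesis L0 : [pchar L] =i pred0.
Local Notation A := 'M[L]_m.+1.
Variable g : A -> Prop.
Hypothesis subg : is_subspace g.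
Hypothesis brg : forall x y, g x -> g y -> g (bracket x y).
Hypothesis nondeg : forall x, g x -> (forall y, g y -> \tr (x * y) = 0) -> x = 0.
Implicit Types (n x y z h : A).

Lemma mxtrace_bracket2 n z y :
  \tr (bracket n (bracket n z) * y) = \tr (z * bracket n (bracket n y)).
Proof.
have flip x y' : \tr (bracket n x * y') = - \tr (x * bracket n y').
  have -> : bracket n x = - bracket x n by rewrite /bracket opprB.
  by rewrite mulNr raddfN /= mxtrace_bracket.
by rewrite !flip opprK.
Qed.

(** [(ad n)^2] is symmetric for the trace form. If [n] were not in its image, a functional
    [tr (Q x)] would vanish on the image but not at [n]; a [z] in [g] representing it has
    [(ad n)^2 z = 0], so [n z] is nilpotent and [tr (z n) = 0], a contradiction. The factor [- 2]
    gives [[h, n] = 2 n] for [h = [n, y]]. *)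
Lemma ex_ad2_preimage n : g n -> n ^+ m.+1 = 0 ->
  exists2 y, g y & bracket n (bracket n y) = - 2%:R *: n.
Proof.
move=> gn n0; pose W x := exists2 y, g y & bracket n (bracket n y) = x.
have subW : is_subspace W.
  split=> [|_ _ [y gy <-] [z gz <-]|a _ [y gy <-]].
  - by exists 0; [apply: subspace0 | rewrite !bracket0].
  - by exists (y + z); [apply: subspaceD | rewrite (bracketD n y z) bracketD].
  - by exists (a *: y); [apply: subspaceZ | rewrite !bracketZ].
suff [y gy def_n] : W n.
  by exists (- 2%:R *: y); [apply: subspaceZ | rewrite !bracketZ def_n].
apply: NNPP => nWn; have [Q [QW Qn]] := trace_separates subW nWn.
have [z gz def_z] := trace_form_represents subg nondeg Q.
have Tz0 : bracket n (bracket n z) = 0.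
  apply: nondeg => [|y gy]; first by do 2 apply: brg => //.
  rewrite mxtrace_bracket2 -[RHS](QW (bracket n (bracket n y))); last by exists y.
  by apply: def_z; do 2 apply: brg => //.
have [k nzk] := bracket2_mul_nilpotent L0 n0 Tz0.
case/eqP: Qn; rewrite -def_z // -[RHS](nilpotent_trace0 nzk).
exact: mxtraceC.
Qed.

Section NilpotentWeight.
Variables (h : A) (s : seq L) (e : L -> A).
Hypothesis spec : spectral_family h s e.

Let pairs := [seq (a, b) | a <- s, b <- s].

Let pairsP p : p \in pairs -> p.1 \in s /\ p.2 \in s.
Proof. by case/allpairsP=> q [q1 q2 ->]. Qed.

(** [y ^+ r] has weight [- 2 r], while the weights of [ad h] are the finitely many differences of
    eigenvalues of [h]; some [- 2 d] is not among them. *)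
Lemma weight_nilpotent y : (exists k, gen_weight (bracket h) (- 2%:R) k y) ->
  exists d, y ^+ d = 0.
Proof.
case=> k wt_y.
have wtX r : exists k, gen_weight (bracket h) (- 2%:R * r%:R) k (y ^+ r).
  elim: r => [|r [k' IH]].
    by exists 1%N; rewrite expr0 /gen_weight /= /shift mulr0 scale0r subr0 /=
      /bracket mulr1 mul1r subrr.
  exists (k' + k)%N; rewrite exprSr -[r.+1]addn1 natrD mulrDr mulr1.
  by apply: gen_weight_mul => //; apply: bracketM.
pose p : {poly L} := \prod_(q <- pairs) ('X - (q.1 - q.2)%:P).
have [||d nz] := @ex_nonroot L (fun r => - 2%:R * r%:R) p.
- have two0 : - 2%:R != 0 :> L by rewrite oppr_eq0; have /pcharf0P-> := L0.
  by move=> i j /(mulfI two0); apply: char0_natr_inj.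
- by apply/monic_neq0/monic_prod_XsubC.
exists d; pose I0 (x : A) := x = 0.
have subI0 : is_subspace I0 by split=> [|u v -> ->|a v ->]; rewrite /I0 ?addr0 ?scaler0.
have [kd wt_d] := wtX d.
(* The terms sum to [0]. Rescaling [- y ^+ d] by [0] and its components by [1] is consistent, as
   their weights differ, and leaves [y ^+ d = 0]. *)
pose l : seq (L * L * A) := (- 2%:R * d%:R, 0, - (y ^+ d)) ::
  [seq (q.1 - q.2, 1, e q.1 * y ^+ d * e q.2) | q <- pairs].
have : I0 (\sum_(x <- l) x.1.2 *: x.2); last first.
  rewrite big_cons big_map /= scale0r add0r.
  by under eq_bigr do rewrite scale1r; rewrite -(sandwich_sum spec).
apply: (gen_weight_rescale (D := bracket h) subI0).
- by move=> v ->; apply: bracket0.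
- move=> x; rewrite inE => /orP[/eqP-> /=|/mapP[q /pairsP[q1 q2] ->]] /=.
    by exists kd; rewrite -scaleN1r; apply: gen_weightZ.
  by apply: (sandwich_weight spec).
- have far q : q \in pairs -> q.1 - q.2 != - 2%:R * d%:R.
    move=> q_in; apply: contraNneq nz => eq_q; rewrite /p (big_rem q) //= hornerM.
    by rewrite hornerXsubC eq_q subrr mul0r.
  move=> x x'; rewrite !inE => /orP[/eqP->|/mapP[q q_in ->]]
    /orP[/eqP->|/mapP[q' q'_in ->]] //=.
    by move=> eq_q; case/eqP: (far q' q'_in).
  by move=> eq_q; case/eqP: (far q q_in).
- by rewrite big_cons big_map /= -(sandwich_sum spec) addNr.
Qed.

End NilpotentWeight.

(** Keeping only the component of weight [- 2] of [y] makes it nilpotent and leaves it in [g]. The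
    equation persists because [(ad n)^2] raises weights by [4] and its right side has weight [2]. *)
Lemma ex_nilpotent_ad2_preimage n : g n -> n ^+ m.+1 = 0 ->
  exists y, [/\ g y, y ^+ m.+1 = 0 & bracket n (bracket n y) = - 2%:R *: n].
Proof.
move=> gn n0; have [y gy Ty] := ex_ad2_preimage gn n0.
set h := bracket n y in Ty; have gh : g h by apply: brg.
have hn : bracket h n = 2%:R *: n.
  by rewrite -[LHS]opprK -[2%:R]opprK scaleNr -Ty /bracket opprB.
have [r def_r] := closed_field_poly_normal (char_poly h).
have [|s [e [spec _]]] := @ex_spectral_family _ _ h r.
  have := Cayley_Hamilton h; rewrite {1}def_r.
  rewrite (monicP (char_poly_monic h)) scale1r rmorph_prod /= => <-.
  by apply: eq_bigr => a _; rewrite rmorphB /= horner_mx_X horner_mx_C.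
pose pairs := [seq (a, b) | a <- s, b <- s].
have pairsP q : q \in pairs -> q.1 \in s /\ q.2 \in s.
  by case/allpairsP=> q' [q1 q2 ->].
pose c q := e q.1 * y * e q.2.
pose sel (q : L * L) : L := (q.1 - q.2 == - 2%:R)%:R.
pose y2 := \sum_(q <- pairs) sel q *: c q.
have wt_c q : q \in pairs -> exists k, gen_weight (bracket h) (q.1 - q.2) k (c q).
  by case/pairsP=> q1 q2; apply: (sandwich_weight spec).
have wt_y2 : exists k, gen_weight (bracket h) (- 2%:R) k y2.
  have : forall l, {subset l <= pairs} ->
      exists k, gen_weight (bracket h) (- 2%:R) k (\sum_(q <- l) sel q *: c q).
    elim=> [|q l IH] sub_l; first by exists 0%N; rewrite big_nil.
    have [k1 wt1] : exists k, gen_weight (bracket h) (- 2%:R) k (sel q *: c q).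
      rewrite /sel; case: eqP => [<-|_]; last by exists 0%N; rewrite scale0r.
      by rewrite scale1r; apply/wt_c/sub_l/mem_head.
    have [|k2 wt2] := IH; first by move=> x x_l; apply: sub_l; rewrite inE x_l orbT.
    exists (maxn k1 k2); rewrite big_cons /gen_weight linearD /=.
    rewrite (gen_weight_leq (leq_maxl k1 k2) wt1) (gen_weight_leq (leq_maxr k1 k2) wt2).
    exact: addr0.
  by apply.
exists y2; split.
- have := @gen_weight_rescale _ _ (bracket h) g subg _ [seq (q.1 - q.2, sel q, c q) | q <- pairs].
  rewrite !big_map /= -(sandwich_sum spec y); apply=> //.
  + by move=> v gv; apply: brg.
  + by move=> _ /mapP[q q_in ->]; apply: wt_c.
  + by move=> _ _ /mapP[q q_in ->] /mapP[q' q'_in ->] /= eq_q; rewrite /sel eq_q.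
- have [d yd0] := weight_nilpotent spec wt_y2.
  exact: mx_nilpotent_exp yd0.
pose I0 (x : A) := x = 0.
have subI0 : is_subspace I0 by split=> [|u v -> ->|a v ->]; rewrite /I0 ?addr0 ?scaler0.
have wt_n : gen_weight (bracket h) 2%:R 1 n by rewrite /gen_weight /= /shift /= hn subrr.
have wt_br a k z : gen_weight (bracket h) a k z ->
    gen_weight (bracket h) (a + 2%:R) k.+1 (bracket n z).
  move=> wt_z; have -> : bracket n z = n * z - z * n by [].
  have w1 : gen_weight (bracket h) (a + 2%:R) k.+1 (n * z).
    by rewrite addrC -[k.+1]add1n; apply: gen_weight_mul => //; apply: bracketM.
  have w2 : gen_weight (bracket h) (a + 2%:R) k.+1 (z * n).
    by rewrite -[k.+1]addn1; apply: gen_weight_mul => //; apply: bracketM.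
  by rewrite /gen_weight linearB [X in X - _]w1 [X in _ - X]w2 subrr.
pose T z := bracket n (bracket n z).
(* The terms sum to [2 n + T y = 0]; the scalars [1] and [sel] retain exactly the part of weight
   [2]. *)
pose l : seq (L * L * A) := (2%:R, 1, 2%:R *: n) ::
  [seq (q.1 - q.2 + 2%:R + 2%:R, sel q, T (c q)) | q <- pairs].
have T_sum (f : L * L -> A) : \sum_(q <- pairs) T (f q) = T (\sum_(q <- pairs) f q).
  by rewrite /T !bracket_sum.
have : I0 (\sum_(x <- l) x.1.2 *: x.2); last first.
  rewrite big_cons big_map /= scale1r; under eq_bigr do rewrite /T -!bracketZ.
  rewrite -/(T _) T_sum -/y2 => sum0; apply/eqP.
  by rewrite scaleNr -addr_eq0 addrC; apply/eqP.
apply: (gen_weight_rescale (D := bracket h) subI0).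
- by move=> v ->; apply: bracket0.
- move=> x; rewrite inE => /orP[/eqP-> /=|/mapP[q q_in ->]] /=.
    by exists 1%N; apply: gen_weightZ.
  by have [k wt_k] := wt_c q q_in; exists k.+2; apply/wt_br/wt_br.
- have selE q : (q.1 - q.2 + 2%:R + 2%:R == 2%:R) = (q.1 - q.2 == - 2%:R).
    by rewrite -subr_eq0 addrK -[- 2%:R]add0r -subr_eq opprK.
  move=> x x'; rewrite !inE => /orP[/eqP->|/mapP[q q_in ->]]
    /orP[/eqP->|/mapP[q' q'_in ->]] //=.
  + by move/eqP; rewrite eq_sym selE /sel => ->.
  + by move/eqP; rewrite selE /sel => ->.
  + by move/addIr/addIr; rewrite /sel => ->.
- rewrite big_cons big_map /= T_sum -(sandwich_sum spec y) [T y]Ty scaleNr.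
  exact: subrr.
Qed.

End JacobsonMorozov.

(** * Descent to the base field *)

Lemma interpolate_at0 (L : fieldType) (r : seq L) : uniq r ->
  exists a : L -> L, forall q : {poly L}, (size q <= size r)%N ->
    \sum_(z <- r) a z * q.[z] = q`_0.
Proof.
elim: r => [|w r IH] /=.
  by exists (fun=> 0) => q; rewrite leqn0 size_poly_eq0 => /eqP->; rewrite big_nil coef0.
case/andP=> wNr /IH[a def_a].
(* Writing [q = q1 * ('X - w) + q.[w]], one has [q(0) = q(w) - w q1(0)], and the values of [q1] on
   [r] are [(q(z) - q(w)) / (z - w)]. *)
pose a' z := - w * a z / (z - w).
exists (fun z => if z == w then 1 - \sum_(z <- r) a' z else a' z) => q sz_q.
have /factor_theorem[q1 def_q] : root (q - q.[w]%:P) w.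
  by rewrite /root hornerD hornerN hornerC subrr.
have sz_q1 : (size q1 <= size r)%N.
  have [->|nz_q1] := eqVneq q1 0; first by rewrite size_poly0.
  have : (size (q1 * ('X - w%:P))%R <= (size r).+1)%N.
    rewrite -def_q (leq_trans (size_polyD _ _)) // geq_max sz_q size_polyN.
    by rewrite (leq_trans (size_polyC_leq1 _)).
  by rewrite (size_Mmonic nz_q1 (monicXsubC w)) size_XsubC addn2.
have def_q' : q = q1 * ('X - w%:P) + q.[w]%:P by rewrite -def_q subrK.
have r_w z : z \in r -> z != w by apply: contraTneq => ->.
rewrite big_cons eqxx mulrBl mul1r mulr_suml.
rewrite [X in _ + X](eq_big_seq (fun z => a' z * q.[z])); last by move=> z /r_w/negPf /= ->.
have -> : q`_0 = q.[w] - w * q1`_0.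
  by rewrite -!horner_coef0 {1}def_q' !hornerE; ring.
rewrite -(def_a q1) // mulr_sumr -addrA; congr (_ + _).
rewrite -sumrN -[RHS]sumrN -big_split; apply: eq_big_seq => z z_r /=.
have nz : z - w != 0 by rewrite subr_eq0 r_w.
have -> : q.[z] = q1.[z] * (z - w) + q.[w] by rewrite {1}def_q' !hornerE.
by rewrite /a'; move: q.[w] q1.[z] => qw q1z; field.
Qed.

(** * Primitive elements and separable minimal polynomials *)

Section Conjugates.
Variables (K L : fieldType) (f : {rmorphism K -> L}).
Hypothesis K0 : [pchar K] =i pred0.
Hypothesis algL : algebraic_ext f.

Lemma ex_primitive (s : seq L) : exists theta, forall x, x \in s ->
  exists p : {poly K}, (map_poly f p).[theta] = x.
Proof.
elim: s => [|y s [theta IH]]; first by exists 0.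
have [p [nz_p px]] := algL theta; have [q [nz_q qy]] := algL y.
have [n [[p1 Dx] [q1 Dy]]] := pchar0_PET nz_p px nz_q qy K0.
exists (y *+ n - theta) => x; rewrite inE => /orP[/eqP-> | /IH[p2 <-]].
  by exists q1.
exists (p2 \Po p1); rewrite map_comp_poly horner_comp; congr (_.[_]).
exact: Dx.
Qed.

Lemma ex_minimal_poly (theta : L) : exists2 mu : {poly K}, mu != 0 &
  forall p, ((map_poly f p).[theta] == 0) = (mu %| p).
Proof.
have [p [nz_p p0]] := algL theta.
have [mu [nz_mu mu0 min_mu]] : exists mu : {poly K},
    [/\ mu != 0, (map_poly f mu).[theta] = 0 &
        forall p, p != 0 -> (map_poly f p).[theta] = 0 -> (size mu <= size p)%N].
  elim: {p}(size p) {-2}p (leqnn (size p)) nz_p p0 => [|k IH] p le_p nz_p p0.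
    by rewrite leqn0 size_poly_eq0 (negPf nz_p) in le_p.
  have [min_p|] := classic (forall q, q != 0 -> (map_poly f q).[theta] = 0 ->
    (size p <= size q)%N); first by exists p; split=> //; apply/eqP.
  move=> not_min; case: (not_all_ex_not _ _ not_min) => q not_q.
  case: (imply_to_and _ _ not_q) => nz_q not_q0.
  case: (imply_to_and _ _ not_q0) => q0 /negP; rewrite -ltnNge => lt_q.
  by apply: (IH q) => //; [rewrite -ltnS (leq_trans lt_q) | apply/eqP].
exists mu => // q; apply/eqP/idP => [q0|/dvdpP[q1 ->]]; last first.
  by rewrite rmorphM hornerM mu0 mulr0.
rewrite /dvdp -[_ == 0]negbK; apply/negP => nz_r.
have := min_mu _ nz_r; rewrite leqNgt ltn_modp nz_mu => h; suff : false by [].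
apply: h; have := congr1 (fun q => (map_poly f q).[theta]) (divp_eq q mu).
by rewrite /= q0 rmorphD rmorphM hornerD hornerM mu0 mulr0 add0r.
Qed.

Lemma minimal_poly_separable (theta : L) (mu : {poly K}) : mu != 0 ->
  (forall p, ((map_poly f p).[theta] == 0) = (mu %| p)) -> separable_poly mu.
Proof.
move=> nz_mu min_mu; rewrite unlock /coprimep.
set d := gcdp _ _; have /dvdpP[q def_mu] : d %| mu := dvdp_gcdl _ _.
have nz_mu' : mu^`() != 0.
  apply/eqP => /polyP mu'0; have : (size mu <= 1)%N.
    apply/leq_sizeP => -[//|j] _; have := mu'0 j; rewrite coef_deriv coef0.
    by move/eqP; rewrite -mulr_natr mulf_eq0; have /pcharf0P-> := K0; rewrite orbF => /eqP.
  have mu0 : (map_poly f mu).[theta] = 0 by apply/eqP; rewrite min_mu.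
  move/size1_polyC => def_c; move: mu0; rewrite def_c map_polyC hornerC => /eqP.
  by rewrite fmorph_eq0 => /eqP c0; rewrite def_c c0 polyC0 eqxx in nz_mu.
have d_theta : (map_poly f d).[theta] != 0.
  rewrite min_mu; apply/negP => mu_d; have := dvdp_trans mu_d (dvdp_gcdr _ _).
  by move/(dvdp_leq nz_mu'); rewrite leqNgt lt_size_deriv.
have : mu %| q.
  have : (map_poly f mu).[theta] == 0 by rewrite min_mu.
  by rewrite def_mu rmorphM hornerM mulf_eq0 (negPf d_theta) orbF -def_mu min_mu.
have nz_q : q != 0 by apply: contraNneq nz_mu => q0; rewrite def_mu q0 mul0r.
have nz_d : d != 0 by apply: contraNneq nz_mu => d0; rewrite def_mu d0 mulr0.
move/(dvdp_leq nz_q); rewrite def_mu size_mul // -[X in (_ <= X)%N]addn0.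
have : (0 < size d)%N by rewrite size_poly_gt0.
have : (0 < size q)%N by rewrite size_poly_gt0.
case: (size d) (size q) => [|[|k]] // [|j] //.
by rewrite !addnS /=; lia.
Qed.

End Conjugates.

(* Evaluating at all the conjugates of a primitive element and interpolating at
   [0] replaces an [L]-point by an affine combination of conjugate points that
   has coordinates in [K]. *)
Lemma conjugate_combination (K : fieldType) (L : closedFieldType)
    (f : {rmorphism K -> L}) m (y : 'M[L]_m) :
    [pchar K] =i pred0 -> algebraic_ext f ->
  let ev z : {poly K} -> L := horner_eval z \o map_poly f in
  exists (Y : 'M[{poly K}]_m) (theta : L) (r : seq L) (a : L -> L),
    [/\ map_mx (ev theta) Y = y,
        forall p, ev theta p = 0 -> forall z, z \in r -> ev z p = 0,
        \sum_(z <- r) a z = 1 &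
        \sum_(z <- r) a z *: map_mx (ev z) Y = map_mx f (map_mx (coefp 0) Y)].
Proof.
move=> K0 algL ev.
have [theta prim] := ex_primitive K0 algL [seq y ij.1 ij.2 | ij <- enum {: 'I_m * 'I_m}].
have [mu nz_mu min_mu] := ex_minimal_poly algL theta.
have sep_mu := minimal_poly_separable K0 nz_mu min_mu.
have mu_theta : (map_poly f mu).[theta] = 0 by apply/eqP; rewrite min_mu.
have [P defP] : exists P : 'I_m * 'I_m -> {poly K}, forall ij,
    ev theta (P ij) = y ij.1 ij.2 /\ (size (P ij) < size mu)%N.
  apply: (fin_all_exists (P := fun ij p => ev theta p = y ij.1 ij.2 /\ (size p < size mu)%N)).
  move=> ij; have [|p def_p] := prim (y ij.1 ij.2).
    by apply/mapP; exists ij; rewrite ?mem_enum.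
  (* Reduction modulo [mu] keeps the value at [theta] and bounds the size by the number of roots of
     [mu], as interpolation requires. *)
  exists (p %% mu); rewrite ltn_modp; split=> //; rewrite -def_p /ev /= /horner_eval.
  by rewrite {2}(divp_eq p mu) rmorphD rmorphM hornerD hornerM mu_theta mulr0 add0r.
have [r def_mu] := closed_field_poly_normal (map_poly f mu).
have nz_lead : lead_coef (map_poly f mu) != 0 by rewrite lead_coef_eq0 map_poly_eq0.
have root_r z : (z \in r) = ((map_poly f mu).[z] == 0).
  by rewrite -[RHS]/(root (map_poly f mu) z) def_mu rootZ // root_prod_XsubC.
have uniq_r : uniq r.
  rewrite -separable_prod_XsubC; move: sep_mu; rewrite -(separable_map f) def_mu.
  by rewrite unlock derivZ coprimepZl // coprimepZr.
have size_r : size mu = (size r).+1.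
  by rewrite -(size_map_poly f) def_mu size_scale // size_prod_XsubC.
have [a def_a] := interpolate_at0 uniq_r.
exists (\matrix_(i, j) P (i, j)), theta, r, a; split.
- by apply/matrixP => i j; rewrite !mxE; case: (defP (i, j)).
- move=> p /eqP; rewrite /ev /= /horner_eval min_mu => /dvdpP[q ->] z.
  by rewrite root_r rmorphM hornerM => /eqP->; rewrite mulr0.
- rewrite -[RHS](coef1 _ 0) -def_a; last first.
    by rewrite size_poly1; case: (r) root_r => // /(_ theta); rewrite mu_theta eqxx.
  by apply: eq_bigr => z _; rewrite hornerC mulr1.
- apply/matrixP => i j; rewrite summxE !mxE /= -coef_map -def_a.
    by apply: eq_bigr => z _; rewrite !mxE.
  by rewrite size_map_poly -ltnS -size_r; case: (defP (i, j)).
Qed.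

Section Descent.
Variables (K : fieldType) (L : closedFieldType) (f : {rmorphism K -> L}) (m : nat).
Hypothesis K0 : [pchar K] =i pred0.
Hypothesis algL : algebraic_ext f.
Variable S : seq {mpoly K[m.+1 * m.+1]}.
Local Notation G := (Lpoints f S).
Hypothesis subG : is_subgroup G.

Let L0 : [pchar L] =i pred0.
Proof. by move=> p; rewrite (fmorph_pchar f) K0. Qed.

Let SL := [seq map_mpoly f p | p <- S].

Lemma Lpoints_closed (B : 'M[L]_m.+1) :
  G B <-> B \in unitmx /\ forall p, p \in SL -> p.@[mxpt B] = 0.
Proof.
split=> [[uB SB]|[uB SB]]; split=> // p; first by case/mapP=> q Sq ->; apply: SB.
by move=> Sp; apply: SB; apply: map_f.
Qed.

Lemma Kpoints_map (B : 'M[K]_m.+1) : Kpoints S B <-> G (map_mx f B).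
Proof.
have evf (p : {mpoly K[m.+1 * m.+1]}) : (map_mpoly f p).@[mxpt (map_mx f B)] = f p.@[mxpt B].
  elim/mpoly_alg_ind: p => [c|i|p q IHp IHq|p q IHp IHq].
  - by rewrite map_mpolyC !mevalC.
  - by rewrite map_mpolyX !mevalXU /mxpt -map_mxvec mxE.
  - by rewrite mevalD !rmorphD /= IHp IHq.
  - by rewrite mevalM !rmorphM /= IHp IHq.
rewrite /Kpoints /Lpoints map_unitmx.
split=> -[uB SB]; split=> // p Sp; first by rewrite evf SB ?rmorph0.
by apply: (fmorph_inj f); rewrite -evf SB ?rmorph0.
Qed.

Lemma map_nexp (B : 'M[K]_m.+1) : map_mx f (nexp B) = nexp (map_mx f B).
Proof.
rewrite /nexp raddf_sum; apply: eq_bigr => i _ /=.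
by rewrite map_mxZ fmorphV rmorph_nat rmorphXn.
Qed.

(* A nilpotent [y] is used so that [y \in Lie G] becomes the polynomial
   condition [exp y \in G], which is inherited by the conjugates of [y]. *)
Lemma descend_ad2_preimage (n : 'M[K]_m.+1) (y : 'M[L]_m.+1) :
    Lie G y -> y ^+ m.+1 = 0 ->
    bracket (map_mx f n) (bracket (map_mx f n) y) = - 2%:R *: map_mx f n ->
  exists2 y0 : 'M[K]_m.+1, Lie G (map_mx f y0) &
    bracket n (bracket n y0) = - 2%:R *: n.
Proof.
move=> Ly y0 Ty.
have [Y [theta [r [a [defY conj sum_a comb]]]]] := conjugate_combination y K0 algL.
pose ev z : {rmorphism {poly K} -> L} := horner_eval z \o map_poly f.
rewrite -![horner_eval _ \o _]/(ev _ : _ -> _) in defY.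
have conj_mx p q (B : 'M[{poly K}]_(p, q)) z : z \in r ->
    map_mx (ev theta) B = 0 -> map_mx (ev z) B = 0.
  move=> z_r /matrixP B0; apply/matrixP => i j; rewrite !mxE.
  by apply: conj z_r; have := B0 i j; rewrite !mxE.
have evC z c : ev z c%:P = f c by rewrite /= /horner_eval map_polyC hornerC.
(* The exponential of [Y] over the ring [{poly K}]: the equations of [G] at it become polynomials
   over [K] vanishing at [theta], to which [conj] applies. *)
pose E : 'M[{poly K}]_m.+1 := \sum_(i < m.+1) (i`!%:R^-1)%:P *: Y ^+ i.
have mapE z : map_mx (ev z) E = nexp (map_mx (ev z) Y).
  rewrite /E raddf_sum; apply: eq_bigr => i _ /=.
  by rewrite map_mxZ evC fmorphV rmorph_nat rmorphXn.
pose nP : 'M[{poly K}]_m.+1 := map_mx polyC n.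
have map_nP z : map_mx (ev z) nP = map_mx f n.
  by apply/matrixP => i j; rewrite !mxE evC.
have evS (q : {mpoly K[m.+1 * m.+1]}) z :
    ev z (mmap polyC (mxpt E) q) = (map_mpoly f q).@[mxpt (nexp (map_mx (ev z) Y))].
  elim/mpoly_alg_ind: q => [c|i|p q IHp IHq|p q IHp IHq].
  - by rewrite mmapC evC map_mpolyC mevalC.
  - by rewrite mmapX mmap1U map_mpolyX mevalXU -mapE /mxpt -map_mxvec mxE.
  - by rewrite mmapD !rmorphD IHp IHq.
  - by rewrite !rmorphM IHp IHq.
have Yz_nil z : z \in r -> map_mx (ev z) Y ^+ m.+1 = 0.
  by move=> z_r; rewrite -rmorphXn; apply: conj_mx => //; rewrite rmorphXn /= defY.
have LYz z : z \in r -> Lie G (map_mx (ev z) Y).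
  move=> z_r; apply: (exp_Lie L0 subG); first exact: Yz_nil.
  split; first by apply: nexp_unit => //; apply: Yz_nil.
  move=> p Sp; rewrite -evS; apply: conj z_r; rewrite evS defY.
  have := Lie_exp L0 subG Lpoints_closed 1 y0 Ly; rewrite scale1r.
  by case=> _; apply.
have TYz z : z \in r -> bracket (map_mx f n) (bracket (map_mx f n) (map_mx (ev z) Y)) =
    - 2%:R *: map_mx f n.
  move=> z_r; apply/eqP; rewrite scaleNr -addr_eq0; apply/eqP.
  rewrite -(map_nP z).
  have map_br w (B C : 'M[{poly K}]_m.+1) :
      map_mx (ev w) (bracket B C) = bracket (map_mx (ev w) B) (map_mx (ev w) C).
    by rewrite /bracket rmorphB !rmorphM.
  have ev2 w : map_mx (ev w) (2%:R *: nP) = 2%:R *: map_mx (ev w) nP.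
    by rewrite map_mxZ rmorph_nat.
  rewrite -!map_br -ev2 -raddfD; apply: conj_mx => //.
  by rewrite raddfD /= ev2 !map_br map_nP defY Ty scaleNr addNr.
exists (map_mx (coefp 0) Y).
  rewrite -comb; apply: (subspace_sum_seq (Lie_subspace G)) => z z_r.
  by apply: (subspaceZ (Lie_subspace G)); apply: LYz.
apply: (@map_mx_inj _ _ f); rewrite map_mxZ rmorphN rmorph_nat.
have map_br (B C : 'M[K]_m.+1) :
    map_mx f (bracket B C) = bracket (map_mx f B) (map_mx f C).
  by rewrite /bracket rmorphB !rmorphM.
rewrite !map_br -comb !bracket_sum.
rewrite (eq_big_seq (fun z => a z *: (- 2%:R *: map_mx f n))) => [|z z_r].
  by rewrite -scaler_suml sum_a scale1r.
by rewrite !bracketZ TYz.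
Qed.

End Descent.

(** * The value of the word *)

Definition torus (F : fieldType) m (s : seq F) (e : F -> 'M[F]_m.+1) (wt : F -> int) (t : F) :=
  \sum_(a <- s) t ^ wt a *: e a.

Section Torus.
Variables (F : fieldType) (m : nat).
Hypothesis F0 : [pchar F] =i pred0.
Local Notation A := 'M[F]_m.+1.
Variables (h n : A) (s : seq F) (e : F -> A) (wt : F -> int).
Hypothesis spec : spectral_family h s e.
Hypothesis int_s : forall a, a \in s -> a = (wt a)%:~R.
Hypothesis hn : bracket h n = 2%:R *: n.

Local Notation torus := (torus s e wt).

Lemma torus1 : torus 1 = 1.
Proof.
have [_ sum_e _ _ _] := spec; rewrite -[RHS]sum_e; apply: eq_bigr => a _.
by rewrite exp1rz scale1r.
Qed.

Lemma torusM t u : t != 0 -> u != 0 -> torus (t * u) = torus t * torus u.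
Proof.
move=> t0 u0; rewrite {3}/torus mulr_sumr; apply: eq_big_seq => a a_s.
by rewrite -scalerAr (spectral_eigen (fun a => t ^ wt a) spec) // scalerA expfzMl mulrC.
Qed.

(** The product has generalized weight [a - b]; as the projectors commute with [h], it is also an
    eigenvector of [ad h] for the weight [2] of [n]. *)
Lemma sandwich_eq0 a b : a \in s -> b \in s -> wt a != wt b + 2 -> e a * n * e b = 0.
Proof.
move=> a_s b_s nab; have [k wt_k] := sandwich_weight spec n a_s b_s.
pose I0 (x : A) := x = 0.
have subI0 : is_subspace I0 by split=> [|u v -> ->|c v ->]; rewrite /I0 ?addr0 ?scaler0.
apply: (@gen_weight_shift_mem _ _ (bracket h) I0 subI0 _ _ 2%:R k 1 _ _ wt_k).
- by move=> v ->; apply: bracket0.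
- apply: contraNneq nab => ab2; rewrite -subr_eq0 -(intr_char0_eq0 _ F0).
  by rewrite opprD addrA !rmorphB /= -!int_s // ab2 subrr.
have comm_e c : c \in s -> bracket h (e c) = 0.
  move=> c_s; have [_ _ _ _ poly_e] := spec; have [_ [p ->]] := poly_e c c_s.
  rewrite /bracket -{1 4}(horner_mx_X h) -!rmorphM mulrC; exact: subrr.
rewrite /I0 -[LHS]/(bracket h (e a * n * e b) - 2%:R *: (e a * n * e b)) !bracketM.
rewrite !comm_e // hn mul0r mulr0 add0r addr0.
by rewrite -scalerAr -scalerAl subrr.
Qed.

Lemma torus_nilpotent t : t != 0 -> torus t * n = (t ^+ 2 *: n) * torus t.
Proof.
move=> t0; have [_ sum_e _ _ _] := spec.
transitivity (\sum_(a <- s) \sum_(b <- s) t ^ wt a *: (e a * n * e b)).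
  rewrite /torus mulr_suml; apply: eq_bigr => a _.
  by rewrite -[LHS]mulr1 -sum_e mulr_sumr; apply: eq_bigr => b _; rewrite -!scalerAl.
rewrite exchange_big mulr_sumr; apply: eq_big_seq => b b_s /=.
rewrite -[t ^+ 2 *: n]mul1r -sum_e !mulr_suml; apply: eq_big_seq => a a_s.
rewrite -!scalerAr -scalerAl scalerA.
have [->|/(sandwich_eq0 a_s b_s)->] := eqVneq (wt a) (wt b + 2); last by rewrite !scaler0.
by rewrite expfzDr.
Qed.

End Torus.

Lemma spectral_family_map (K L : fieldType) (f : {rmorphism K -> L}) m
    (h : 'M[K]_m.+1) s e : spectral_family h s e ->
  exists2 e' : L -> 'M[L]_m.+1, spectral_family (map_mx f h) (map f s) e' &
    forall a, a \in s -> e' (f a) = map_mx f (e a).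
Proof.
move=> [uniq_s sum_e [k wt_e] orth poly_e].
pose e' b := map_mx f (e (nth 0 s (index b (map f s)))).
have e'E a : a \in s -> e' (f a) = map_mx f (e a).
  by move=> a_s; rewrite /e' index_map ?nth_index //; apply: fmorph_inj.
exists e' => //; split.
- by rewrite map_inj_uniq //; apply: fmorph_inj.
- rewrite big_map (eq_big_seq (fun a => map_mx f (e a))) //.
  by rewrite -raddf_sum sum_e; apply: map_mx1.
- exists k => _ /mapP[a a_s ->]; rewrite e'E // -map_scalar_mx.
  by rewrite -rmorphB -rmorphXn -rmorphM wt_e // rmorph0.
- move=> _ _ /mapP[a a_s ->] /mapP[b b_s ->]; rewrite !e'E // -rmorphM orth //.
  by rewrite (inj_eq (fmorph_inj f)); case: eqP => // _; rewrite raddf0.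
- move=> _ /mapP[a a_s ->]; rewrite e'E // map_mx_eq0.
  have [nz [p def_e]] := poly_e a a_s; split=> //; exists (map_poly f p).
  by rewrite def_e map_horner_mx.
Qed.

(** [L] plays the algebraic closure of [K]: connectedness and semisimplicity are imposed on the
    [L]-points of the equations [S], while [u] and the [Z i] are [K]-points. *)
Theorem theorem5p6 (n : nat) (hn : (2 <= n)%N) (w : word n)
  (hw1 : in_F1 w) (hw2 : ~ in_F2 w)
  (K : fieldType) (hK : [pchar K] =i pred0)
  (L : closedFieldType) (f : {rmorphism K -> L}) (hL : algebraic_ext f)
  (m : nat) (S : seq {mpoly K[m * m]})
  (hG : is_subgroup (Lpoints f S))
  (hconn : zconnected (Lpoints f S))
  (hss : mx_semisimple (Lpoints f S))
  (u : 'M[K]_m) (hu : Kpoints S u) (hunip : mx_unipotent u) :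
  exists Z : 'I_n -> 'M[K]_m,
    (forall i, Kpoints S (Z i)) /\ word_eval Z w = u.
Proof.
case: m S hG hconn hss u hu hunip => [|m] S subG _ ssG u Gu unip_u.
  by exists (fun=> u); split=> //; rewrite [LHS]flatmx0 [RHS]flatmx0.
have L0 : [pchar L] =i pred0 by move=> p; rewrite (fmorph_pchar f) hK.
have defG := @Lpoints_closed K L f m S.
have nil_u : (u - 1) ^+ m.+1 = 0.
  have [k uk0] := unip_u; apply: (@mx_nilpotent_exp _ _ k); rewrite -[RHS]uk0.
  by elim: k {uk0} => //= k IH; rewrite exprS IH.
have [N [_ N0 expN]] :
    exists N, [/\ True, N ^+ m.+1 = 0 & nexp N = 1 + (u - 1)].
  by apply: (@nexp_onto K m hK (fun=> True)).
rewrite addrC subrK in expN.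
pose NL := map_mx f N.
have NL0 : NL ^+ m.+1 = 0 by rewrite /NL -rmorphXn /= N0 rmorph0.
have LN : Lie (Lpoints f S) NL.
  by apply: (exp_Lie L0 subG NL0); rewrite -map_nexp expN; apply/Kpoints_map.
have subL := Lie_subspace (Lpoints f S).
have brL := @Lie_bracket L m (Lpoints f S).
have nondeg x : Lie (Lpoints f S) x ->
    (forall y, Lie (Lpoints f S) y -> \tr (x * y) = 0) -> x = 0.
  by move=> Lx x0; apply: (trace_radical_eq0 L0 subG defG ssG).
have [y [Ly y0 Ty]] := ex_nilpotent_ad2_preimage L0 subL brL nondeg LN NL0.
have [y0' Ly0 Ty0] := descend_ad2_preimage hK hL subG Ly y0 Ty.
set h := bracket N y0' in Ty0.
have hN : bracket h N = 2%:R *: N.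
  by rewrite -[LHS]opprK -[2%:R]opprK scaleNr -Ty0 /bracket opprB.
have Lh : Lie (Lpoints f S) (map_mx f h).
  by rewrite /h /bracket rmorphB !rmorphM; apply: brL.
have [l prod0] := integral_eigenvalues hK N0 hN.
have [|s [e [spec s_l]]] := @ex_spectral_family _ _ h (map intr l); first by rewrite big_map.
(* Recovers an integer from its image in [K]; the default [0] never matters, since all of [s] lies
   in the image of [l]. *)
pose wt (a : K) : int := nth 0 l (index a (map intr l)).
have int_s a : a \in s -> a = (wt a)%:~R.
  move=> /s_l a_l; rewrite /wt -[RHS](nth_map _ (0 : K)) ?nth_index //.
  by rewrite -(size_map (intr : int -> K)) index_mem.
have Gtorus t : t != 0 -> Kpoints S (torus s e wt t).
  move=> t0; apply/(@Kpoints_map K L f m S).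
  have [e' spec' e'E] := spectral_family_map f spec.
  pose wt' b := wt (nth 0 s (index b (map f s))).
  have wt'E a : a \in s -> wt' (f a) = wt a.
    by move=> a_s; rewrite /wt' index_map ?nth_index //; apply: fmorph_inj.
  have := @torus_mem L m L0 _ _ subG defG (map_mx f h) (map f s) e' (f t) wt' Lh spec'.
  rewrite big_map fmorph_eq0 (eq_big_seq (fun a => map_mx f (t ^ wt a *: e a))).
    rewrite -raddf_sum; apply=> // _ /mapP[a a_s ->].
    by rewrite wt'E // {1}(int_s a a_s) rmorph_int.
  by move=> a a_s; rewrite wt'E // e'E // map_mxZ fmorphXz.
have GE c : Kpoints S (nexp (c *: N)).
  apply/(@Kpoints_map K L f m S); rewrite map_nexp map_mxZ.
  exact: (Lie_exp L0 subG defG).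
have [|||||Z defZ Zw] := @word_eval_surjective n w K m.+1
    (fun c => nexp (c *: N)) (torus s e wt) hw1 hw2 hK.
- by rewrite scale0r nexp0.
- by move=> a b; apply: nexpZD.
- exact: (torus1 wt spec).
- exact: (torusM wt spec).
- move=> t c t0; apply: nexp_conj; rewrite -scalerAr (torus_nilpotent hK spec int_s hN t0).
  by rewrite -!scalerAl scalerA mulrC.
exists Z; split; last by rewrite Zw scale1r.
move=> i; have [c [t t0 ->]] := defZ i.
apply/(@Kpoints_map K L f m S); rewrite map_mxM.
by have [_ _ grpM _] := subG; apply: grpM; apply/Kpoints_map; [apply: GE | apply: Gtorus].
Qed.
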